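(* Let $(X,\xi)$ be stationary under $\mathbf P$ and suppose that $\operatorname{conv}(\operatorname{supp}\xi)=\mathbb R^d$ $\mathbf P$-a.e. Let $N$, $D$, $S$, $D^\circ$ be constructed from $\xi$ as in the context. Let $T$ be a random vector in $[0,1)^d$ such that, under $\mathbf P$, the conditional distribution of $T$ given $(X,\xi)$ is $(\theta_{-S}\xi)(\,\cdot\mid[0,1)^d)$. Define $$(X^\circ,\xi^\circ):=\theta_T\theta_{-S}(X,\xi),\qquad d\mathbf P^\circ:=\frac{\theta_{-S}\xi([0,1)^d)}{|D|}\,d\mathbf P .$$ Then, under $\mathbf P^\circ$: (i) $(X^\circ,\xi^\circ)$ is mass-stationary; (ii) the conditional distribution of $T$ given $(X^\circ,\xi^\circ)$ is uniform on $[0,1)^d$; (iii) the conditional distribution of $S$ given $((X^\circ,\xi^\circ),T)$ is uniform on the finite set $D^\circ$. Moreover, $(X^\circ,\xi^\circ)$ under $\mathbf P^\circ$ is the Palm version of $(X,\xi)$ under $\mathbf P$.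
   Context: Setting. $(\Omega,\mathcal F)$ is a measurable space carrying the random elements (extended if further randomization is needed); $\mathbf P$ and $\mathbf P^\circ$ are measures on it, not necessarily probability measures, with integrals $\mathbf E$, $\mathbf E^\circ$. $\lambda$ is Lebesgue measure on $\mathbb R^d$. For a measure $\mu$ and a set $A$ with $0<\mu(A)<\infty$, $\mu(\cdot\mid A):=\mu(\cdot\cap A)/\mu(A)$. The symbol $\overset{D}{=}$ denotes equality of distributions (under the indicated measure). $(E,\mathcal E)$ is a measurable space on which the additive group $\mathbb R^d$ acts by maps $\theta_t$, $t\in\mathbb R^d$, such that $(t,x)\mapsto\theta_t x$ is measurable from $\mathbb R^d\times E$ to $E$. $X$ is a random element in $(E,\mathcal E)$ and $\xi$ is a random (locally finite) measure on $\mathbb R^d$. For a measure, $\theta_t\xi(B):=\xi(B+t)$ for Borel $B\subseteq\mathbb R^d$, and $\theta_t(X,\xi):=(\theta_tX,\theta_t\xi)$. The same conventions apply to $(X^\circ,\xi^\circ)$. All distributions of $(X,\xi)$ and $(X^\circ,\xi^\circ)$ under $\mathbf P$ and $\mathbf P^\circ$ are understood to be $\sigma$-finite. Stationarity: $(X,\xi)$ is stationary under $\mathbf P$ if $\theta_t(X,\xi)\overset{D}{=}(X,\xi)$ under $\mathbf P$ for all $t\in\mathbb R^d$. Mass-stationarity: for a pair $(X^\circ,\xi^\circ)$ such that $0$ is in the support of $\xi^\circ$ $\mathbf P^\circ$-a.e., $(X^\circ,\xi^\circ)$ is mass-stationary under $\mathbf P^\circ$ if for all bounded Borel $C\subset\mathbb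 R^d$ with $\lambda(C)>0$ and $\lambda(\partial C)=0$, $$(\theta_{V_C}(X^\circ,\xi^\circ),V_C+U_C)\overset{D}{=}((X^\circ,\xi^\circ),U_C)\quad\text{under }\mathbf P^\circ,$$ where under $\mathbf P^\circ$ the conditional distribution of $U_C$ given $(X^\circ,\xi^\circ)$ is uniform on $C$ and the conditional distribution of $V_C$ given $((X^\circ,\xi^\circ),U_C)$ is $\xi^\circ(\cdot\mid C-U_C)$, with $C-x:=\{y-x:y\in C\}$. Palm version: $(X^\circ,\xi^\circ)$ under $\mathbf P^\circ$ is the Palm version of a stationary pair $(X,\xi)$ under $\mathbf P$ if for each nonnegative measurable $f$ and some (equivalently each) Borel $B\subset\mathbb R^d$ with $0<\lambda(B)<\infty$, $$\mathbf E^\circ[f(X^\circ,\xi^\circ)]=\mathbf E\Big[\int_B f(\theta_t(X,\xi))\,\xi(dt)\Big]\Big/\lambda(B).$$ Construction of $N,D,S,D^\circ$: $N$ is the simple point process on $\mathbb Z^d$ with a point at $i\in\mathbb Z^d$ if and only if $\xi(i+[0,1)^d)>0$. Partition $\mathbb Z^d$ into the Voronoi cells obtained by associating each $i\in\mathbb Z^d$ with the point of $N$ closest to $i$, choosing the lexicographically lowest one if there are several closest points; each cell contains exactly one point of $N$. Let $D_i$ be the cell containing $i$ and $S_i$ the vector from the $N$-point in $D_i$ to $i$. Put $D:=D_0$, $S:=S_0$, $D^\circ:=S+D$. (So $S\in D^\circ$; under the convex hull assumption $|D|$, the number of elements of $D$, is $\mathbf P$-a.e. finite.) *)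

(* Defs.v *)
From HB Require Import structures.
From mathcomp Require Import all_boot all_order all_algebra.
From mathcomp Require Import all_classical all_reals all_analysis.
From mathcomp Require Import measurable_realfun.

Set Implicit Arguments.
Unset Strict Implicit.
Unset Printing Implicit Defensive.
Import Order.TTheory GRing.Theory Num.Theory.
Import numFieldNormedType.Exports.
Local Open Scope classical_set_scope.
Local Open Scope ring_scope.

(* R^d is 'rV[R]_d; its measurable sets are the Borel sets. *)
HB.instance Definition _ (R : realType) (d : nat) :=
  Measurable.copy 'rV[R]_d (g_sigma_algebraType (@open 'rV[R]_d)).

Section borel_rV.
Context {R : realType}.

Lemma open_measurable_rV d (U : set 'rV[R]_d) : open U -> measurable U.
Proof. by move=> oU; exact: sub_sigma_algebra. Qed.

Lemma measurable_coord d (k : 'I_d) :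
  measurable_fun setT (fun x : 'rV[R]_d => x ord0 k).
Proof.
apply: (measurability _ (RGenOpens.measurableE R)).
move=> _ [_ [a [b ->]] <-]; rewrite setTI; apply: open_measurable_rV.
have /continuousP := @coord_continuous R 1 d ord0 k; apply.
exact: interval_open.
Qed.

Let ratball d (p : 'rV[rat]_d * rat) : set 'rV[R]_d :=
  [set y | forall k, `|ratr (p.1 ord0 k) - y ord0 k| < ratr p.2].

Lemma open_rV_bigcup d (U : set 'rV[R]_d) : open U ->
  U = \bigcup_(p in [set p | ratball p `<=` U]) ratball p.
Proof.
move=> oU; apply/seteqP; split => [x Ux|x [p pU]]; last exact: pU.
move: oU; rewrite openE => /(_ _ Ux)/nbhs_ballP[e /= e0 eU].
have /rat_in_itvoo[q /itvP qe] : 0 < e / 2 by rewrite divr_gt0.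
have q0 : 0 < ratr q :> R by rewrite qe.
have /choice[c cP] : forall k : 'I_d, exists r : rat,
    `|ratr r - x ord0 k| < ratr q.
  move=> k; have /rat_in_itvoo[r /itvP xr] :
    x ord0 k < x ord0 k + ratr q by rewrite ltrDl.
  exists r; rewrite ger0_norm ?subr_ge0 ?(ltW (_ : _ < ratr r)) ?xr//.
  by rewrite ltrBlDl xr.
exists (\row_k c k, q); last by move=> k /=; rewrite mxE; exact: cP.
move=> y yq /=; apply: eU; split=> // i k; rewrite ord1 /ball/=.
rewrite -(subrKA (ratr (c k))) (le_lt_trans (ler_normD _ _))//.
rewrite (splitr e) ltrD//.
  by rewrite distrC (lt_trans (cP k))// qe.
by have := yq k; rewrite /= mxE => /lt_trans; apply; rewrite qe.
Qed.

Lemma measurable_fun_rV d dT (T : measurableType dT) (f : T -> 'rV[R]_d) :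
  (forall k, measurable_fun setT (fun t => f t ord0 k)) -> measurable_fun setT f.
Proof.
move=> mf; apply: (@measurability _ _ _ _ _ _ (@open 'rV[R]_d)) => //.
move=> _ [U oU <-]; rewrite setTI (open_rV_bigcup oU) preimage_bigcup.
rewrite bigcup_mkcond; apply: countable_bigcupT_measurable => // p.
case: ifPn => _; last exact: measurable0.
have -> : f @^-1` ratball p = \bigcap_(k in [set: 'I_d])
    ((fun t => f t ord0 k) @^-1` ball (ratr (p.1 ord0 k) : R) (ratr p.2)).
  by apply/seteqP; split => [t + k _|t + k]; apply.
apply: fin_bigcap_measurable => // k _; rewrite -[X in measurable X]setTI.
by apply: mf => //; exact: measurable_ball.
Qed.

End borel_rV.

Section lebesgue_rV.
Context {R : realType}.

Definition cons_rV d (p : R * 'rV[R]_d) : 'rV[R]_d.+1 :=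
  \row_j if unlift ord0 j is Some k then p.2 ord0 k else p.1.

Lemma measurable_cons_rV d : measurable_fun setT (@cons_rV d).
Proof.
apply: measurable_fun_rV => j; case: (unliftP ord0 j) => [k|] ->.
  have -> : (fun p => @cons_rV d p ord0 (lift ord0 k)) =
      (fun x : 'rV[R]_d => x ord0 k) \o snd.
    by apply/funext => p /=; rewrite mxE liftK.
  by apply: measurableT_comp; [exact: measurable_coord|exact: measurable_snd].
have -> : (fun p => @cons_rV d p ord0 ord0) = fst.
  by apply/funext => p /=; rewrite mxE unlift_none.
exact: measurable_fst.
Qed.

Definition uncons_rV d (x : 'rV[R]_d.+1) : R * 'rV[R]_d :=
  (x ord0 ord0, \row_k x ord0 (lift ord0 k)).

Lemma measurable_uncons_rV d : measurable_fun setT (@uncons_rV d).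
Proof.
apply: measurable_fun_pair; first exact: measurable_coord.
apply: measurable_fun_rV => k /=.
under eq_fun do rewrite mxE.
exact: measurable_coord.
Qed.

Section cons_measure.
Variables (d : nat) (m : {sigma_finite_measure set 'rV[R]_d -> \bar R}).

Definition cons_measure : set 'rV[R]_d.+1 -> \bar R :=
  pushforward (lebesgue_measure \x m)%E (@cons_rV d).

Let cons_measure0 : cons_measure set0 = 0%E.
Proof. by rewrite /cons_measure /pushforward preimage_set0 measure0. Qed.

Let cons_measure_ge0 A : (0 <= cons_measure A)%E.
Proof. exact: (measure_ge0 (lebesgue_measure \x m)%E). Qed.

Let cons_measure_sigma_additive : semi_sigma_additive cons_measure.
Proof.
move=> F mF tF mUF; have mc := @measurable_cons_rV d.
rewrite /cons_measure /pushforward preimage_bigcup.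
apply: (@measure_semi_sigma_additive _ _ _ (lebesgue_measure \x m)%E).
- by move=> n; rewrite -[X in measurable X]setTI; exact: mc.
- apply/trivIsetP => /= i j _ _ ij; rewrite -preimage_setI.
  by move/trivIsetP : tF => /(_ _ _ _ _ ij) ->//; rewrite preimage_set0.
- by rewrite -preimage_bigcup -[X in measurable X]setTI; exact: mc.
Qed.

HB.instance Definition _ := isMeasure.Build _ _ _ cons_measure
  cons_measure0 cons_measure_ge0 cons_measure_sigma_additive.

Let cons_measure_sigma_finite : sigma_finite setT cons_measure.
Proof.
have consK : cancel (@cons_rV d) (@uncons_rV d).
  move=> [r x]; rewrite /uncons_rV mxE unlift_none; congr pair.
  by apply/rowP => k; rewrite !mxE liftK.
have /sigma_finiteP[F [TF ndF Foo]] := sigma_finiteT (@lebesgue_measure R).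
have /sigma_finiteP[G [TG ndG Goo]] := sigma_finiteT m.
exists (fun i => @uncons_rV d @^-1` (F i `*` G i)).
  apply/seteqP; split => // x _.
  have [i _ Fi] : (\bigcup_i F i) (uncons_rV x).1 by rewrite -TF.
  have [j _ Gj] : (\bigcup_i G i) (uncons_rV x).2 by rewrite -TG.
  exists (maxn i j) => //; split.
    by move: (uncons_rV x).1 Fi; exact/subsetPset/ndF/leq_maxl.
  by move: (uncons_rV x).2 Gj; exact/subsetPset/ndG/leq_maxr.
move=> i; have [mF Fioo] := Foo i; have [mG Gioo] := Goo i; split.
  rewrite -[X in measurable X]setTI; apply: measurable_uncons_rV => //.
  exact: measurableX.
rewrite /cons_measure /pushforward -comp_preimage (_ : _ \o _ = id);
  last exact/funext.
by rewrite product_measure1E// lte_mul_pinfty// ge0_fin_numE.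
Qed.

HB.instance Definition _ := Measure_isSigmaFinite.Build _ _ _ cons_measure
  cons_measure_sigma_finite.

End cons_measure.

(* Lebesgue measure on R^d: the d-fold product of the Lebesgue measure on R. *)
Fixpoint lebesgue_rV d : {sigma_finite_measure set 'rV[R]_d -> \bar R} :=
  match d with
  | 0 => \d_(0 : 'rV[R]_0)
  | d'.+1 => cons_measure (lebesgue_rV d')
  end.

Lemma lebesgue_rV_box d (a b : 'rV[R]_d) : (forall k, a ord0 k <= b ord0 k) ->
  lebesgue_rV d [set x | forall k, a ord0 k <= x ord0 k < b ord0 k] =
  (\prod_k (b ord0 k - a ord0 k))%:E.
Proof.
elim: d a b => [|d IHd] a b ab.
  rewrite big_ord0 /= diracE mem_set//= => k; by case: k.
rewrite /= /cons_measure /pushforward.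
pose a' : 'rV[R]_d := \row_k a ord0 (lift ord0 k).
pose b' : 'rV[R]_d := \row_k b ord0 (lift ord0 k).
pose B' := [set x : 'rV[R]_d | forall k, a' ord0 k <= x ord0 k < b' ord0 k].
have -> : @cons_rV d @^-1` [set x | forall k, a ord0 k <= x ord0 k < b ord0 k] =
    `[a ord0 ord0, b ord0 ord0[%classic `*` B'.
  apply/seteqP; split => [[r x] /= rx|[r x] /= [rab xB] k].
    split => [|k]; first by have := rx ord0; rewrite mxE unlift_none in_itv.
    by have := rx (lift ord0 k); rewrite !mxE liftK.
  rewrite mxE; case: (unliftP ord0 k) => [j|] ->; last by rewrite in_itv in rab.
  by have := xB j; rewrite !mxE.
have mB' : measurable B'.
  have -> : B' = \bigcap_(k in [set: 'I_d]) ((fun x : 'rV[R]_d => x ord0 k) @^-1`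
      `[a' ord0 k, b' ord0 k[).
    apply/seteqP; split => [x xB k _|x xB k] /=; first by rewrite in_itv; exact: xB.
    by have := xB k I; rewrite /= in_itv.
  apply: fin_bigcap_measurable => // k _; rewrite -[X in measurable X]setTI.
  by apply: measurable_coord => //; exact: measurable_itv.
have lab : lebesgue_measure `[a ord0 ord0, b ord0 ord0[%classic =
    (b ord0 ord0 - a ord0 ord0)%:E.
  rewrite lebesgue_measure_itv/= lte_fin.
  by case: ltgtP (ab ord0) => // -> _; rewrite subrr.
rewrite [LHS]product_measure1E// [X in (X * _)%E]lab IHd.
  rewrite big_ord_recl EFinM; congr (_ * _%:E)%E.
  by apply: eq_bigr => k _; rewrite !mxE.
by move=> k; rewrite !mxE.
Qed.

End lebesgue_rV.

Section random_measure.
Context {R : realType} {d : nat}.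

(* Values outside the Borel sets are unconstrained, so elements that agree on
   Borel sets may differ; no measurable set of lf_measure separates them. *)
Record lf_measure := LfMeasure {
  lf_val :> {measure set 'rV[R]_d -> \bar R};
  lf_locally_finite : forall B : set 'rV[R]_d,
    measurable B -> bounded_set B -> (lf_val B < +oo)%E }.

Lemma mzero_locally_finite (B : set 'rV[R]_d) :
  measurable B -> bounded_set B -> (@mzero _ 'rV[R]_d R B < +oo)%E.
Proof. by move=> _ _; rewrite /mzero ltry. Qed.

HB.instance Definition _ := gen_eqMixin lf_measure.
HB.instance Definition _ := gen_choiceMixin lf_measure.
HB.instance Definition _ :=
  isPointed.Build lf_measure (LfMeasure mzero_locally_finite).

Definition lf_eval_sets : set (set lf_measure) :=
  \bigcup_(B in [set B : set 'rV[R]_d | measurable B])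
    preimage_set_system setT (fun xi : lf_measure => xi B) measurable.

HB.instance Definition _ :=
  Measurable.copy lf_measure (g_sigma_algebraType lf_eval_sets).

Section shift_measure.
Variables (t : 'rV[R]_d) (xi : lf_measure).

(* (theta_t xi)(B) = xi(B + t), see shift_measureE. *)
Definition shift_measure : set 'rV[R]_d -> \bar R :=
  pushforward xi (fun x => x - t).

Lemma measurable_subrV : measurable_fun setT (fun x : 'rV[R]_d => x - t).
Proof.
apply: measurable_fun_rV => k; under eq_fun do rewrite !mxE.
by apply: measurable_funB; [exact: measurable_coord|exact: measurable_cst].
Qed.

Let shift_measure0 : shift_measure set0 = 0%E.
Proof. by rewrite /shift_measure /pushforward preimage_set0 measure0. Qed.

Let shift_measure_ge0 A : (0 <= shift_measure A)%E.
Proof. exact: (measure_ge0 xi). Qed.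

Let shift_measure_sigma_additive : semi_sigma_additive shift_measure.
Proof.
move=> F mF tF mUF; have mt := measurable_subrV.
rewrite /shift_measure /pushforward preimage_bigcup.
apply: (@measure_semi_sigma_additive _ _ _ xi).
- by move=> n; rewrite -[X in measurable X]setTI; exact: mt.
- apply/trivIsetP => /= i j _ _ ij; rewrite -preimage_setI.
  by move/trivIsetP : tF => /(_ _ _ _ _ ij) ->//; rewrite preimage_set0.
- by rewrite -preimage_bigcup -[X in measurable X]setTI; exact: mt.
Qed.

HB.instance Definition _ := isMeasure.Build _ _ _ shift_measure
  shift_measure0 shift_measure_ge0 shift_measure_sigma_additive.

Lemma shift_measureE (B : set 'rV[R]_d) :
  shift_measure B = xi [set x + t | x in B].
Proof.
rewrite /shift_measure /pushforward; congr (lf_val xi _).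
apply/seteqP; split => [x Bxt|_ [x Bx <-]] /=; last by rewrite addrK.
by exists (x - t) => //; rewrite subrK.
Qed.

Lemma shift_measure_locally_finite (B : set 'rV[R]_d) :
  measurable B -> bounded_set B -> (shift_measure B < +oo)%E.
Proof.
move=> mB [M [Mr bB]]; apply: lf_locally_finite.
  by rewrite -[X in measurable X]setTI; exact: measurable_subrV.
exists (M + `|t|); split => [|r Mtr x /= Bxt]; first by rewrite realD.
rewrite -(subrK t x) (le_trans (ler_normD _ _))// -lerBrDr.
by apply: bB => //; rewrite ltrBrDr.
Qed.

Definition shift_lf : lf_measure := LfMeasure shift_measure_locally_finite.

End shift_measure.

End random_measure.
Arguments lf_measure : clear implicits.

Section sets_rV.
Context {R : realType} {d : nat}.
Implicit Types (A : set 'rV[R]_d) (x y : 'rV[R]_d).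

Definition unit_cube : set 'rV[R]_d := [set x | forall k, 0 <= x ord0 k < 1].

Definition boundary A : set 'rV[R]_d := closure A `\` interior A.

Definition conv_hull A : set 'rV[R]_d := smallest (@convex_set R 'rV[R]_d) A.

Definition msupport (mu : set 'rV[R]_d -> \bar R) : set 'rV[R]_d :=
  [set x | forall U : set 'rV[R]_d, open U -> U x -> (0 < mu U)%E].

Definition edist x y : R := Num.sqrt (\sum_k (x ord0 k - y ord0 k) ^+ 2).

Definition lex_le x y : Prop := x = y \/
  exists k : 'I_d, (forall j : 'I_d, (j < k)%N -> x ord0 j = y ord0 j) /\
            x ord0 k < y ord0 k.

End sets_rV.

(* mu( . | A); meaningful only when 0 < mu A < +oo. *)
Definition mcond {T : Type} {R : realType} (mu : set T -> \bar R) (A : set T)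
    : set T -> \bar R :=
  fun B => (mu (B `&` A) / mu A)%E.

Section voronoi.
Context {R : realType} {d : nat}.
Implicit Types (xi : lf_measure R d) (i p : 'rV[R]_d).

(* Z^d as a subset of R^d. *)
Definition lattice : set 'rV[R]_d := [set i | forall k, i ord0 k \is a Num.int].

Definition occupied xi : set 'rV[R]_d :=
  [set i | lattice i /\ (0 < xi [set (i + x)%R | x in unit_cube])%E].

Definition is_closest (N : set 'rV[R]_d) i p : Prop :=
  N p /\ forall q, N q ->
    edist i p <= edist i q /\ (edist i p = edist i q -> lex_le p q).

(* The default value i is only used when occupied xi is empty. *)
Definition voronoi_point xi i : 'rV[R]_d :=
  xget i (is_closest (occupied xi) i).

Definition voronoi_cell xi i : set 'rV[R]_d :=
  [set j | lattice j /\ voronoi_point xi j = voronoi_point xi i].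

(* The unique point of occupied xi in voronoi_cell xi i is voronoi_point xi i. *)
Definition voronoi_vector xi i : 'rV[R]_d := i - voronoi_point xi i.

End voronoi.

Section distributions.
Local Open Scope ereal_scope.
Context {R : realType}.

Definition eq_distribution {d1 d2 dS} {O1 : measurableType d1}
    {O2 : measurableType d2} {S : measurableType dS}
    (P1 : {measure set O1 -> \bar R}) (Y1 : O1 -> S)
    (P2 : {measure set O2 -> \bar R}) (Y2 : O2 -> S) : Prop :=
  forall A : set S, measurable A -> pushforward P1 Y1 A = pushforward P2 Y2 A.

(* The conditional distribution of Z given Y under P is the random measure K:
   almost everywhere K is the value at Y of a probability kernel k that
   disintegrates the joint distribution of Y and Z. *)
Definition cond_distribution {dO dY dZ} {O : measurableType dO}
    {SY : measurableType dY} {SZ : measurableType dZ}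
    (P : {measure set O -> \bar R}) (Y : O -> SY) (Z : O -> SZ)
    (K : O -> set SZ -> \bar R) : Prop :=
  [/\ measurable_fun setT Y, measurable_fun setT Z &
    exists k : R.-pker SY ~> SZ,
      {ae P, forall w, forall B, measurable B -> K w B = k (Y w) B} /\
      (forall A B, measurable A -> measurable B ->
        P (Y @^-1` A `&` Z @^-1` B) = \int[P]_(w in Y @^-1` A) k (Y w) B)].

End distributions.

Section stationarity.
Local Open Scope ereal_scope.
Context {R : realType} {d : nat} {dE : measure_display} {E : measurableType dE}.
Implicit Types theta : 'rV[R]_d -> E -> E.

Definition measurable_action theta : Prop :=
  [/\ forall x, theta 0%R x = x,
      forall s t x, theta (s + t)%R x = theta s (theta t x) &
      measurable_fun setT (fun p : 'rV[R]_d * E => theta p.1 p.2)].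

Definition shift_pair theta (t : 'rV[R]_d) (y : E * lf_measure R d) :
    E * lf_measure R d :=
  (theta t y.1, shift_lf t y.2).

(* The distribution of a pair is always understood to be sigma-finite. *)
Definition stationary theta {dO} {O : measurableType dO}
    (P : {measure set O -> \bar R}) (Y : O -> E * lf_measure R d) : Prop :=
  [/\ measurable_fun setT Y, sigma_finite setT (pushforward P Y) &
    forall t, eq_distribution P (shift_pair theta t \o Y) P Y].

(* The randomization (U, V) lives on an arbitrary extension pr : O' -> O of
   (O, P); its joint distribution with Y is determined by the two conditional
   distributions, and O' = O * R^d * R^d always carries such U and V. *)
Definition mass_stationary theta {dO} {O : measurableType dO}
    (P : {measure set O -> \bar R}) (Y : O -> E * lf_measure R d) : Prop :=
  [/\ measurable_fun setT Y, sigma_finite setT (pushforward P Y),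
    {ae P, forall w, msupport (Y w).2 0%R} &
    forall C : set 'rV[R]_d, measurable C -> bounded_set C ->
      0 < lebesgue_rV d C -> lebesgue_rV d (boundary C) = 0 ->
    forall (dO' : measure_display) (O' : measurableType dO')
      (P' : {measure set O' -> \bar R}) (pr : O' -> O) (U V : O' -> 'rV[R]_d),
      measurable_fun setT pr ->
      (forall A, measurable A -> pushforward P' pr A = P A) ->
      cond_distribution P' (Y \o pr) U (fun=> mcond (lebesgue_rV d) C) ->
      cond_distribution P' (fun w => (Y (pr w), U w)) V
        (fun w => mcond (Y (pr w)).2 [set (y - U w)%R | y in C]) ->
      eq_distribution
        P' (fun w => (shift_pair theta (V w) (Y (pr w)), (V w + U w)%R))
        P' (fun w => (Y (pr w), U w))].

Definition palm_version theta {dO dO'} {O : measurableType dO}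
    {O' : measurableType dO'}
    (P : {measure set O -> \bar R}) (Y : O -> E * lf_measure R d)
    (P' : {measure set O' -> \bar R}) (Y' : O' -> E * lf_measure R d) : Prop :=
  forall f : E * lf_measure R d -> \bar R,
    measurable_fun setT f -> (forall y, 0 <= f y) ->
  forall B : set 'rV[R]_d, measurable B -> 0 < lebesgue_rV d B < +oo ->
  \int[P']_w f (Y' w) =
  (\int[P]_w \int[(Y w).2]_(t in B) f (shift_pair theta t (Y w)))
    / lebesgue_rV d B.

End stationarity.

(* Main.v *)
(* Let mu be the law of the stationary pair (X, xi), write y for a point of its
   space and eta y for the random measure in y. For G >= 0 put
   I(G) = \int mu(dy) \int (eta y)(dt) G(theta_t y, t). Stationarity makes I
   invariant under translations of the second variable of G, and averaging over
   the unit cube gives I(G) = \int Q(dy) \int dt G(y, t) with Q the Palm measure.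
   This identity (Campbell) yields the Palm formula, the sigma-finiteness of Q
   and the exchange formula
     \int Q(dy) \int (eta y)(dt) g(y, t) = \int Q(dy) \int (eta y)(dt) g(theta_t y, -t),
   and the latter, with Fubini, mass-stationarity.
   The law of (X°, xi°, T, S) is found by a mass transport on Z^d: moving the
   origin to the nucleus of its cell turns an integral over all positions of the
   nucleus into a sum over the cell of a nucleus located at 0. The density
   (theta_{-S} xi)([0,1)^d) / |D| cancels the normalization of T and makes S
   uniform on that cell, so under P° the pair (X°, xi°) has law Q, T is uniform by
   Campbell's identity and S is uniform on D°. *)
Require Import Defs.
From HB Require Import structures.
From mathcomp Require Import all_boot all_order all_algebra.
From mathcomp Require Import all_classical all_reals all_analysis.
From mathcomp Require Import measurable_realfun.
From mathcomp Require Import ring lra zify.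

Set Implicit Arguments.
Unset Strict Implicit.
Unset Printing Implicit Defensive.
Import Order.TTheory GRing.Theory Num.Theory.
Import numFieldNormedType.Exports.
Local Open Scope classical_set_scope.
Local Open Scope ring_scope.

(** * Mixtures of measures and disintegrations *)

(** Everything is phrased through integrals of nonnegative extended-real functions, so that
    interchanges need only Tonelli and sigma-finite measures; sums over Z^d become integrals against
    [lattice_measure] for the same reason. The price is that the inverse of 0 is [+oo] and that of
    [+oo] is 0: a cancellation is valid only where the quantity is positive and finite, and three
    arguments supply this. The mass of [C - u] is positive when 0 is in the support and [u] is
    interior to [C], which is where the null boundary of [C] enters. The cube mass at the nucleus is
    positive and finite because the conditional law of T is a probability measure. The cell is
    finite because of the convex hull: every occupied point confines the cell to a half-space, and
    the support leaves no direction unbounded. The averaging set in Campbell's identity is the cube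
    that carries T; its volume 1 leaves no constant to track. *)

Section measure_theory.
Local Open Scope ereal_scope.
Context {R : realType}.

(** Inversion is an antitone involution of [[0, +oo]], so [f^-1 > r] means [f < r^-1]; a negative
    [r] gives the whole space. *)
Lemma measurable_inve d (T : measurableType d) (f : T -> \bar R) :
  measurable_fun setT f -> (forall x, 0 <= f x) ->
  measurable_fun setT (fun x => (f x)^-1).
Proof.
move=> mf f0; apply: (measurability _ (ErealGenOInfty.measurableE R)).
move=> _ [_ [r ->] <-]; rewrite setTI.
have [r0|r0] := ltP r 0%R.
  rewrite (_ : _ @^-1` _ = setT)//; apply/seteqP; split => // x _ /=.
  by rewrite in_itv/= andbT (lt_le_trans (_ : _ < 0)) ?lte_fin// inve_ge0.
rewrite (_ : _ @^-1` _ = f @^-1` `]-oo, (r%:E)^-1[).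
  by rewrite -[X in measurable X]setTI; apply: mf => //; exact: emeasurable_itv.
apply/seteqP; split => x /=; rewrite !in_itv/= ?andbT => h.
  by rewrite -[f x]inveK lte_pV2// inE ?inve_ge0// lee_fin.
by rewrite -[r%:E]inveK lte_pV2// inE ?inve_ge0// lee_fin.
Qed.

Lemma measurable_indicE d1 d2 (T1 : measurableType d1) (T2 : measurableType d2)
    (B : set T2) (g : T1 -> T2) : measurable B -> measurable_fun setT g ->
  measurable_fun setT (fun x => (\1_B (g x))%:E : \bar R).
Proof.
move=> mB mg; apply/measurable_EFinP.
rewrite (_ : (fun x => _) = \1_(g @^-1` B)).
  by apply: measurable_indic; rewrite -[X in measurable X]setTI; exact: mg.
by apply/funext => x.
Qed.

Lemma sigma_finite_measure_of d (T : measurableType d)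
    (m : {measure set T -> \bar R}) : sigma_finite setT m ->
  exists m' : {sigma_finite_measure set T -> \bar R}, m = m'.
Proof.
move=> s.
pose h1 := isSFinite.Build _ _ _ (Measure.sort m) (sfinite_measure_sigma_finite s).
pose h2 := isSigmaFinite.Build _ _ _ (Measure.sort m) s.
pose m' := HB.pack_for (SigmaFiniteMeasure.type T R) (Measure.sort m) h1 h2.
by exists m'; exact: eq_measure.
Qed.

(** Sigma-finiteness is a hypothesis here rather than part of the type of the measures, because the
    measures [eta y] below are known to be sigma-finite by a lemma only. *)
Lemma tonelli d1 d2 (T1 : measurableType d1) (T2 : measurableType d2)
    (m1 : {measure set T1 -> \bar R}) (m2 : {measure set T2 -> \bar R})
    (f : T1 * T2 -> \bar R) :
  sigma_finite setT m1 -> sigma_finite setT m2 ->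
  measurable_fun setT f -> (forall x, 0 <= f x) ->
  \int[m1]_x \int[m2]_y f (x, y) = \int[m2]_y \int[m1]_x f (x, y).
Proof.
move=> /sigma_finite_measure_of[m1' ->] /sigma_finite_measure_of[m2' ->] mf f0.
exact: (@fubini_tonelli _ _ _ _ _ m1' m2').
Qed.

Lemma measurable_fun_integral2 d1 d2 (T1 : measurableType d1) (T2 : measurableType d2)
    (m2 : {measure set T2 -> \bar R}) (f : T1 * T2 -> \bar R) :
  sigma_finite setT m2 ->
  measurable_fun setT f -> (forall x, 0 <= f x) ->
  measurable_fun setT (fun x => \int[m2]_y f (x, y)).
Proof.
move=> /sigma_finite_measure_of[m2' ->] mf f0.
exact: (@measurable_fun_fubini_tonelli_F _ _ _ _ _ m2').
Qed.

Section mixture.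
Context d1 d2 (X : measurableType d1) (Z : measurableType d2).
Variables (nu : {measure set X -> \bar R}) (h : X -> R)
  (l : X -> {measure set Z -> \bar R}).
Hypotheses (mh : measurable_fun setT h) (h0 : forall x, (0 <= h x)%R).
Hypothesis ml : forall A, measurable A -> measurable_fun setT (fun x => l x A).

Lemma mixture_measure : exists m : {measure set Z -> \bar R},
  forall A, measurable A -> m A = \int[nu]_x ((h x)%:E * l x A).
Proof.
pose m (A : set Z) : \bar R :=
  \int[nu]_x ((h x)%:E * l x (if `[< measurable A >] then A else set0)).
have m0 : m set0 = 0.
  apply: integral0_eq => x _; rewrite (_ : (if _ then _ else _) = set0).
    by rewrite measure0 mule0.
  by case: ifP.
have mge A : 0 <= m A by apply: integral_ge0 => x _; rewrite mule_ge0// ?lee_fin.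
have msa : semi_sigma_additive m.
  move=> F mF tF mUF; rewrite [X in _ --> X](_ : _ = \sum_(n <oo) m (F n)).
    by apply: is_cvg_nneseries.
  rewrite /m -integral_nneseries//.
  - apply: eq_integral => x _; rewrite asboolT// nneseriesZl//; congr *%E.
    rewrite measure_semi_bigcup//; apply: eq_eseriesr => i _.
    by rewrite asboolT//; exact: mF.
  - by move=> n; rewrite asboolT//; apply: emeasurable_funM; [exact/measurable_EFinP|]; exact: ml.
  - by move=> n x _; rewrite mule_ge0// ?lee_fin.
pose mm := isMeasure.Build _ _ _ m m0 mge msa.
pose m' : {measure set Z -> \bar R} := HB.pack m mm.
by exists m' => A mA; rewrite /= /m asboolT.
Qed.

Import HBNNSimple.

(** Simple functions come first, then monotone convergence, used for [m], for each [l x] and for the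
    outer integral. *)
Lemma integral_mixture (m : {measure set Z -> \bar R}) (f : Z -> \bar R) :
  (forall A, measurable A -> m A = \int[nu]_x ((h x)%:E * l x A)) ->
  measurable_fun setT f -> (forall z, 0 <= f z) ->
  \int[m]_z f z = \int[nu]_x ((h x)%:E * \int[l x]_z f z).
Proof.
move=> mE mf f0.
have mint (g : Z -> \bar R) : measurable_fun setT g -> (forall z, 0 <= g z) ->
    measurable_fun setT (fun x => \int[l x]_z g z).
  by move=> mg g0; apply: measurable_fun_integral_kernel.
have nn (g : {nnsfun Z >-> R}) :
    \int[m]_z (g z)%:E = \int[nu]_x ((h x)%:E * \int[l x]_z (g z)%:E).
  have E (l' : {measure set Z -> \bar R}) : \int[l']_z (g z)%:E =
      \sum_(r \in range g) r%:E * l' (g @^-1` [set r]).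
    under eq_integral do rewrite fimfunE -fsumEFin//.
    rewrite ge0_integral_fsum//; last 2 first.
      - by move=> r; exact/measurable_EFinP/measurableT_comp.
      - by move=> r z _; rewrite EFinM nnfun_muleindic_ge0.
    apply: eq_fsbigr => r _.
    rewrite (integralZl_indic _ (fun r => g @^-1` [set r]))//.
      by rewrite integral_indic// setIT.
    by move=> r0; rewrite preimage_nnfun0.
  rewrite E; under [RHS]eq_integral do rewrite E.
  (* The sum runs over real values [r], and the interchange needs nonnegative terms; for a negative
     [r] the level set of [g] is empty. *)
  have ge0 r (l' : {measure set Z -> \bar R}) : 0 <= r%:E * l' (g @^-1` [set r]).
    have [r0|r0] := leP 0%R r; first by rewrite mule_ge0// ?lee_fin.
    by rewrite preimage_nnfun0// measure0 mule0.
  transitivity (\int[nu]_x (\sum_(r \in range g) ((h x)%:E * (r%:E * l x (g @^-1` [set r]))))).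
    rewrite ge0_integral_fsum//; last 2 first.
      - move=> r; apply: emeasurable_funM; [exact/measurable_EFinP|]; apply: emeasurable_funM => //.
        exact: ml.
      - by move=> r x _; rewrite mule_ge0// ?lee_fin.
    apply: eq_fsbigr => r _; rewrite mE//.
    have [r0|r0] := leP 0%R r; last first.
      rewrite preimage_nnfun0//; under eq_integral do rewrite measure0 mule0.
      under [RHS]eq_integral do rewrite measure0 !mule0.
      by rewrite !integral0 mule0.
    rewrite -ge0_integralZl//.
    - by apply: eq_integral => x _; rewrite muleCA.
    - by apply: emeasurable_funM; [exact/measurable_EFinP|]; exact: ml.
    - by move=> x _; rewrite mule_ge0// ?lee_fin.
  by apply: eq_integral => x _; rewrite ge0_mule_fsumr.
pose f_ := nnsfun_approx measurableT mf.
have fE (l' : {measure set Z -> \bar R}) : \int[l']_z f z =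
    limn (fun n => \int[l']_z (f_ n z)%:E).
  rewrite -monotone_convergence//.
  - by apply: eq_integral => z _; apply/esym/cvg_lim => //; exact: cvg_nnsfun_approx.
  - by move=> n; exact/measurable_EFinP.
  - by move=> n z _; rewrite lee_fin.
  - by move=> z _ a b ab; rewrite lee_fin; exact/lefP/nd_nnsfun_approx.
have nd (l' : {measure set Z -> \bar R}) :
    nondecreasing_seq (fun n => \int[l']_z (f_ n z)%:E).
  move=> a b ab; apply: ge0_le_integral => //.
  - by move=> z _; rewrite lee_fin.
  - exact/measurable_EFinP.
  - exact/measurable_EFinP.
  - by move=> z _; rewrite lee_fin; exact/lefP/nd_nnsfun_approx.
rewrite fE; transitivity (limn (fun n => \int[nu]_x ((h x)%:E * \int[l x]_z (f_ n z)%:E))).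
  by congr (limn _); apply/funext => n; rewrite nn.
rewrite -monotone_convergence//.
- apply: eq_integral => x _; rewrite fE.
  rewrite -limeMl//; apply: ereal_nondecreasing_is_cvgn; exact: nd.
- move=> n; apply: emeasurable_funM; [exact/measurable_EFinP|]; apply: mint.
    exact/measurable_EFinP.
  by move=> z; rewrite lee_fin.
- by move=> n x _; apply: mule_ge0; [rewrite lee_fin|apply: integral_ge0 => z _; rewrite lee_fin].
- by move=> x _ a b ab; apply: lee_wpmul2l; [rewrite lee_fin; exact: h0|exact: nd].
Qed.

End mixture.

(** A measure with a density is a mixture of Dirac measures. *)
Lemma integral_density d (T : measurableType d) (nu m : {measure set T -> \bar R})
    (h : T -> R) (f : T -> \bar R) :
  measurable_fun setT h -> (forall x, (0 <= h x)%R) ->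
  (forall A, measurable A -> m A = \int[nu]_(x in A) (h x)%:E) ->
  measurable_fun setT f -> (forall x, 0 <= f x) ->
  \int[m]_x f x = \int[nu]_x ((h x)%:E * f x).
Proof.
move=> mh h0 mE mf f0.
rewrite (integral_mixture (nu := nu) (h := h) (l := fun x => \d_x))//.
- by apply: eq_integral => x _; rewrite integral_dirac// diracT mul1e.
- by move=> A mA; exact: measurable_fun_dirac.
- move=> A mA; rewrite mE// integral_mkcond; apply: eq_integral => x _.
  rewrite patchE /=. by rewrite diracE; case: ifP; rewrite ?mule1 ?mule0.
Qed.

Lemma law_measure d1 d2 (T1 : measurableType d1) (T2 : measurableType d2)
    (P : {measure set T1 -> \bar R}) (Y : T1 -> T2) : measurable_fun setT Y ->
  exists m : {measure set T2 -> \bar R},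
    (forall A, m A = P (Y @^-1` A)) /\
    (forall f, measurable_fun setT f -> (forall y, 0 <= f y) ->
      \int[m]_y f y = \int[P]_w f (Y w)).
Proof.
move=> mY.
exists (measure_function_pushforward__canonical__measure_function_Measure P mY).
by split=> // f mf f0; rewrite ge0_integral_pushforward// preimage_setT.
Qed.

Section disintegration.
Context dO dY dZ (O : measurableType dO) (SY : measurableType dY)
  (SZ : measurableType dZ).
Variables (P : {measure set O -> \bar R}) (Y : O -> SY) (Z : O -> SZ)
  (k : R.-pker SY ~> SZ).
Hypotheses (mY : measurable_fun setT Y) (mZ : measurable_fun setT Z).
Hypothesis sY : sigma_finite setT (pushforward P Y).
Hypothesis PE : forall A B, measurable A -> measurable B ->
  P (Y @^-1` A `&` Z @^-1` B) = \int[P]_(w in Y @^-1` A) k (Y w) B.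

(** Both sides integrate [f] against a measure on the product: the joint law of [Y] and [Z], and the
    mixture of the images of [k (Y w)] under [z -> (Y w, z)]. They agree on rectangles, and
    rectangles determine them because the law of [Y] is sigma-finite. *)
Lemma integral_disintegration (f : SY * SZ -> \bar R) :
  measurable_fun setT f -> (forall z, 0 <= f z) ->
  \int[P]_w f (Y w, Z w) = \int[P]_w \int[k (Y w)]_z f (Y w, z).
Proof.
move=> mf f0.
have mpair w : measurable_fun setT (fun z : SZ => (Y w, z)).
  by apply: measurable_fun_pair.
pose l w := measure_function_pushforward__canonical__measure_function_Measure
  (k (Y w)) (mpair w).
have lE w A : l w A = k (Y w) (xsection A (Y w)).
  by rewrite /= /pushforward xsectionE.
have ml A : measurable A -> measurable_fun setT (fun w => l w A).
  move=> mA; under eq_fun do rewrite lE.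
  apply: (measurableT_comp (f := fun y => k y (xsection A y))) => //.
  by apply: measurable_fun_xsection_finite_kernel; rewrite inE.
have [m2 m2E] := mixture_measure P (h := cst 1%R) (measurable_cst _) (fun=> ler01) ml.
have mYZ : measurable_fun setT (fun w => (Y w, Z w)) by exact: measurable_fun_pair.
have [m1 [m1E m1int]] := law_measure P mYZ.
have rect A B : measurable A -> measurable B -> m2 (A `*` B) = m1 (A `*` B).
  move=> mA mB; rewrite m1E m2E; last exact: measurableX.
  rewrite -[RHS]/(P (Y @^-1` A `&` Z @^-1` B)) PE// [RHS]integral_mkcond.
  apply: eq_integral => w _; rewrite mul1e lE patchE.
  have -> : (w \in Y @^-1` A) = (Y w \in A) by apply/idP/idP; rewrite !inE.
  case: ifPn => YA; first by rewrite in_xsectionX.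
  by rewrite notin_xsectionX// measure0.
have m12 A : measurable A -> m1 A = m2 A.
  have /sigma_finiteP[F [FT ndF Foo]] := sY.
  apply: (measure_unique [set C | exists A, measurable A /\ exists B, measurable B /\ C = A `*` B]
    (fun n => F n `*` setT)) => //.
  - rewrite measurable_prod_measurableType //; congr (<<s _ >>).
    rewrite predeqE; split => [[C mC [B mB <-]]|[C [mC [B [mB ->]]]]].
      by exists C; split => //; exists B.
    by exists C => //; exists B.
  - move=> /= _ _ [X1 [mX1 [X2 [mX2 ->]]]] [Y1 [mY1 [Y2 [mY2 ->]]]].
    rewrite -setXI; exists (X1 `&` Y1); split; first exact: measurableI.
    by exists (X2 `&` Y2); split => //; exact: measurableI.
  - by move=> n; exists (F n); split; [have [] := Foo n|exists setT].
  - by rewrite -setX_bigcupl -FT setXTT.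
  - by move=> _ [C [mC [B [mB ->]]]]; rewrite rect.
  - move=> n; rewrite m1E (_ : _ @^-1` _ = Y @^-1` F n); first by have [] := Foo n.
    by apply/seteqP; split => w //= [].
rewrite -[LHS]m1int//.
rewrite (integral_mixture (nu := P) (h := cst 1%R) (l := l))//; last first.
  by move=> A mA; rewrite m12// m2E.
apply: eq_integral => w _; rewrite mul1e [LHS]ge0_integral_pushforward//.
Qed.

End disintegration.

End measure_theory.

(** * Lebesgue measure and locally finite measures on R^d *)

Section lebesgue_rV_invariance.
Local Open Scope ereal_scope.
Context {R : realType}.

Lemma measurable_coord_comp d dT (T : measurableType dT) (f : T -> 'rV[R]_d) k :
  measurable_fun setT f -> measurable_fun setT (fun x => f x ord0 k).
Proof.
exact: (@measurableT_comp _ _ _ _ _ _ (fun x : 'rV[R]_d => x ord0 k) _ _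
  (measurable_coord k)).
Qed.

Lemma measurable_funD_rV d dT (T : measurableType dT) (f g : T -> 'rV[R]_d) :
  measurable_fun setT f -> measurable_fun setT g ->
  measurable_fun setT (fun x => f x + g x)%R.
Proof.
move=> mf mg; apply: measurable_fun_rV => k; under eq_fun do rewrite mxE.
by apply: measurable_funD; exact: measurable_coord_comp.
Qed.

Lemma measurable_funN_rV d dT (T : measurableType dT) (f : T -> 'rV[R]_d) :
  measurable_fun setT f -> measurable_fun setT (fun x => - f x)%R.
Proof.
move=> mf; apply: measurable_fun_rV => k; under eq_fun do rewrite mxE -sub0r.
by apply: measurable_funB => //; exact: measurable_coord_comp.
Qed.

Lemma measurable_funB_rV d dT (T : measurableType dT) (f g : T -> 'rV[R]_d) :
  measurable_fun setT f -> measurable_fun setT g ->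
  measurable_fun setT (fun x => f x - g x)%R.
Proof. by move=> mf mg; apply/measurable_funD_rV => //; exact: measurable_funN_rV. Qed.

Lemma integral_lebesgue_rVS d (f : 'rV[R]_d.+1 -> \bar R) :
  measurable_fun setT f -> (forall x, 0 <= f x) ->
  \int[lebesgue_rV d.+1]_x f x =
  \int[lebesgue_measure]_r \int[lebesgue_rV d]_x f (cons_rV (r, x)).
Proof.
move=> mf f0; have mc := @measurable_cons_rV R d.
transitivity (\int[pushforward (lebesgue_measure \x lebesgue_rV d) (@cons_rV R d)]_x f x).
  by apply: eq_measure_integral.
rewrite ge0_integral_pushforward// preimage_setT fubini_tonelli1//.
  exact: measurableT_comp.
by move=> x; exact: f0.
Qed.

(** By uniqueness of Lebesgue measure it suffices to look at intervals []a, b]], which the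
    reflection pulls back to [[c - b, c - a[], of the same length. *)
Lemma integral_lebesgue_reflect (c : R) (f : R -> \bar R) :
  measurable_fun setT f -> (forall x, 0 <= f x) ->
  \int[lebesgue_measure]_r f (c - r)%R = \int[lebesgue_measure]_r f r.
Proof.
move=> mf f0.
have mc : measurable_fun setT (fun r : measurableTypeR R => (c - r)%R : measurableTypeR R).
  by apply: measurable_funB.
have E A : measurable A -> lebesgue_measure A =
    pushforward lebesgue_measure (fun r : measurableTypeR R => (c - r)%R : measurableTypeR R) A.
  move=> mA; apply: lebesgue_measure_unique => // _ [[a b] /= _ <-].
  rewrite /pushforward (_ : _ @^-1` _ = `[c - b, c - a[%classic)%R; last first.
    apply/seteqP; split => x /=; rewrite !in_itv/= => /andP[h1 h2]; apply/andP; lra.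
  rewrite !lebesgue_measure_itv/= !lte_fin ltrD2l ltrN2; case: ifP => // _.
  by rewrite -!EFinD; congr EFin; ring.
rewrite (@eq_measure_integral _ _ _ _ (pushforward lebesgue_measure
    (fun r : measurableTypeR R => (c - r)%R : measurableTypeR R)) _ f)//.
  by rewrite ge0_integral_pushforward// preimage_setT.
by move=> A mA _; exact: E.
Qed.

Lemma integral_lebesgue_rV_reflect d (c : 'rV[R]_d) (f : 'rV[R]_d -> \bar R) :
  measurable_fun setT f -> (forall x, 0 <= f x) ->
  \int[lebesgue_rV d]_s f (c - s)%R = \int[lebesgue_rV d]_s f s.
Proof.
elim: d c f => [|d IHd] c f mf f0.
  have -> : (fun s => f (c - s)%R) = f.
    by apply/funext => s; congr f; apply/rowP => -[].
  by [].
pose c' : 'rV[R]_d := \row_k c ord0 (lift ord0 k).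
have cE r x : (c - cons_rV (r, x))%R = cons_rV (c ord0 ord0 - r, c' - x)%R.
  apply/rowP => j; rewrite !mxE; case: (unliftP ord0 j) => [k|] ->; last by [].
  by rewrite !mxE.
have mfc : measurable_fun setT (fun s : 'rV[R]_d.+1 => f (c - s)%R).
  by apply: (measurableT_comp mf); exact: measurable_funB_rV.
rewrite (integral_lebesgue_rVS mf f0) (integral_lebesgue_rVS mfc (fun=> f0 _)).
under eq_integral do under eq_integral do rewrite cE.
have mcons r : measurable_fun setT (fun x : 'rV[R]_d => cons_rV (r, x)).
  by apply: (measurableT_comp (@measurable_cons_rV R d)); exact: measurable_fun_pair.
under eq_integral => r _.
  rewrite (IHd _ (fun x => f (cons_rV ((c ord0 ord0 - r)%R, x))))//; last first.
    exact: measurableT_comp.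
  over.
rewrite (integral_lebesgue_reflect (c ord0 ord0)
  (f := fun r => \int[lebesgue_rV d]_x f (cons_rV (r, x))))//.
  apply: (@measurable_fun_fubini_tonelli_F _ _ _ _ _ (lebesgue_rV d)
    (fun z => f (cons_rV z))) => //.
  exact: (measurableT_comp mf (@measurable_cons_rV R d)).
by move=> r; apply: integral_ge0.
Qed.

(** A translation is the composition of the two reflections [s -> - s] and [s -> c - s]. *)
Lemma integral_lebesgue_rV_shift d (c : 'rV[R]_d) (f : 'rV[R]_d -> \bar R) :
  measurable_fun setT f -> (forall x, 0 <= f x) ->
  \int[lebesgue_rV d]_s f (c + s)%R = \int[lebesgue_rV d]_s f s.
Proof.
move=> mf f0.
transitivity (\int[lebesgue_rV d]_s f (c + (0 - s))%R).
  rewrite (integral_lebesgue_rV_reflect 0 (f := fun s => f (c + s)%R))//.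
  by apply: (measurableT_comp mf); exact: measurable_funD_rV.
under eq_integral do rewrite sub0r.
exact: integral_lebesgue_rV_reflect.
Qed.

Lemma lebesgue_rV_unit_cube d : lebesgue_rV d (@unit_cube R d) = 1.
Proof.
have := @lebesgue_rV_box R d 0 (\row__ 1%R).
rewrite big1 => [|k _]; last by rewrite !mxE subr0.
move=> <- => [|k]; last by rewrite !mxE.
by congr (lebesgue_rV d _); apply/seteqP; split => x /= + k => /(_ k); rewrite !mxE.
Qed.

End lebesgue_rV_invariance.

Section sigma_finite_kernel_integral.
Local Open Scope ereal_scope.
Context {R : realType} dX dZ (X : measurableType dX) (Z : measurableType dZ).
Variables (k : X -> {measure set Z -> \bar R}) (F : nat -> set Z).
Hypothesis mk : forall A, measurable A -> measurable_fun setT (fun x => k x A).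
Hypotheses (mF : forall n, measurable (F n)) (FT : \bigcup_n F n = setT)
  (ndF : nondecreasing_seq F) (kF : forall x n, k x (F n) < +oo).

Let k_kernel := isKernel.Build _ _ X Z R k mk.
Let k' : R.-ker X ~> Z := HB.pack k k_kernel.

(** The masses [k x (F n)] are finite for each [x] but need not be bounded in [x]. Cutting [A] to
    the slab over [F n] leaves a finite measure for each [x], and the slabs increase to the whole
    product. *)
Lemma measurable_kernel_xsection A : measurable A ->
  measurable_fun setT (fun x => k x (xsection A x)).
Proof.
move: A; pose B := [set A | measurable A /\
  measurable_fun setT (fun x => k x (xsection A x))].
suff : measurable `<=` B by move=> + A => /[apply] -[].
move=> A mA.
have -> : A = \bigcup_n (A `&` (setT `*` F n)).
  by rewrite -setI_bigcupr -setX_bigcupr FT setXTT setIT.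
apply: (@xsection_ndseq_closed _ _ _ _ _ k).
  move=> m n mn; apply/subsetPset; apply: setIS; apply: setSX => //.
  exact/subsetPset/ndF.
move=> n; split; first by apply: measurableI => //; exact: measurableX.
have h : forall x, exists M : R, forall V, measurable V -> mrestr (k' x) (mF n) V < M%:E.
  move=> x; exists (fine (k x (F n)) + 1)%R => V mV.
  rewrite [in ltRHS]EFinD lte_spadder// fineK; last by rewrite ge0_fin_numE.
  by rewrite /mrestr/= le_measure// inE//; exact: measurableI.
have [_] := measurable_prod_subset_xsection_kernel h mA.
congr (measurable_fun _ _); apply/funext => x.
by rewrite /mrestr setTX xsectionI xsection_preimage_snd.
Qed.

Import HBNNSimple.

Lemma measurable_kernel_integral (f : X * Z -> \bar R) :
  measurable_fun setT f -> (forall z, 0 <= f z) ->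
  measurable_fun setT (fun x => \int[k x]_z f (x, z)).
Proof.
move=> mf f0; pose f_ := nnsfun_approx measurableT mf.
apply: (measurable_fun_xsection_integral f k f_).
- by move=> a b ab; exact/nd_nnsfun_approx.
- by move=> z; apply: cvg_nnsfun_approx.
- move=> n r; by apply: measurable_kernel_xsection.
Qed.

End sigma_finite_kernel_integral.

Section locally_finite_measures.
Local Open Scope ereal_scope.
Context {R : realType} {d : nat}.
Implicit Types (xi : lf_measure R d) (t : 'rV[R]_d) (B : set 'rV[R]_d).

Definition norm_ball (n : nat) : set 'rV[R]_d := [set x | (`|x| < n%:R)%R].

Lemma measurable_norm_ball n : measurable (norm_ball n).
Proof.
apply: open_measurable_rV.
rewrite (_ : norm_ball n = Num.norm @^-1` [set r : R | (r < n%:R)%R])//.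
by apply: open_comp; [move=> x _; exact: norm_continuous|exact: open_lt].
Qed.

Lemma bounded_norm_ball n : bounded_set (norm_ball n).
Proof.
exists n%:R; split; first exact: num_real.
by move=> r nr x /= xn; exact/ltW/(lt_trans xn).
Qed.

Lemma norm_ball_ltoo xi n : xi (norm_ball n) < +oo.
Proof. exact: lf_locally_finite (measurable_norm_ball n) (bounded_norm_ball n). Qed.

Lemma nondecreasing_norm_ball : nondecreasing_seq norm_ball.
Proof.
move=> m n mn; apply/subsetPset => x /= /lt_le_trans; apply.
by rewrite ler_nat.
Qed.

Lemma bigcup_norm_ball : \bigcup_n norm_ball n = setT.
Proof.
apply/seteqP; split=> // x _; exists (Num.truncn `|x|).+1 => //=.
exact: truncnS_gt.
Qed.

Lemma lf_measure_sigma_finite xi : sigma_finite setT xi.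
Proof.
exists norm_ball; first by rewrite bigcup_norm_ball.
by move=> n; split; [exact: measurable_norm_ball|exact: norm_ball_ltoo].
Qed.

Lemma measurable_lf_eval B : measurable B ->
  measurable_fun setT (fun xi => xi B).
Proof.
move=> mB _ A mA; apply: sub_sigma_algebra; exists B => //.
by exists A.
Qed.

Lemma measurable_fun_lf dX (X : measurableType dX) (f : X -> lf_measure R d) :
  (forall B, measurable B -> measurable_fun setT (fun x => f x B)) ->
  measurable_fun setT f.
Proof.
move=> mf; apply: (@measurability _ _ _ _ _ _ lf_eval_sets) => //.
move=> _ [_ [B mB [A mA <-]] <-]; rewrite !setTI.
by rewrite -[X in measurable X]setTI; exact: (mf B mB measurableT A mA).
Qed.

Lemma measurable_lf_integral dX (X : measurableType dX) (f : X -> lf_measure R d)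
    (g : X * 'rV[R]_d -> \bar R) :
  measurable_fun setT f ->
  measurable_fun setT g -> (forall z, 0 <= g z) ->
  measurable_fun setT (fun x => \int[f x]_t g (x, t)).
Proof.
move=> mf; apply: (@measurable_kernel_integral _ _ _ _ _ _ norm_ball).
- by move=> A mA; exact: (measurableT_comp (measurable_lf_eval mA)).
- exact: measurable_norm_ball.
- exact: bigcup_norm_ball.
- exact: nondecreasing_norm_ball.
- by move=> x n; exact: norm_ball_ltoo.
Qed.

(** Equality is required on all sets, since an [lf_measure] has values also outside the Borel sets.
    The shift is defined by a preimage, so the action laws below hold in this strong sense. *)
Lemma lf_measure_eq xi1 xi2 : (xi1 = xi2 :> (set 'rV[R]_d -> \bar R)) -> xi1 = xi2.
Proof.
case: xi1 xi2 => [m1 h1] [m2 h2] /= e.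
have {}e : m1 = m2 by exact: eq_measure.
by subst m2; congr LfMeasure; exact: Prop_irrelevance.
Qed.

Lemma shift_lf0 xi : shift_lf 0 xi = xi.
Proof.
apply: lf_measure_eq; apply/funext => B; rewrite /= /shift_measure /pushforward.
by congr (lf_val xi _); apply/seteqP; split => x /=; rewrite subr0.
Qed.

Lemma shift_lfD s t xi : shift_lf (s + t) xi = shift_lf s (shift_lf t xi).
Proof.
apply: lf_measure_eq; apply/funext => B; rewrite /= /shift_measure /pushforward.
congr (lf_val xi _).
by apply/seteqP; split => x /=; rewrite opprD (addrC (- s)%R) addrA.
Qed.

Lemma integral_shift_lf t xi (f : 'rV[R]_d -> \bar R) :
  measurable_fun setT f -> (forall x, 0 <= f x) ->
  \int[shift_lf t xi]_x f x = \int[xi]_x f (x - t)%R.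
Proof.
move=> mf f0.
have [m [mE mint]] := law_measure xi (measurable_subrV t).
by rewrite -mint//; apply: eq_measure_integral => A _ _; rewrite mE.
Qed.

(** The shifted mass of [B] is the integral of [1_B (s - t x)] against [f x]: the shift has moved
    into the integrand, which makes joint measurability a case of [measurable_lf_integral]. *)
Lemma measurable_shift_lf dX (X : measurableType dX) (t : X -> 'rV[R]_d)
    (f : X -> lf_measure R d) :
  measurable_fun setT t -> measurable_fun setT f ->
  measurable_fun setT (fun x => shift_lf (t x) (f x)).
Proof.
move=> mt mf; apply: measurable_fun_lf => B mB.
have mdiff : measurable_fun setT (fun z : X * 'rV[R]_d => z.2 - t z.1)%R.
  by apply: measurable_funB_rV => //; exact: measurableT_comp.
rewrite (_ : (fun x => _) =
    fun x => \int[f x]_s (\1_B (s - t x)%R)%:E); last first.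
  apply/funext => x; rewrite (_ : (fun s => _) = EFin \o \1_((fun s => s - t x)%R @^-1` B)).
    rewrite integral_indic// ?setIT//.
    by rewrite -[X in measurable X]setTI; exact: measurable_subrV.
  by apply/funext => s.
apply: (@measurable_lf_integral _ _ _ (fun z => (\1_B (z.2 - t z.1)%R)%:E)) => //.
exact: measurable_indicE.
Qed.

Lemma measurable_fun_fst dX d1 d2 (X : measurableType dX) (T1 : measurableType d1)
    (T2 : measurableType d2) (f : X -> T1 * T2) :
  measurable_fun setT f -> measurable_fun setT (fun x => (f x).1).
Proof. exact: (@measurableT_comp _ _ _ _ _ _ fst _ f measurable_fst). Qed.

Lemma measurable_fun_snd dX d1 d2 (X : measurableType dX) (T1 : measurableType d1)
    (T2 : measurableType d2) (f : X -> T1 * T2) :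
  measurable_fun setT f -> measurable_fun setT (fun x => (f x).2).
Proof. exact: (@measurableT_comp _ _ _ _ _ _ snd _ f measurable_snd). Qed.

Lemma measurable_comp2 dX d1 d2 d3 (X : measurableType dX) (T1 : measurableType d1)
    (T2 : measurableType d2) (T3 : measurableType d3) (G : T1 -> T2 -> T3)
    (f : X -> T1) (g : X -> T2) :
  measurable_fun setT (fun z => G z.1 z.2) ->
  measurable_fun setT f -> measurable_fun setT g ->
  measurable_fun setT (fun x => G (f x) (g x)).
Proof.
move=> mG mf mg.
apply: (@measurableT_comp _ _ _ _ _ _ (fun z => G z.1 z.2) _ (fun x => (f x, g x)) mG).
exact: measurable_fun_pair.
Qed.

Lemma measurable_comp3 dX d1 d2 d3 d4 (X : measurableType dX) (T1 : measurableType d1)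
    (T2 : measurableType d2) (T3 : measurableType d3) (T4 : measurableType d4)
    (G : T1 -> T2 -> T3 -> T4) (f : X -> T1) (g : X -> T2) (h : X -> T3) :
  measurable_fun setT (fun z => G z.1.1 z.1.2 z.2) ->
  measurable_fun setT f -> measurable_fun setT g -> measurable_fun setT h ->
  measurable_fun setT (fun x => G (f x) (g x) (h x)).
Proof.
move=> mG mf mg mh.
apply: (@measurableT_comp _ _ _ _ _ _ (fun z => G z.1.1 z.1.2 z.2) _
  (fun x => (f x, g x, h x)) mG).
by apply: measurable_fun_pair => //; exact: measurable_fun_pair.
Qed.

Lemma measurable_unit_cube : measurable (@unit_cube R d).
Proof.
have -> : @unit_cube R d = \bigcap_(k in [set: 'I_d])
    ((fun x : 'rV[R]_d => x ord0 k) @^-1` `[0%R, 1%R[).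
  by apply/seteqP; split=> [x xC k _|x xC k]; have := xC k; rewrite /= ?in_itv//; apply.
apply: fin_bigcap_measurable => // k _; rewrite -[X in measurable X]setTI.
by apply: measurable_coord => //; exact: measurable_itv.
Qed.

Lemma bounded_unit_cube : bounded_set (@unit_cube R d).
Proof.
exists 1%R; split; first exact: num_real.
move=> r r1 x /= xC; rewrite [leLHS]/Num.Def.normr/= mx_normrE.
apply: bigmax_le => [|[i j] _ /=]; first exact/ltW/(lt_trans ltr01).
have /andP[x0 x1] := xC j.
by rewrite ord1 ger0_norm// ltW// (lt_trans x1).
Qed.

End locally_finite_measures.

(** Syntax-directed measurability for terms built from projections, pairs and vector arithmetic. The
    patterns [+%R a] and [-%R] catch eta-contracted sums and opposites; any other head goes to
    [ext], through which each section supplies the lemmas for its own operations. *)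
Ltac measurability ext := repeat (try assumption; lazymatch goal with
  | |- measurable_fun _ (fun _ => ?c) => exact: measurable_cst
  | |- measurable_fun _ (fun x => x) => exact: measurable_id
  | |- measurable_fun _ (+%R ?a) =>
      exact: (measurable_funD_rV (measurable_cst a) (@measurable_id _ _ setT))
  | |- measurable_fun _ -%R => exact: (measurable_funN_rV (@measurable_id _ _ setT))
  | |- measurable_fun _ fst => exact: measurable_fst
  | |- measurable_fun _ snd => exact: measurable_snd
  | |- measurable_fun _ (fun x => (_ , _)) => apply: measurable_fun_pair
  | |- measurable_fun _ (fun x => (_ - _)%R) => apply: measurable_funB_rV
  | |- measurable_fun _ (fun x => (_ + _)%R) => apply: measurable_funD_rV
  | |- measurable_fun _ (fun x => (- _)%R) => apply: measurable_funN_rV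
  | |- measurable_fun _ (fun x => fst _) => apply: measurable_fun_fst
  | |- measurable_fun _ (fun x => snd _) => apply: measurable_fun_snd
  | |- measurable_fun _ _ => ext
  end).

Section measurable_shift.
Local Open Scope ereal_scope.
Context {R : realType} {d : nat} {dE : measure_display} {E : measurableType dE}.
Variable theta : 'rV[R]_d -> E -> E.
Hypothesis act : measurable_action theta.
Local Notation M := (E * lf_measure R d)%type.
Local Notation sh := (shift_pair theta).

Lemma shift_pair0 y : sh 0%R y = y.
Proof. by case: act => th0 _ _; case: y => x xi; rewrite /shift_pair/= th0 shift_lf0. Qed.

Lemma shift_pairD s t y : sh (s + t)%R y = sh s (sh t y).
Proof. by case: act => _ thD _; rewrite /shift_pair/= thD shift_lfD. Qed.

Lemma measurable_shift_pair dX (X : measurableType dX) (t : X -> 'rV[R]_d) (y : X -> M) :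
  measurable_fun setT t -> measurable_fun setT y ->
  measurable_fun setT (fun x => sh (t x) (y x)).
Proof.
move=> mt my; case: act => _ _ mth; apply: measurable_fun_pair.
  apply: (@measurableT_comp _ _ _ _ _ _ (fun p => theta p.1 p.2) _
    (fun x => (t x, (y x).1)) mth).
  by apply: measurable_fun_pair => //; exact: measurable_fun_fst.
by apply: measurable_shift_lf => //; exact: measurable_fun_snd.
Qed.

End measurable_shift.

(** * Palm calculus *)

Section campbell.
Local Open Scope ereal_scope.
Context {R : realType} {d : nat} {dM : measure_display} {M : measurableType dM}.
Local Notation V := 'rV[R]_d.
Local Notation leb := (@lebesgue_rV R d).
(** The calculus uses only a measurable action and an equivariant map to measures, so the space of
    pairs is hidden behind [M]. *)
Variables (sh : V -> M -> M) (eta : M -> lf_measure R d).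
Hypotheses (sh0 : forall y, sh 0%R y = y)
  (shD : forall s t y, sh (s + t)%R y = sh s (sh t y))
  (msh : measurable_fun setT (fun z : V * M => sh z.1 z.2))
  (meta : measurable_fun setT eta)
  (eta_sh : forall t y, eta (sh t y) = shift_lf t (eta y)).

Lemma measurable_fun_sh dX (X : measurableType dX) (t : X -> V) (y : X -> M) :
  measurable_fun setT t -> measurable_fun setT y ->
  measurable_fun setT (fun x => sh (t x) (y x)).
Proof. exact: (measurable_comp2 msh). Qed.

Lemma measurable_fun_eta dX (X : measurableType dX) (y : X -> M) :
  measurable_fun setT y -> measurable_fun setT (fun x => eta (y x)).
Proof. exact: (measurableT_comp meta). Qed.

Lemma measurable_integral_eta dX (X : measurableType dX) (y : X -> M)
    (g : X -> V -> \bar R) :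
  measurable_fun setT y -> measurable_fun setT (fun z : X * V => g z.1 z.2) ->
  (forall x t, 0 <= g x t) ->
  measurable_fun setT (fun x => \int[eta (y x)]_t g x t).
Proof.
move=> my mg g0.
apply: (@measurable_lf_integral _ _ _ _ (fun x => eta (y x)) (fun z => g z.1 z.2)) => //.
exact: measurable_fun_eta.
Qed.

Local Ltac meas := measurability
  ltac:(first [apply: measurable_fun_sh | apply: measurable_fun_eta]).

Variable mu : {measure set M -> \bar R}.
Hypothesis smu : sigma_finite setT mu.

Lemma integral_lf_swap (nu : {measure set V -> \bar R}) (K : M -> V -> V -> \bar R) :
  sigma_finite setT nu ->
  measurable_fun setT (fun z : M * V * V => K z.1.1 z.1.2 z.2) ->
  (forall y t s, 0 <= K y t s) ->
  \int[mu]_y \int[eta y]_t \int[nu]_s K y t s =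
  \int[nu]_s \int[mu]_y \int[eta y]_t K y t s.
Proof.
move=> snu mK K0.
transitivity (\int[mu]_y \int[nu]_s \int[eta y]_t K y t s).
  apply: eq_integral => y _.
  apply: (tonelli (f := fun z => K y z.1 z.2)) => //.
  - exact: lf_measure_sigma_finite.
  - by cbv beta; apply: (measurable_comp3 mK); meas.
apply: (tonelli (f := fun z : M * V => \int[eta z.1]_t K z.1 t z.2)) => //.
  apply: (@measurable_integral_eta _ _ (fun z : M * V => z.1)
    (fun z t => K z.1 t z.2)) => //; first by meas.
  by cbv beta; apply: (measurable_comp3 mK); meas.
by move=> z; apply: integral_ge0.
Qed.

Hypothesis mu_stationary : forall t (f : M -> \bar R),
  measurable_fun setT f -> (forall y, 0 <= f y) ->
  \int[mu]_y f (sh t y) = \int[mu]_y f y.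

(** Stationarity replaces [y] by [sh s y]. A point [t] of [eta y] sits at [t - s] in the shifted
    measure, and recentring there leads to the same [sh t y]. *)
Lemma campbell_shift (G : M -> V -> \bar R) s :
  measurable_fun setT (fun z : M * V => G z.1 z.2) -> (forall y t, 0 <= G y t) ->
  \int[mu]_y \int[eta y]_t G (sh t y) t = \int[mu]_y \int[eta y]_t G (sh t y) (t - s)%R.
Proof.
move=> mG G0.
rewrite -(mu_stationary s (f := fun y => \int[eta y]_t G (sh t y) t)).
- apply: eq_integral => y _; rewrite /= eta_sh integral_shift_lf//.
  + by apply: eq_integral => t _; rewrite -shD subrK.
  + by cbv beta; apply: (measurable_comp2 mG); meas.
- apply: (@measurable_integral_eta _ _ idfun (fun y t => G (sh t y) t)) => //.
    exact: measurable_id.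
  by cbv beta; apply: (measurable_comp2 mG); meas.
- by move=> y; apply: integral_ge0.
Qed.

Lemma campbell_unit_cube (G : M -> V -> \bar R) :
  measurable_fun setT (fun z : M * V => G z.1 z.2) -> (forall y t, 0 <= G y t) ->
  \int[mu]_y \int[eta y]_t G (sh t y) t =
  \int[mu]_y \int[eta y]_t ((\1_unit_cube t)%:E * \int[leb]_s G (sh t y) s).
Proof.
move=> mG G0; have mC := @measurable_unit_cube R d.
have sleb : sigma_finite setT leb by exact: (sigma_finiteT leb).
have mul0 t (x : \bar R) : 0 <= x -> 0 <= (\1_(@unit_cube R d) t)%:E * x.
  by move=> x0; apply: mule_ge0 => //; rewrite lee_fin.
symmetry; transitivity (\int[mu]_y \int[eta y]_t \int[leb]_s
    ((\1_unit_cube t)%:E * G (sh t y) (t - s)%R)).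
  apply: eq_integral => y _; apply: eq_integral => t _.
  (* The reflection [s -> t - s] makes the second argument of [G] relative to [t], so that
     [campbell_shift] can act on it. *)
  rewrite -(integral_lebesgue_rV_reflect t (f := G (sh t y)))//; last first.
    by cbv beta; apply: (measurable_comp2 mG); meas.
  rewrite ge0_integralZl//.
  by cbv beta; apply: (measurable_comp2 mG); meas.
apply: (etrans (integral_lf_swap
  (K := fun y t s => (\1_unit_cube t)%:E * G (sh t y) (t - s)%R) sleb _ _)).
- apply: emeasurable_funM; first by apply: measurable_indicE => //; meas.
  by cbv beta; apply: (measurable_comp2 mG); meas.
- by move=> y t s; exact: mul0.
(* For fixed [s], translating the second variable by [s] restores the argument [t] of [G] and
   displaces the cube instead. The integral of the displaced indicator over [s] is the volume 1 of
   the cube. *)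
transitivity (\int[leb]_s \int[mu]_y \int[eta y]_t
    ((\1_unit_cube (t + s)%R)%:E * G (sh t y) t)).
  apply: eq_integral => s _.
  apply: (etrans (campbell_shift
    (G := fun y t => (\1_unit_cube t)%:E * G y (t - s)%R) (- s)%R _ _)).
  + apply: emeasurable_funM; first by apply: measurable_indicE => //; meas.
    by cbv beta; apply: (measurable_comp2 mG); meas.
  + by move=> y t; exact: mul0.
  + apply: eq_integral => y _; apply: eq_integral => t _.
    by rewrite opprK addrK.
apply: (etrans (esym (integral_lf_swap
  (K := fun y t s => (\1_unit_cube (t + s)%R)%:E * G (sh t y) t) sleb _ _))).
- apply: emeasurable_funM; first by apply: measurable_indicE => //; meas.
  by cbv beta; apply: (measurable_comp2 mG); meas.
- by move=> y t s; exact: mul0.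
apply: eq_integral => y _; apply: eq_integral => t _.
rewrite ge0_integralZr//; last first.
  by apply: measurable_indicE => //; meas.
transitivity (1 * G (sh t y) t); last by rewrite mul1e.
congr (_ * _).
apply: (etrans (integral_lebesgue_rV_shift t (f := fun s => (\1_unit_cube s)%:E) _ _)).
- by apply: measurable_indicE => //; meas.
- by move=> s; rewrite lee_fin.
- by rewrite integral_indic// setIT; exact: lebesgue_rV_unit_cube.
Qed.

Section palm.
Variable Q : {measure set M -> \bar R}.
Hypothesis QE : forall f : M -> \bar R, measurable_fun setT f -> (forall y, 0 <= f y) ->
  \int[Q]_y f y = \int[mu]_y \int[eta y]_t ((\1_unit_cube t)%:E * f (sh t y)).

Let sleb : sigma_finite setT leb. Proof. exact: (sigma_finiteT leb). Qed.

Lemma campbell (G : M -> V -> \bar R) :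
  measurable_fun setT (fun z : M * V => G z.1 z.2) -> (forall y t, 0 <= G y t) ->
  \int[mu]_y \int[eta y]_t G (sh t y) t = \int[Q]_y \int[leb]_s G y s.
Proof.
move=> mG G0; rewrite QE; first exact: campbell_unit_cube.
- exact: (measurable_fun_integral2 (f := fun z => G z.1 z.2)).
- by move=> y; apply: integral_ge0.
Qed.

Lemma palm_formula (f : M -> \bar R) (B : set V) : measurable B ->
  measurable_fun setT f -> (forall y, 0 <= f y) ->
  \int[mu]_y \int[eta y]_(t in B) f (sh t y) = \int[Q]_y f y * leb B.
Proof.
move=> mB mf f0.
transitivity (\int[mu]_y \int[eta y]_t (f (sh t y) * (\1_B t)%:E)).
  apply: eq_integral => y _; rewrite integral_mkcond; apply: eq_integral => t _.
  by rewrite patchE indicE; case: ifP => _; rewrite ?mule1 ?mule0.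
apply: (etrans (campbell (G := fun y t => f y * (\1_B t)%:E) _ _)).
- apply: emeasurable_funM; last by apply: measurable_indicE => //; meas.
  by apply: (measurableT_comp mf); meas.
- by move=> y t; apply: mule_ge0 => //; rewrite lee_fin.
rewrite -ge0_integralZr//; apply: eq_integral => y _.
rewrite ge0_integralZl//; last by apply: measurable_indicE => //; meas.
by rewrite integral_indic// setIT.
Qed.

(** Unfolding [Q] produces two points of the same measure [eta y]: the point [t] of recentring,
    confined to the cube, and a second point [r = v + t]. Tonelli lets them trade roles. Recentring
    is then done at [r], and in Campbell's identity the indicator of the cube integrates to 1. *)
Lemma palm_exchange (g : M -> V -> \bar R) :
  measurable_fun setT (fun z : M * V => g z.1 z.2) -> (forall y t, 0 <= g y t) ->
  \int[Q]_y \int[eta y]_v g (sh v y) (- v)%R = \int[Q]_y \int[eta y]_v g y v.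
Proof.
move=> mg g0; have mC := @measurable_unit_cube R d.
have mul0 t (x : \bar R) : 0 <= x -> 0 <= (\1_(@unit_cube R d) t)%:E * x.
  by move=> x0; apply: mule_ge0 => //; rewrite lee_fin.
have mG : measurable_fun setT (fun z : M * V =>
    \int[eta z.1]_v ((\1_unit_cube (v + z.2)%R)%:E * g z.1 v)).
  apply: (measurable_integral_eta (y := fun z : M * V => z.1)
      (g := fun z v => (\1_unit_cube (v + z.2)%R)%:E * g z.1 v)).
  - by meas.
  - apply: emeasurable_funM; first by apply: measurable_indicE => //; meas.
    by cbv beta; apply: (measurable_comp2 mg); meas.
  - by move=> z v; exact: mul0.
rewrite QE; last 2 first.
- apply: (measurable_integral_eta (g := fun y v => g (sh v y) (- v)%R)) => //.
  by cbv beta; apply: (measurable_comp2 mg); meas.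
- by move=> y; apply: integral_ge0.
transitivity (\int[mu]_y \int[eta y]_r \int[eta (sh r y)]_v
    ((\1_unit_cube (v + r)%R)%:E * g (sh r y) v)).
  apply: eq_integral => y _.
  transitivity (\int[eta y]_t \int[eta y]_r
      ((\1_unit_cube t)%:E * g (sh r y) (t - r)%R)).
    apply: eq_integral => t _; rewrite ge0_integralZl//; last first.
      by cbv beta; apply: (measurable_comp2 mg); meas.
    congr (_ * _); rewrite eta_sh integral_shift_lf//; last first.
      by cbv beta; apply: (measurable_comp2 mg); meas.
    by apply: eq_integral => r _; rewrite -shD subrK opprB.
  apply: (etrans (tonelli (m1 := eta y) (m2 := eta y)
    (f := fun z => (\1_unit_cube z.1)%:E * g (sh z.2 y) (z.1 - z.2)%R) _ _ _ _)).
  - exact: lf_measure_sigma_finite.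
  - exact: lf_measure_sigma_finite.
  - apply: emeasurable_funM; first by apply: measurable_indicE => //; meas.
    by cbv beta; apply: (measurable_comp2 mg); meas.
  - by move=> z; exact: mul0.
  apply: eq_integral => r _ /=.
  rewrite eta_sh integral_shift_lf; last 2 first.
  - apply: emeasurable_funM; first by apply: measurable_indicE => //; meas.
    by cbv beta; apply: (measurable_comp2 mg); meas.
  - by move=> v; exact: mul0.
  by apply: eq_integral => t _; rewrite subrK.
apply: (etrans (campbell (G := fun y r =>
  \int[eta y]_v ((\1_unit_cube (v + r)%R)%:E * g y v)) _ _)) => //.
  by move=> y r; apply: integral_ge0 => v _; exact: mul0.
apply: eq_integral => y _.
apply: (etrans (tonelli (m1 := leb) (m2 := eta y)
  (f := fun z => (\1_unit_cube (z.2 + z.1)%R)%:E * g y z.2) _ _ _ _)) => //.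
- exact: lf_measure_sigma_finite.
- apply: emeasurable_funM; first by apply: measurable_indicE => //; meas.
  by cbv beta; apply: (measurable_comp2 mg); meas.
- by move=> z; exact: mul0.
apply: eq_integral => v _ /=.
rewrite ge0_integralZr//; last by apply: measurable_indicE => //; meas.
transitivity (1 * g y v); last by rewrite mul1e.
congr (_ * _).
apply: (etrans (integral_lebesgue_rV_shift v (f := fun s => (\1_unit_cube s)%:E) _ _)).
- by apply: measurable_indicE => //; meas.
- by move=> s; rewrite lee_fin.
- by rewrite integral_indic// setIT; exact: lebesgue_rV_unit_cube.
Qed.

(* With A n increasing to the whole space, (eta y)(unit_cube) <= n on A n and
   mu (A n) < oo, the function g n y = |{t in the cube | theta_{-t} y in A n}| is
   Q-integrable by Campbell and increases to 1, so the sets {g n >= 1/2} are an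
   exhausting sequence. *)
Lemma palm_sigma_finite : sigma_finite setT Q.
Proof.
have mC := @measurable_unit_cube R d.
have mev : measurable_fun setT (fun y : M => eta y unit_cube).
  exact: (measurableT_comp (measurable_lf_eval mC) meta).
have [F [FT ndF Foo]] := (sigma_finiteP _ _).1 smu.
have mF n : measurable (F n) := (Foo n).1.
have ndF' m n : (m <= n)%N -> F m `<=` F n by move=> mn; exact/subsetPset/ndF.
pose A n : set M := F n `&` [set y | eta y unit_cube <= n%:R%:E].
have mA n : measurable (A n).
  apply: measurableI; first exact: mF.
  by rewrite -[X in measurable X]setTI; exact: emeasurable_fun_infty_c.
have ndA : nondecreasing_seq A.
  move=> m n mn; apply/subsetPset => y [Fy /= yn]; split.
    exact: (ndF' _ _ mn).
  by rewrite /= (le_trans yn)// lee_fin ler_nat.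
have AT y : exists n, A n y.
  have [i _ Fi] : (\bigcup_i F i) y by rewrite -FT.
  have fin : eta y unit_cube \is a fin_num.
    rewrite ge0_fin_numE//; exact/lf_locally_finite/bounded_unit_cube.
  pose j := (Num.truncn (fine (eta y unit_cube))).+1.
  exists (maxn i j); split.
    exact: (ndF' _ _ (leq_maxl _ _)).
  rewrite /= -(fineK fin) lee_fin (le_trans (ltW (truncnS_gt _)))// ler_nat.
  exact: leq_maxr.
pose G n y t : \bar R := (\1_unit_cube t)%:E * (\1_(A n) (sh (- t)%R y))%:E.
have G0 n y t : 0 <= G n y t by apply: mule_ge0; rewrite lee_fin.
have mG n : measurable_fun setT (fun z : M * V => G n z.1 z.2).
  by apply: emeasurable_funM; apply: measurable_indicE => //; meas.
pose g n y := \int[leb]_t G n y t.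
have g0 n y : 0 <= g n y by apply: integral_ge0.
have mg n : measurable_fun setT (g n).
  exact: (measurable_fun_integral2 (f := fun z => G n z.1 z.2)).
have intg n : \int[Q]_y g n y < +oo.
  rewrite -campbell//.
  apply: (@le_lt_trans _ _ (n%:R%:E * mu (F n))); last first.
    by rewrite lte_mul_pinfty// (Foo n).2.
  apply: (@le_trans _ _ (\int[mu]_(y in F n) (cst n%:R%:E) y)); last first.
    by rewrite integral_cst.
  rewrite [leRHS]integral_mkcond; apply: ge0_le_integral => //.
  - by move=> y _; apply: integral_ge0.
  - apply: (measurable_integral_eta (g := fun y t => G n (sh t y) t)) => //.
    by cbv beta; apply: (measurable_comp2 (mG n)); meas.
  - by apply/(measurable_restrictT _ (mF n)).1; exact: measurable_cst.
  - move=> y _; rewrite (_ : \int[_]_t _ = eta y unit_cube * (\1_(A n) y)%:E).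
      rewrite patchE indicE; have [/set_mem[Fy yn]|yA] := boolP (y \in A n).
        by rewrite mem_set// mule1.
      by rewrite mule0; case: ifP => // _; rewrite lee_fin.
    (* Campbell's identity evaluates [G n] at [sh t y], which the shift by [- t] returns to [y]:
       membership in [A n] no longer depends on [t]. *)
    transitivity (\int[eta y]_t ((\1_unit_cube t)%:E * (\1_(A n) y)%:E)).
      by apply: eq_integral => t _; rewrite /G -shD addNr sh0.
    rewrite ge0_integralZr//; last by apply: measurable_indicE => //; meas.
    by rewrite integral_indic// setIT.
pose H n : set M := [set y | (2^-1)%:E <= g n y].
exists H.
  apply/seteqP; split => // y _.
  pose B n : set V := [set t | unit_cube t /\ A n (sh (- t)%R y)].
  have mB n : measurable (B n).
    rewrite (_ : B n = unit_cube `&` (fun t => sh (- t)%R y) @^-1` A n)//.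
    apply: measurableI => //; rewrite -[X in measurable X]setTI.
    have mshN : measurable_fun setT (fun t : V => sh (- t)%R y) by meas.
    exact: mshN.
  have gE n : g n y = leb (B n).
    rewrite /g -[RHS]mul1e -(integral_cst leb (mB n)) [RHS]integral_mkcond.
    apply: eq_integral => t _; rewrite patchE /G !indicE.
    have -> : (t \in B n) = (t \in unit_cube) && (sh (- t)%R y \in A n).
      by apply/idP/andP; rewrite !inE => -[].
    by case: (t \in unit_cube); case: (_ \in A n); rewrite /= ?mule1 ?mule0.
  have BT : \bigcup_n B n = unit_cube.
    apply/seteqP; split => [t [n _ []]//|t tC].
    by have [n An] := AT (sh (- t)%R y); exists n.
  have ndB : nondecreasing_seq B.
    move=> m n mn; apply/subsetPset => t [tC At]; split => //.
    by move: At; have /subsetPset := ndA _ _ mn; apply.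
  have mUB : measurable (\bigcup_n B n) by rewrite BT.
  have cvgB := nondecreasing_cvg_mu (mu := leb) mB mUB ndB.
  have cube1 : leb (\bigcup_n B n) = 1 by rewrite BT; exact: lebesgue_rV_unit_cube.
  apply: contrapT => noH.
  have : (1 <= (2^-1)%:E :> \bar R).
    rewrite -cube1; apply: (cvge_to_le cvgB); apply: nearW => n.
    rewrite leNgt; apply/negP => /ltW; rewrite -[X in _ <= X]/(leb (B n)) -gE => gn.
    by apply: noH; exists n.
  by rewrite lee_fin leNgt invf_lt1 ?ltr0n// ltr1n.
move=> n; split.
  by rewrite -[X in measurable X]setTI; exact: emeasurable_fun_c_infty.
have := @le_integral_abse _ _ _ Q _ measurableT (g n) (2^-1)%R (mg n).
rewrite invr_gt0 ltr0n => /(_ isT).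
under eq_integral do rewrite gee0_abs//.
move=> /le_lt_trans/(_ (intg n)).
rewrite setTI (_ : [set x | _] = H n); last first.
  by apply/seteqP; split => y; rewrite /H /= gee0_abs.
rewrite !ltey => /negP h; apply/eqP => QH; apply: h.
by rewrite QH gt0_muley ?eqxx// lte_fin invr_gt0 ltr0n.
Qed.

(** If 0 is outside the support of [eta y], some box [U n] around 0 has no mass. The exceptional [y]
    are thus covered by the countably many sets [N n], each of which is [Q]-null. *)
Lemma palm_support : {ae Q, forall y, msupport (eta y) 0%R}.
Proof.
pose e (n : nat) : R := (n.+1%:R^-1)%R.
have e0 n : (0 < e n)%R by rewrite invr_gt0 ltr0n.
pose U n : set V := [set x | forall k, (`|x ord0 k| < e n)%R].
pose B n : set V := [set x | forall k, (0 <= x ord0 k < e n)%R].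
have mU n : measurable (U n).
  have -> : U n = \bigcap_(k in [set: 'I_d]) ((fun x : V => x ord0 k) @^-1` ball (0:R)%R (e n)).
    apply/seteqP; split=> [x xC k _|x xC k].
      by rewrite /= /ball/= sub0r normrN; exact: xC.
    by have := xC k I; rewrite /= /ball/= sub0r normrN.
  apply: fin_bigcap_measurable => // k _; rewrite -[X in measurable X]setTI.
  by apply: measurable_coord => //; exact: measurable_ball.
have mB n : measurable (B n).
  have -> : B n = \bigcap_(k in [set: 'I_d]) ((fun x : V => x ord0 k) @^-1` `[0%R, e n[).
    by apply/seteqP; split=> [x xC k _|x xC k]; have := xC k; rewrite /= ?in_itv//; apply.
  apply: fin_bigcap_measurable => // k _; rewrite -[X in measurable X]setTI.
  by apply: measurable_coord => //; exact: measurable_itv.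
have lebB n : leb (B n) = (\prod_(k < d) e n)%R%:E.
  have := @lebesgue_rV_box R d 0 (\row__ e n).
  rewrite (eq_bigr (fun=> e n)) => [|k _]; last by rewrite !mxE subr0.
  move=> <- => [|k]; last by rewrite !mxE ltW.
  by congr (leb _); apply/seteqP; split => x /= + k => /(_ k); rewrite !mxE.
pose N n : set M := [set y | eta y (U n) = 0].
have mN n : measurable (N n).
  rewrite -[N n]setTI.
  have mev : measurable_fun setT (fun y : M => eta y (U n)).
    exact: (measurableT_comp (measurable_lf_eval (mU n)) meta).
  exact: (mev measurableT [set 0] (emeasurable_set1 _)).
(* A point t of the box B n = [0,e)^d has B n inside t + ]-e,e[^d, so one t in B n
   with theta_t y in N n makes B n an (eta y)-null set: either way the integral in
   the Palm formula for N n over B n vanishes. *)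
have QN n : Q (N n) = 0.
  have := palm_formula (mB n) (f := fun y => (\1_(N n) y)%:E).
  rewrite integral_indic// setIT => E0.
  have {}E0 : 0 = Q (N n) * leb (B n).
    rewrite -E0//.
    - apply/esym/integral0_eq => y _.
      have [[t [Bt Nt]]|noN] := pselect (exists t, B n t /\ N n (sh t y)).
        apply: null_set_integral => //.
          apply: measurable_funTS; apply: measurable_indicE => //; by meas.
        have {}Nt : eta (sh t y) (U n) = 0 by [].
        rewrite eta_sh /= /shift_measure /pushforward in Nt.
        apply/eqP; rewrite -measure_le0 -Nt; apply: le_measure; rewrite ?inE//.
          by rewrite -[X in measurable X]setTI; apply: measurable_subrV.
        move=> x Bx k /=; rewrite !mxE; have := Bx k; have := Bt k.
        move=> /andP[t0 te] /andP[x0 xe]; rewrite ltr_norml; apply/andP; split.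
          by rewrite ltrNl opprB (le_lt_trans _ te)// lerBlDr lerDl.
        by rewrite (le_lt_trans _ xe)// lerBlDr lerDl.
      apply: integral0_eq => t Bt; rewrite indicE memNset//.
      by move=> Nt; apply: noN; exists t.
    - exact: measurable_indicE.
  move/esym/eqP: E0; rewrite mule_eq0 => /orP[/eqP ?|]; first by [].
  rewrite lebB eqe gt_eqF//; exact: prodr_gt0.
have [A [mA A0 NA]] : Q.-negligible (\bigcup_n N n).
  by apply: negligible_bigcup => n; apply/negligibleP; [exact: mN|exact: QN].
exists A; split=> //; apply: subset_trans NA.
move=> y /= nsupp; apply: contrapT => yN; apply: nsupp => W oW W0.
have mW := open_measurable_rV oW.
have /nbhs_ballP[r /= r0 rW] : nbhs (0%R : V) W by exact: open_nbhs_nbhs.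
have [n nr] : exists n, (e n < r)%R.
  exists (Num.truncn (r^-1)%R); rewrite /e invf_plt ?posrE//; exact: truncnS_gt.
have UW : U n `<=` W.
  move=> x Ux; apply: rW; split=> // i k; rewrite ord1 /ball/= mxE sub0r normrN.
  exact: lt_trans (Ux k) nr.
rewrite (lt_le_trans _ (le_measure _ _ _ UW)) ?inE// lt0e measure_ge0 andbT.
by apply/eqP => Ny; apply: yN; exists n.
Qed.

Section mass.
Variables (C : set V) (F : M -> V -> \bar R).
Hypotheses (mC : measurable C) (bC : bounded_set C) (dC : leb (boundary C) = 0).
Hypotheses (mF : measurable_fun setT (fun z : M * V => F z.1 z.2))
  (F0 : forall y u, 0 <= F y u).

(** The mass of [C - u]; its inverse [w] normalizes the law of V and is [+oo] where this mass is
    0. *)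
Let eC y u : \bar R := eta y [set x | C (x + u)%R].

Let w y u : \bar R := (eC y u)^-1.

Let mCu u : measurable [set x | C (x + u)%R].
Proof.
have m : measurable_fun setT (fun x : V => (x + u)%R) by meas.
by rewrite -[X in measurable X]setTI; exact: m.
Qed.

Let eCE y u : eC y u = \int[eta y]_x (\1_C (x + u)%R)%:E.
Proof.
rewrite /eC -[LHS]mul1e -(integral_cst (eta y) (mCu u)) [LHS]integral_mkcond.
apply: eq_integral => x _; rewrite patchE indicE.
have -> : (x \in [set x | C (x + u)%R]) = ((x + u)%R \in C).
  by apply/idP/idP; rewrite !inE.
by case: (_ \in C).
Qed.

Lemma measurable_eval_translate :
  measurable_fun setT (fun z : M * V => eta z.1 [set x | C (x + z.2)%R]).
Proof.
rewrite -[X in measurable_fun _ X]/(fun z : M * V => eC z.1 z.2).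
under eq_fun do rewrite eCE.
apply: (measurable_integral_eta (y := fun z : M * V => z.1)
  (g := fun z x => (\1_C (x + z.2)%R)%:E)).
- by meas.
- by apply: measurable_indicE => //; meas.
- by move=> z x; rewrite lee_fin.
Qed.

Let meC : measurable_fun setT (fun z : M * V => eC z.1 z.2).
Proof. exact: measurable_eval_translate. Qed.

Let mw : measurable_fun setT (fun z : M * V => w z.1 z.2).
Proof. by apply: measurable_inve => // z; exact: measure_ge0. Qed.

Let w0 y u : 0 <= w y u. Proof. by rewrite inve_ge0. Qed.

Let mul0 t (x : \bar R) : 0 <= x -> 0 <= (\1_C t)%:E * x.
Proof. by move=> x0; apply: mule_ge0 => //; rewrite lee_fin. Qed.

Local Ltac measE := repeat (apply: emeasurable_funM); first
  [ by apply: measurable_indicE => //; meas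
  | by cbv beta; apply: (measurable_comp2 mw); meas
  | by cbv beta; apply: (measurable_comp2 meC); meas
  | by cbv beta; apply: (measurable_comp2 mF); meas ].

(** For [u] interior to [C], the translate [C - u] contains an open neighbourhood of 0. *)
Lemma translate_support_gt0 y u : msupport (eta y) 0%R -> interior C u ->
  0 < eta y [set x | C (x + u)%R].
Proof.
move=> supp iCu.
pose W := [set x : V | interior C (x + u)%R].
have oW : open W.
  have /continuousP h : continuous (fun x : V => (x + u)%R).
    move=> x; have H := @cvgD R V _ (nbhs x) _ idfun (cst u) x u.
    by apply: H; [exact: cvg_id|exact: cvg_cst].
  by apply: h; exact: open_interior.
have W0 : W 0%R by rewrite /W /= add0r.
apply: (lt_le_trans (supp W oW W0)); apply: le_measure; rewrite ?inE//.
  exact: open_measurable_rV.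
by move=> x /interior_subset.
Qed.

Lemma translate_bounded_lty y u : eta y [set x | C (x + u)%R] < +oo.
Proof.
apply: lf_locally_finite => //; case: bC => m [mr h].
exists (m + `|u|)%R; split; first by rewrite realD.
move=> r mur x /= Cx; rewrite -(addrK u x) (le_trans (ler_normB _ _))// -lerBrDr.
by apply: h => //; rewrite ltrBrDr.
Qed.

Lemma measurable_mass_kernel : measurable_fun setT (fun z : M * V =>
  \int[eta z.1]_v ((\1_C (v + z.2)%R)%:E *
    ((eta z.1 [set x | C (x + z.2)%R])^-1 * F (sh v z.1) (v + z.2)%R))).
Proof.
apply: (measurable_integral_eta (y := fun z : M * V => z.1) (g := fun z v =>
    (\1_C (v + z.2)%R)%:E * (w z.1 z.2 * F (sh v z.1) (v + z.2)%R))).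
- by meas.
- by cbv beta; measE.
- by move=> z v; apply: mul0; exact: mule_ge0.
Qed.

(** The two sides are the two laws in the definition of mass-stationarity, tested on [F] and
    multiplied by [leb C]. With [s = v + u] the weights agree, [w y u = w (sh v y) s]: both refer to
    the same window, seen from two of its points. Hence the left side has the form to which the
    exchange formula applies, and this removes the shift. Integrating over [v] then yields [eC y s],
    which cancels [w y s]. *)
Lemma palm_mass_stationary :
  \int[Q]_y \int[leb]_u ((\1_C u)%:E * \int[eta y]_v ((\1_C (v + u)%R)%:E *
    (w y u * F (sh v y) (v + u)%R))) =
  \int[Q]_y \int[leb]_u ((\1_C u)%:E * F y u).
Proof.
pose g y v := \int[leb]_s ((\1_C (v + s)%R)%:E * ((\1_C s)%:E * (w y s * F y s))).
have wF0 y u y' u' : 0 <= w y u * F y' u' by apply: mule_ge0.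
transitivity (\int[Q]_y \int[eta y]_v g (sh v y) (- v)%R).
  apply: eq_integral => y _.
  transitivity (\int[leb]_u \int[eta y]_v ((\1_C u)%:E * ((\1_C (v + u)%R)%:E *
      (w y u * F (sh v y) (v + u)%R)))).
    apply: eq_integral => u _; rewrite ge0_integralZl//.
    - by measE.
    - by move=> v _; exact: mul0.
  transitivity (\int[eta y]_v \int[leb]_u ((\1_C u)%:E * ((\1_C (v + u)%R)%:E *
      (w y u * F (sh v y) (v + u)%R)))).
    apply: (tonelli (m1 := leb) (m2 := eta y)
      (f := fun z => (\1_C z.1)%:E * ((\1_C (z.2 + z.1)%R)%:E *
        (w y z.1 * F (sh z.2 y) (z.2 + z.1)%R)))).
    - exact: sleb.
    - exact: lf_measure_sigma_finite.
    - by measE.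
    - by move=> z; apply: mul0; exact: mul0.
  apply: eq_integral => v _.
  apply: (etrans _ (integral_lebesgue_rV_shift v (f := fun s =>
    (\1_C (- v + s)%R)%:E * ((\1_C s)%:E * (w (sh v y) s * F (sh v y) s))) _ _)).
  - apply: eq_integral => u _; rewrite addKr; congr (_ * (_ * (_ * _))).
    rewrite /w /eC eta_sh /= /shift_measure /pushforward; congr ((eta y _)^-1).
    by apply/seteqP; split => x /=; rewrite addrA subrK.
  - by measE.
  - by move=> s; apply: mul0; exact: mul0.
have mK : measurable_fun setT (fun z : M * V * V =>
    (\1_C (z.1.2 + z.2)%R)%:E * ((\1_C z.2)%:E * (w z.1.1 z.2 * F z.1.1 z.2))).
  by measE.
rewrite palm_exchange; last 2 first.
- apply: (measurable_fun_integral2 (f := fun z : (M * V) * V =>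
    (\1_C (z.1.2 + z.2)%R)%:E * ((\1_C z.2)%:E * (w z.1.1 z.2 * F z.1.1 z.2)))) => //.
  by move=> z; apply: mul0; exact: mul0.
- by move=> y v; apply: integral_ge0 => s _; apply: mul0; exact: mul0.
transitivity (\int[Q]_y \int[leb]_s (eC y s * ((\1_C s)%:E * (w y s * F y s)))).
  apply: eq_integral => y _.
  apply: (etrans (tonelli (m1 := eta y) (m2 := leb)
    (f := fun z => (\1_C (z.1 + z.2)%R)%:E * ((\1_C z.2)%:E *
      (w y z.2 * F y z.2))) _ _ _ _)) => //.
  - exact: lf_measure_sigma_finite.
  - by measE.
  - by move=> z; apply: mul0; exact: mul0.
  apply: eq_integral => s _ /=; rewrite ge0_integralZr//.
  - by rewrite eCE.
  - by apply: measurable_indicE => //; meas.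
  - exact: mul0.
have L0 y s : 0 <= eC y s * ((\1_C s)%:E * (w y s * F y s)).
  by apply: mule_ge0 => //; exact: mul0.
apply: ge0_ae_eq_integral => //.
- apply: (measurable_fun_integral2 (f := fun z : M * V =>
    eC z.1 z.2 * ((\1_C z.2)%:E * (w z.1 z.2 * F z.1 z.2)))) => //; by measE.
- apply: (measurable_fun_integral2 (f := fun z : M * V => (\1_C z.2)%:E * F z.1 z.2)) => //.
    by measE.
  by move=> z; exact: mul0.
- by move=> y _; apply: integral_ge0.
- by move=> y _; apply: integral_ge0 => u _; exact: mul0.
(* The cancellation holds for [y] with 0 in the support of [eta y] and [s] off the boundary of [C];
   the exceptions are null for [Q] and for Lebesgue measure. *)
have [N [mN N0 NS]] := palm_support.
exists N; split=> //; apply: subset_trans NS => y /= yN supp; apply: yN => _.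
apply: ge0_ae_eq_integral => //.
- by measE.
- by measE.
- by move=> u _; exact: mul0.
exists (boundary C); split=> //.
  apply: measurableD; last by apply: open_measurable_rV; exact: open_interior.
  rewrite -[closure C]setCK; apply: measurableC; apply: open_measurable_rV.
  by apply: closed_openC; exact: closed_closure.
move=> s /= sN; apply: contrapT => sB; apply: sN => _.
have [Cs|nCs] := pselect (C s); last by rewrite indicE memNset// !mul0e mule0.
have iCs : interior C s.
  by apply: contrapT => niCs; apply: sB; split => //; exact: subset_closure.
rewrite /w /eC muleCA; congr (_ * _).
have e0 := translate_support_gt0 supp iCs; have ef := translate_bounded_lty y s.
rewrite muleA divee ?mul1e//; first by rewrite ge0_fin_numE.
by rewrite gt_eqF.
Qed.

End mass.

End palm.

End campbell.

(** * Voronoi cells of lattice points *)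

Section lattice_points.
Context {R : realType} {d : nat}.
Local Notation V := 'rV[R]_d.
Local Notation edist := Defs.edist.
Implicit Types (i j p q s x y : V) (xi : lf_measure R d).

Definition int_row (z : 'rV[int]_d) : V := map_mx intr z.

Lemma latticeP i : lattice i <-> exists z, i = int_row z.
Proof.
split=> [li|[z ->] k]; last by rewrite mxE intr_int.
have /choice[z zE] : forall k, exists m : int, i ord0 k = m%:~R.
  by move=> k; exact/intrP/li.
by exists (\row_k z k); apply/rowP => k; rewrite !mxE zE.
Qed.

Lemma lattice0 : lattice (0 : V).
Proof. by move=> k; rewrite mxE int_num0. Qed.

Lemma latticeD i j : lattice i -> lattice j -> lattice (i + j).
Proof. by move=> li lj k; rewrite mxE rpredD. Qed.

Lemma latticeN i : lattice i -> lattice (- i).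
Proof. by move=> li k; rewrite mxE rpredN. Qed.

Lemma latticeB i j : lattice i -> lattice j -> lattice (i - j).
Proof. by move=> li lj; apply: latticeD => //; exact: latticeN. Qed.

Lemma finite_lattice_box (K : R) :
  finite_set [set i : V | lattice i /\ forall k, `|i ord0 k| <= K].
Proof.
(* [K < n], so adding [n] turns an integer of absolute value at most [K] into an index between 0 and
   [n + n]. *)
pose n := (Num.truncn K).+1.
pose f (g : {ffun 'I_d -> 'I_(n + n).+1}) : V := \row_k ((g k : nat)%:R - n%:R).
apply: (sub_finite_set (B := f @` setT)); last exact/finite_image/finite_finset.
move=> i [li iK].
have /choice[g gE] : forall k, exists m : 'I_(n + n).+1, i ord0 k = (m : nat)%:R - n%:R.
  move=> k; have /intrP[m mE] := li k.
  have := iK k; rewrite mE => mK.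
  have mn : `|m| < n%:Z.
    have : (`|m|%:~R : R) < n%:R.
      by rewrite intr_norm (le_lt_trans mK)// truncnS_gt.
    by rewrite -[n%:R]/(n%:Z%:~R) ltr_int.
  have mn' : (absz m < n)%N by rewrite -ltz_nat abszE.
  have mn2 : (absz (m + n%:Z)%R < (n + n).+1)%N by lia.
  exists (Ordinal mn2) => /=.
  have -> : (absz (m + n%:Z)%R)%:R = (m + n%:Z)%:~R :> R.
    by rewrite -[LHS]/((absz (m + n%:Z)%R)%:Z%:~R); congr intmul; lia.
  by rewrite intrD addrK.
exists [ffun k => g k] => //; apply/rowP => k.
by rewrite mxE ffunE gE.
Qed.

Lemma lex_le_anti x y : lex_le x y -> lex_le y x -> x = y.
Proof.
move=> [//|[k [ek lk]]] [//|[l [el ll]]].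
have [kl|lk'|kl] := ltngtP k l.
- by move: lk; rewrite (el _ kl) ltxx.
- by move: ll; rewrite (ek _ lk') ltxx.
- by move: lk; rewrite (val_inj kl) => /lt_trans/(_ ll); rewrite ltxx.
Qed.

Lemma lex_le_trans y x z : lex_le x y -> lex_le y z -> lex_le x z.
Proof.
move=> [->//|[k [ek lk]]] [<-|[l [el ll]]]; first by right; exists k.
right; have [kl|lk'|kl] := ltngtP k l.
- exists k; split; last by rewrite -(el _ kl).
  by move=> j jk; rewrite ek// el// (ltn_trans jk).
- exists l; split; last by rewrite (ek _ lk').
  by move=> j jl; rewrite ek ?(ltn_trans jl)// el.
- exists k; split; last by rewrite (lt_trans lk)// (val_inj kl).
  by move=> j jk; rewrite ek// el// -kl.
Qed.

(** The first coordinate in which the vectors differ decides. *)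
Lemma lex_le_total x y : lex_le x y \/ lex_le y x.
Proof.
have [->|xy] := eqVneq x y; first by left; left.
have /existsP[k0 k0P] : [exists k, x ord0 k != y ord0 k].
  apply: contrapT => nex; move/eqP: xy; apply; apply/rowP => k.
  by apply: contrapT => /eqP xyk; apply: nex; apply/existsP; exists k.
case: (@arg_minnP _ k0 (fun k => x ord0 k != y ord0 k) (fun k : 'I_d => k : nat) k0P) => k kP kmin.
have eqk (j : 'I_d) : (j < k)%N -> x ord0 j = y ord0 j.
  by move=> jk; apply/eqP; apply: contraLR jk => /kmin; rewrite -leqNgt.
have [xk|yk|/eqP] := ltgtP (x ord0 k) (y ord0 k).
- by left; right; exists k.
- by right; right; exists k; split=> // j /eqk.
- by rewrite (negbTE kP).
Qed.

Lemma finite_min (T : choiceType) (r : T -> T -> Prop) (A : set T) :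
  (forall a, r a a) -> (forall a b, r a b \/ r b a) ->
  (forall b a c, r a b -> r b c -> r a c) ->
  finite_set A -> A !=set0 -> exists2 a, A a & forall b, A b -> r a b.
Proof.
move=> rr rtot rtr /finite_seqP[l ->] [x0 /= x0l].
elim: l x0 x0l => // a [|b l] IHl x0 x0l.
  by exists a; rewrite /= ?mem_head// => c; rewrite inE => /eqP ->.
have [m ml mmin] := IHl b (mem_head _ _).
have [am|ma] := rtot a m.
  exists a; rewrite /= ?mem_head// => c; rewrite inE => /orP[/eqP -> //|/mmin].
  exact: rtr.
exists m; first by rewrite /= inE ml orbT.
by move=> c; rewrite /= inE => /orP[/eqP ->//|/mmin].
Qed.

Lemma coord_le_norm x k : `|x ord0 k| <= `|x|.
Proof.
by rewrite [leRHS]/Num.Def.normr/= mx_normrE; apply/bigmax_geP; right; exists (ord0, k).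
Qed.

Lemma edist_ge0 x y : 0 <= edist x y.
Proof. exact: sqrtr_ge0. Qed.

Lemma edist_sqr x y : edist x y ^+ 2 = \sum_k (x ord0 k - y ord0 k) ^+ 2.
Proof. by rewrite sqr_sqrtr// sumr_ge0// => k _; exact: sqr_ge0. Qed.

Lemma edistD x y s : edist (x + s) (y + s) = edist x y.
Proof.
congr Num.sqrt; apply: eq_bigr => k _; rewrite !mxE; congr (_ ^+ 2).
by rewrite opprD addrACA subrr addr0.
Qed.

Lemma edistxx x : edist x x = 0.
Proof. by rewrite /edist big1 ?sqrtr0// => k _; rewrite subrr expr0n. Qed.

Lemma coord_le_edist x y k : `|x ord0 k - y ord0 k| <= edist x y.
Proof.
rewrite -(ler_pXn2r (_ : 0 < 2)%N) ?nnegrE ?edist_ge0// edist_sqr.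
rewrite (bigD1 k)//= real_normK ?num_real// lerDl sumr_ge0// => j _.
exact: sqr_ge0.
Qed.

Lemma edist_eq0 x y : edist x y = 0 -> x = y.
Proof.
move=> xy0; apply/rowP => k; apply/eqP; rewrite -subr_eq0 -normr_eq0.
by rewrite eq_le normr_ge0 andbT -xy0 coord_le_edist.
Qed.

Lemma is_closest_unique (N : set V) i p q :
  is_closest N i p -> is_closest N i q -> p = q.
Proof.
move=> [Np hp] [Nq hq]; have [pq lpq] := hp q Nq; have [qp lqp] := hq p Np.
have e : edist i p = edist i q by apply/eqP; rewrite eq_le pq qp.
by apply: lex_le_anti; [exact: lpq|exact: lqp].
Qed.

(** Only the finitely many points no farther from [i] than one fixed [q0] compete; [r] orders them
    by distance, and lexicographically at equal distance. All other points of [N] are strictly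
    farther away than [q0]. *)
Lemma is_closest_exists (N : set V) i : N `<=` lattice -> N !=set0 ->
  exists p, is_closest N i p.
Proof.
move=> Nl [q0 Nq0].
pose A := [set q | N q /\ edist i q <= edist i q0].
have finA : finite_set A.
  apply: (@sub_finite_set _ _
    [set j : V | lattice j /\ forall k, `|j ord0 k| <= edist i q0 + `|i|]).
    move=> q [Nq qq0]; split; first exact: Nl.
    move=> k; rewrite -(subrK (i ord0 k) (q ord0 k)).
    rewrite (le_trans (ler_normD _ _))// lerD//.
      by rewrite distrC (le_trans (coord_le_edist _ _ _)).
    exact: coord_le_norm.
  exact: finite_lattice_box.
pose r p q := edist i p < edist i q \/ (edist i p = edist i q /\ lex_le p q).
have [] := @finite_min _ r A _ _ _ finA.
- by move=> x; right; split=> //; left.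
- move=> x y; have [xy|yx|xy] := ltgtP (edist i x) (edist i y).
  + by left; left.
  + by right; left.
  + by have [xy'|yx] := lex_le_total x y; [left|right]; right.
- move=> y x z [xy|[xy lxy]] [yz|[yz lyz]].
  + by left; exact: lt_trans xy yz.
  + by left; rewrite -yz.
  + by left; rewrite xy.
  + by right; rewrite xy yz; split=> //; exact: lex_le_trans lxy lyz.
- by exists q0; split.
move=> p [Np pq0] pmin; exists p; split=> // q Nq.
have [qq0|q0q] := leP (edist i q) (edist i q0).
  have [pq|[-> lpq]] := pmin q (conj Nq qq0); last by split.
  by split; [exact: ltW|move=> e; move: pq; rewrite e ltxx].
have pq := le_lt_trans pq0 q0q.
by split; [exact: ltW|move=> e; move: pq; rewrite e ltxx].
Qed.

Lemma lex_leD x y s : lex_le (x + s) (y + s) <-> lex_le x y.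
Proof.
have main (u v t : V) : lex_le u v -> lex_le (u + t) (v + t).
  move=> [->|[k [ek lk]]]; [by left|right; exists k; split].
    by move=> j jk; rewrite !mxE ek.
  by rewrite !mxE ltrD2r.
by split=> [/(main _ _ (- s))|/main//]; rewrite !addrK.
Qed.

Lemma is_closestD (N : set V) i p s :
  is_closest [set x : V | N (x + s)] i p <-> is_closest N (i + s) (p + s).
Proof.
split=> -[Np h]; split=> //.
  move=> q Nq; have := h (q - s); rewrite /= subrK => /(_ Nq)[pq lpq].
  have e : edist (i + s) q = edist i (q - s) by rewrite -[in LHS](subrK s q) edistD.
  by rewrite edistD e; split=> // /lpq; rewrite -[in lex_le _ q](subrK s q) lex_leD.
move=> q /= /h; rewrite !edistD => -[pq lpq]; split=> // /lpq.
by rewrite lex_leD.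
Qed.

End lattice_points.

Section voronoi_tessellation.
Context {R : realType} {d : nat}.
Local Notation V := 'rV[R]_d.
Local Notation edist := Defs.edist.
Implicit Types (i j p q s x y : V) (xi : lf_measure R d).

Lemma occupied_lattice xi : occupied xi `<=` lattice.
Proof. by move=> i []. Qed.

Lemma occupied_shift xi s : lattice s ->
  occupied (shift_lf s xi) = [set j : V | occupied xi (j + s)].
Proof.
move=> ls; have shE B : shift_lf s xi B = xi [set x + s | x in B].
  exact: shift_measureE.
apply/seteqP; split => j.
  move=> [lj]; rewrite shE => h; split; first exact: latticeD.
  rewrite (_ : [set _ | _ in _] = [set x + s | x in [set (j + x)%R | x in unit_cube]])//.
  apply/seteqP; split => [_ [x xC <-]|_ [_ [x xC <-] <-]].
    by exists (j + x); [exists x|rewrite addrAC].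
  by exists x => //; rewrite addrAC.
move=> [ljs h]; split; first by rewrite -[j](addrK s); exact: latticeB.
rewrite shE (_ : [set _ | _ in _] = [set (j + s + x)%R | x in unit_cube])//.
apply/seteqP; split => [_ [_ [x xC <-] <-]|_ [x xC <-]].
  by exists x => //; rewrite addrAC.
by exists (j + x); [exists x|rewrite addrAC].
Qed.

(** The default value [i] moves along with the shift, so the identity covers the case of no occupied
    point. *)
Lemma voronoi_point_shift xi s i : lattice s ->
  voronoi_point (shift_lf s xi) i = voronoi_point xi (i + s) - s.
Proof.
move=> ls; rewrite /voronoi_point occupied_shift//.
have [[p clp]|noc] := pselect (exists p, is_closest (occupied xi) (i + s) p).
  have cl' : is_closest [set j : V | occupied xi (j + s)] i (p - s).
    by apply/is_closestD; rewrite subrK.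
  rewrite (xget_unique _ cl'); last by move=> q /is_closest_unique; apply.
  by rewrite (xget_unique _ clp)// => q /is_closest_unique; apply.
rewrite !xgetPN ?addrK//.
- by move=> p clp; apply: noc; exists p.
- by move=> p /is_closestD clp; apply: noc; exists (p + s).
Qed.

Lemma voronoi_pointP xi i : occupied xi !=set0 ->
  is_closest (occupied xi) i (voronoi_point xi i).
Proof.
by move=> N0; apply: xgetPex; apply: is_closest_exists => //; exact: occupied_lattice.
Qed.

Lemma lattice_voronoi_point xi i : lattice i -> lattice (voronoi_point xi i).
Proof.
move=> li; rewrite /voronoi_point; case: xgetP => [p _ [Np _]|//].
exact: occupied_lattice Np.
Qed.

Lemma voronoi_point_occupied xi i : occupied xi i -> voronoi_point xi i = i.
Proof.
move=> oi; apply: xget_unique.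
  split=> // q _; rewrite edistxx edist_ge0; split=> // /esym/edist_eq0 ->.
  by left.
move=> p [_ /(_ _ oi)[+ _]]; rewrite edistxx => h.
by apply/esym/edist_eq0/eqP; rewrite eq_le h edist_ge0.
Qed.

Lemma measurable_cube_at i : measurable [set (i + x)%R | x in @unit_cube R d].
Proof.
rewrite (_ : [set _ | _ in _] = (fun x => x - i) @^-1` unit_cube).
  rewrite -[X in measurable X]setTI; apply: measurable_subrV => //.
  exact: measurable_unit_cube.
apply/seteqP; split => [_ [x xC <-]|x xC] /=; first by rewrite addrAC subrr add0r.
by exists (x - i) => //; rewrite addrC subrK.
Qed.

(** The open box [W] of half-side 1 around [x] is covered by the unit cubes whose lattice corner is
    within 2 of [x]: 1 for the box and 1 for rounding down. Were none of these cubes charged, [W]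
    would be a null neighbourhood of [x]. *)
Lemma msupport_near_occupied xi x : msupport xi x ->
  exists2 q, occupied xi q & forall k, `|q ord0 k - x ord0 k| <= 2.
Proof.
move=> supp; apply: contrapT => noq.
pose W : set V := [set y | forall k, `|y ord0 k - x ord0 k| < 1].
have oW : open W.
  have -> : W = ball x 1.
    apply/seteqP; split => [y yW|y [_ yW] k]; last first.
      by have := yW ord0 k; rewrite /ball/= distrC.
    by split=> // i k; rewrite ord1 /ball/= distrC; exact: yW.
  exact: ball_open.
have Wx : W x by move=> k; rewrite subrr normr0.
(* Integer vectors are enumerated by their codes; numbers that code no vector, or a vector too far
   from [x], contribute the empty set. *)
pose F (n : nat) : set V := if @unpickle 'rV[int]_d n is Some z then
    (if `[< forall k, `|(int_row z : V) ord0 k - x ord0 k| <= 2 >] then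
    [set (int_row z + x)%R | x in unit_cube] else set0) else set0.
have mF n : measurable (F n).
  rewrite /F; case: unpickle => // z; case: ifPn => // _; exact: measurable_cube_at.
have F0 n : xi (F n) = 0%E.
  rewrite /F; case: unpickle => [z|]; last by rewrite measure0.
  case: ifPn => [/asboolP zx|_]; last by rewrite measure0.
  apply: contrapT => /eqP xiz; apply: noq; exists (int_row z) => //; split.
    by apply/latticeP; exists z.
  by rewrite lt0e xiz measure_ge0.
have WF : W `<=` \bigcup_n F n.
  move=> y yW; pose z : 'rV[int]_d := \row_k Num.floor (y ord0 k).
  have zE k : (int_row z : V) ord0 k = (Num.floor (y ord0 k))%:~R by rewrite !mxE.
  have zy k : 0 <= y ord0 k - (int_row z : V) ord0 k < 1.
    rewrite zE; have /andP[h1] := real_floor_itv (num_real (y ord0 k)).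
    by rewrite intrD => h2; rewrite subr_ge0 h1 ltrBlDl.
  exists (pickle z) => //; rewrite /F pickleK ifT.
    exists (y - int_row z); last by rewrite addrC subrK.
    by move=> k; rewrite !mxE; have := zy k; rewrite !mxE.
  apply/asboolP => k; have /andP[z0 z1] := zy k; have := yW k.
  rewrite ltr_norml => /andP[h1 h2]; rewrite ler_norml; apply/andP; split; lra.
have := supp W oW Wx; rewrite lt0e => /andP[/eqP xiW _]; apply: xiW.
apply/eqP; rewrite -measure_le0.
have mU : measurable (\bigcup_n F n) by exact: bigcup_measurable.
apply: (@le_trans _ _ (xi (\bigcup_n F n))).
  by apply: le_measure; rewrite ?inE//; exact: open_measurable_rV.
have [A [mA A0 NA]] : xi.-negligible (\bigcup_n F n).
  by apply: negligible_bigcup => n; apply/negligibleP; [exact: mF|exact: F0].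
by rewrite -A0; apply: le_measure; rewrite ?inE.
Qed.

(** Without occupied points the support is empty, and so is its hull, the empty set being convex. *)
Lemma occupied_nonempty xi : conv_hull (msupport xi) = setT ->
  occupied xi !=set0.
Proof.
move=> hull; apply: contrapT => N0.
have : conv_hull (msupport xi) `<=` set0.
  apply: smallest_sub; first by move=> x y l; rewrite !inE.
  by move=> x /msupport_near_occupied[q oq _]; apply: N0; exists q.
by rewrite hull => /(_ 0 I).
Qed.

(** A member [j] is no farther from the nucleus [p] than from any occupied [q], which bounds the
    component of [j - p] along [q - p]. Support points are merely close to occupied points, so for
    them the bound carries an error proportional to [nrm (j - p)]; testing with sufficiently long
    vectors absorbs it. *)
Lemma finite_voronoi_cell xi i : conv_hull (msupport xi) = setT ->
  finite_set (voronoi_cell xi i).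
Proof.
move=> hull; have N0 := occupied_nonempty hull.
pose p := voronoi_point xi i; pose A := voronoi_cell xi i.
have Acl j : A j -> is_closest (occupied xi) j p.
  by move=> [_ jp]; rewrite /p -jp; exact: voronoi_pointP.
pose dot (x y : V) := \sum_k x ord0 k * y ord0 k.
pose nrm (x : V) := \sum_k `|x ord0 k|.
have dotle j q : A j -> occupied xi q -> dot (j - p) (q - p) <= dot (q - p) (q - p).
  move=> /Acl[_ /[apply]] [jpq _].
  have : edist j p ^+ 2 <= edist j q ^+ 2 by rewrite ler_pXn2r ?nnegrE ?edist_ge0.
  rewrite !edist_sqr => h.
  have E : \sum_k (j ord0 k - q ord0 k) ^+ 2 = \sum_k (j ord0 k - p ord0 k) ^+ 2 +
      (dot (q - p) (q - p) - (dot (j - p) (q - p) + dot (j - p) (q - p))).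
    rewrite /dot -!big_split/= -sumrB -big_split/=; apply: eq_bigr => k _.
    by rewrite !mxE; ring.
  (* Expanding the squares bounds twice the product by [dot (q - p) (q - p)]; as this is
     nonnegative, the weaker bound on the product itself follows. *)
  have : 0 <= dot (q - p) (q - p) by apply: sumr_ge0 => k _; rewrite -expr2 sqr_ge0.
  rewrite E in h; move: h.
  move: (dot (j - p) (q - p)) (dot (q - p) (q - p)) (\sum_k _) => u v n; lra.
(* W is convex and contains supp xi: an x in supp xi has an occupied q with
   |x_k - q_k| <= 2 for all k, and dotle bounds the part of x - p along q - p. *)
pose W : set V := [set x | exists K, forall j, A j -> dot (j - p) (x - p) <= K + 2 * nrm (j - p)].
have WT : W = setT.
  apply/seteqP; split=> // x _.
  have : conv_hull (msupport xi) x by rewrite hull.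
  move: x; apply: smallest_sub.
    move=> x y l; rewrite !inE => -[K1 h1] [K2 h2].
    have l0 : 0 <= l%:num by []. have l1 : 0 <= 1 - l%:num by rewrite subr_ge0.
    exists (l%:num * K1 + (1 - l%:num) * K2) => j Aj.
    have -> : dot (j - p) (l%:num *: (x : V) + (1 - l%:num) *: (y : V) - p) =
        l%:num * dot (j - p) (x - p) + (1 - l%:num) * dot (j - p) (y - p).
      rewrite /dot !mulr_sumr -big_split/=; apply: eq_bigr => k _; rewrite !mxE; ring.
    have := ler_wpM2l l0 (h1 j Aj); have := ler_wpM2l l1 (h2 j Aj).
    move: (dot _ _) (dot _ _) (nrm _) => u v n h3 h4; clear -l0 l1 h3 h4; nra.
  move=> x /msupport_near_occupied[q oq qx].
  exists (dot (q - p) (q - p)) => j Aj.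
  have -> : dot (j - p) (x - p) = dot (j - p) (q - p) + dot (j - p) (x - q).
    by rewrite /dot -big_split/=; apply: eq_bigr => k _; rewrite !mxE; ring.
  rewrite lerD ?dotle// /dot /nrm mulr_sumr ler_sum// => k _.
  rewrite (le_trans (ler_norm _))// normrM mulrC ler_wpM2r//.
  by rewrite !mxE distrC.
(* p + M e_k and p - M e_k lie in W. Summed over k, this gives
   M |j - p|_1 <= \sum_k K k + 2 d |j - p|_1, where M > 2 d. *)
pose M : R := 2 * d%:R + 1.
have /choice[K hK] : forall k : 'I_d, exists K : R, forall j, A j ->
    M * `|(j - p) ord0 k| <= K + 2 * nrm (j - p).
  move=> k.
  have dotM j (a : R) : dot (j - p) (p + a *: delta_mx ord0 k - p) = a * (j - p) ord0 k.
    rewrite /dot (bigD1 k)//= big1 ?addr0.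
      by rewrite !mxE !eqxx/=; ring.
    by move=> l lk; rewrite !mxE eqxx (negbTE lk)/=; ring.
  have [K1 h1] : W (p + M *: delta_mx ord0 k) by rewrite WT.
  have [K2 h2] : W (p + (- M) *: delta_mx ord0 k) by rewrite WT.
  exists (Num.max K1 K2) => j Aj.
  have := h1 j Aj; have := h2 j Aj; rewrite !dotM => g2 g1.
  have K1m : K1 <= Num.max K1 K2 by rewrite le_max lexx.
  have K2m : K2 <= Num.max K1 K2 by rewrite le_max lexx orbT.
  by case: (ger0P ((j - p) ord0 k)) => _; lra.
have nrmK j : A j -> nrm (j - p) <= \sum_k K k.
  move=> Aj.
  have : \sum_(k < d) M * `|(j - p) ord0 k| <= \sum_(k < d) (K k + 2 * nrm (j - p)).
    by apply: ler_sum => k _; exact: hK.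
  rewrite -mulr_sumr big_split/= sumr_const card_ord -mulr_natr -/(nrm _) /M.
  move: (nrm _) (\sum_k K k) => n S; lra.
apply: (@sub_finite_set _ _
    [set j : V | lattice j /\ forall k, `|j ord0 k| <= \sum_k K k + `|p|]).
  move=> j Aj; split; first by case: Aj.
  move=> k; rewrite -(subrK (p ord0 k) (j ord0 k)) (le_trans (ler_normD _ _))// lerD//.
    rewrite (le_trans _ (nrmK j Aj))// /nrm (bigD1 k)//= !mxE lerDl.
    by apply: sumr_ge0.
  exact: coord_le_norm.
exact: finite_lattice_box.
Qed.

End voronoi_tessellation.

(** * Lattice sums as integrals, and measurability of Voronoi points *)

Section lattice_measure.
Local Open Scope ereal_scope.
Context {R : realType} {d : nat}.
Local Notation V := 'rV[R]_d.
Implicit Types (i j p q s x y : V) (xi : lf_measure R d).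

Lemma measurable_set1_rV (x : V) : measurable [set x].
Proof.
have -> : [set x] = \bigcap_(k in [set: 'I_d]) ((fun z : V => z ord0 k) @^-1` [set x ord0 k]).
  apply/seteqP; split=> [z -> k _ //|z zx]; apply/rowP => k; exact: zx.
apply: fin_bigcap_measurable => // k _; rewrite -[X in measurable X]setTI.
by apply: measurable_coord => //; exact: measurable_set1.
Qed.

Lemma lattice_bigcup : @lattice R d = \bigcup_(z : 'rV[int]_d) [set int_row z].
Proof.
apply/seteqP; split=> [i /latticeP[z ->]|i [z _ ->]]; first by exists z.
by apply/latticeP; exists z.
Qed.

Lemma measurable_lattice : measurable (@lattice R d).
Proof.
rewrite lattice_bigcup; apply: countable_bigcupT_measurable => // z.
exact: measurable_set1_rV.
Qed.

Lemma counting_gt0 (A : set V) x : A x -> 0 < (counting A : \bar R).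
Proof.
move=> Ax; rewrite /counting; case: ifPn => // /asboolP finA.
rewrite lte_fin ltr0n finmap.cardfs_gt0; apply/finmap.fset0Pn; exists x.
by rewrite in_fset_set// inE.
Qed.

Lemma counting_lty (A : set V) : finite_set A <-> (counting A : \bar R) < +oo.
Proof. by rewrite /counting; case: ifPn => /asboolP; rewrite ?ltry ?ltxx. Qed.

Lemma counting_image (T : choiceType) (f : T -> T) (g : T -> T) (A : set T) :
  cancel f g -> counting [set f x | x in A] = counting A :> \bar R.
Proof.
move=> fK; have E : [set g y | y in [set f x | x in A]] = A.
  apply/seteqP; split => [_ [_ [x Ax <-] <-]|x Ax]; first by rewrite fK.
  by exists (f x); [exists x|].
rewrite /counting; case: ifPn => /asboolP h1; case: ifPn => /asboolP h2 //.
- by rewrite fset_set_image// finmap.card_imfset//; exact: can_inj fK.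
- by exfalso; apply: h2; rewrite -E; exact: finite_image.
- by exfalso; apply: h1; exact: finite_image.
Qed.

Definition lattice_measure : {measure set V -> \bar R} :=
  mrestr (@counting V R : {measure set V -> \bar R}) measurable_lattice.

Local Notation L := lattice_measure.

Lemma lattice_measureE A : L A = counting (A `&` lattice).
Proof. by []. Qed.

Lemma lattice_measure_sigma_finite : sigma_finite setT L.
Proof.
exists norm_ball; first by rewrite bigcup_norm_ball.
move=> n; split; first exact: measurable_norm_ball.
apply/counting_lty; apply: sub_finite_set (@finite_lattice_box R d n%:R).
move=> i [/= ni li]; split => // k.
by rewrite (le_trans (coord_le_norm _ _))// ltW.
Qed.

Lemma integral_lattice_reflect (f : V -> \bar R) :
  measurable_fun setT f -> (forall x, 0 <= f x) ->
  \int[L]_j f (- j)%R = \int[L]_j f j.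
Proof.
move=> mf f0.
have mN : measurable_fun setT (fun j : V => (- j)%R) by exact: measurable_funN_rV.
have [m [mE mint]] := law_measure L mN.
rewrite -mint//; apply: eq_measure_integral => A mA _.
rewrite mE !lattice_measureE.
rewrite -(@counting_image _ -%R -%R _ (@opprK _)); congr counting.
apply/seteqP; split => [_ [j [Aj lj] <-]|j [Aj lj]].
  by split => //; exact: latticeN.
by exists (- j)%R; [split; [rewrite /= opprK|exact: latticeN]|rewrite opprK].
Qed.

Lemma integral_lattice_point a (g : V -> \bar R) : lattice a ->
  measurable_fun setT g -> (forall x, 0 <= g x) ->
  \int[L]_j ((\1_[set a] j)%:E * g j) = g a.
Proof.
move=> la mg g0.
transitivity (\int[L]_(j in [set a]) cst (g a) j).
  rewrite [RHS]integral_mkcond; apply: eq_integral => j _.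
  rewrite patchE indicE; case: ifPn => [/set_mem ->|_]; last by rewrite mul0e.
  by rewrite mul1e.
rewrite integral_cst; last exact: measurable_set1_rV.
rewrite lattice_measureE (_ : [set a] `&` lattice = [set a]).
  by rewrite /counting asboolT// fset_set1 finmap.cardfs1 mule1.
by apply/seteqP; split=> [j []//|j ->].
Qed.

Lemma measurable_occupied i : measurable [set xi | occupied xi i].
Proof.
have [li|nli] := pselect (lattice i); last first.
  by rewrite [X in measurable X](_ : _ = set0)//; apply/seteqP; split => // xi [].
have -> : [set xi | occupied xi i] =
    [set xi : lf_measure R d | 0 < xi [set (i + x)%R | x in @unit_cube R d]].
  by apply/seteqP; split=> [xi []//|xi h]; split.
rewrite -[X in measurable X]setTI; apply: emeasurable_fun_o_infty => //.
exact: (measurable_lf_eval (measurable_cube_at i)).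
Qed.

(** Whether a competitor [q] leaves [p] closest ([ok q]) does not depend on [xi]. Only the
    occupation of [q] does, and competitors range over a countable lattice. *)
Lemma measurable_is_closest i p : measurable [set xi | is_closest (occupied xi) i p].
Proof.
pose ok q := (Defs.edist i p <= Defs.edist i q)%R /\
  (Defs.edist i p = Defs.edist i q -> lex_le p q).
pose B (z : 'rV[int]_d) := [set xi | occupied xi (int_row z)] `&`
  [set xi : lf_measure R d | ~ ok (int_row z)].
have -> : [set xi | is_closest (occupied xi) i p] =
    [set xi | occupied xi p] `&` ~` \bigcup_z B z.
  apply/seteqP; split => [xi [op h]|xi [op h]].
    by split=> // -[z _ [oz]]; apply; exact: h.
  split=> // q oq; have /latticeP[z zq] := occupied_lattice oq.
  apply: contrapT => nok; apply: h; exists z => //; split; rewrite /= -zq//.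
apply: measurableI; first exact: measurable_occupied.
apply: measurableC; apply: countable_bigcupT_measurable => // z.
apply: measurableI; first exact: measurable_occupied.
have [hok|nok] := pselect (ok (int_row z)).
  by rewrite [X in measurable X](_ : _ = set0)//; apply/seteqP; split.
by rewrite [X in measurable X](_ : _ = setT)//; apply/seteqP; split.
Qed.

(** Two cases make up the event: [j] is a closest point, or no closest point exists and the default
    [i] equals [j]. *)
Lemma measurable_voronoi_point_eq i j :
  measurable [set xi | voronoi_point xi i = j].
Proof.
pose N : set (lf_measure R d) :=
  \bigcup_(z : 'rV[int]_d) [set xi | is_closest (occupied xi) i (int_row z)].
have mN : measurable N.
  by apply: countable_bigcupT_measurable => // z; exact: measurable_is_closest.
have -> : [set xi | voronoi_point xi i = j] =
    [set xi | is_closest (occupied xi) i j] `|` (~` N `&` [set xi : lf_measure R d | i = j]).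
  apply/seteqP; split => [xi|xi [cl|[nN /= <-]]].
  - rewrite /= /voronoi_point; case: xgetP => [p _ clp <-|nc <-]; first by left.
    by right; split=> // -[z _]; exact: nc.
  - have cl' : is_closest (occupied xi) i j := cl.
    by rewrite /= /voronoi_point (xget_unique _ cl')// => q /is_closest_unique; apply.
  - rewrite /= /voronoi_point xgetPN// => p clp; apply: nN.
    by have /latticeP[z zp] := occupied_lattice clp.1; exists z => //=; rewrite -zp.
apply: measurableU; first exact: measurable_is_closest.
apply: measurableI; first exact: measurableC.
have [->|ij] := pselect (i = j).
  by rewrite [X in measurable X](_ : _ = setT)//; apply/seteqP; split.
by rewrite [X in measurable X](_ : _ = set0)//; apply/seteqP; split.
Qed.

Lemma measurable_voronoi_point i : lattice i ->
  measurable_fun setT (fun xi => voronoi_point xi i).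
Proof.
move=> li _ B mB; rewrite setTI.
have -> : (fun xi => voronoi_point xi i) @^-1` B = \bigcup_(z : 'rV[int]_d)
    ([set xi | voronoi_point xi i = int_row z] `&`
     [set xi : lf_measure R d | B (int_row z)]).
  apply/seteqP; split => [xi Bv|xi [z _ [vz /= Bz]]]; last by rewrite /= vz.
  have /latticeP[z zE] := lattice_voronoi_point xi li.
  by exists z => //; split => //=; rewrite -zE.
apply: countable_bigcupT_measurable => // z.
apply: measurableI; first exact: measurable_voronoi_point_eq.
have [hok|nok] := pselect (B (int_row z)).
  by rewrite [X in measurable X](_ : _ = setT)//; apply/seteqP; split.
by rewrite [X in measurable X](_ : _ = set0)//; apply/seteqP; split.
Qed.

(* The nucleus of a lattice point is the point of occupied xi its cell belongs to. *)
Definition nucleus0 : set (lf_measure R d * V) :=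
  [set z | lattice z.2 /\ voronoi_point z.1 z.2 = 0%R].

Lemma measurable_nucleus0 : measurable nucleus0.
Proof.
have -> : nucleus0 = \bigcup_(z : 'rV[int]_d)
    ([set xi | voronoi_point xi (int_row z) = 0%R] `*` [set int_row z]).
  apply/seteqP; split => [[xi i] [/= /latticeP[z ->] vz]|[xi i] [z _ [/= vz ->]]].
    by exists z.
  by split=> //=; apply/latticeP; exists z.
apply: countable_bigcupT_measurable => // z; apply: measurableX.
  exact: measurable_voronoi_point_eq.
exact: measurable_set1_rV.
Qed.

End lattice_measure.

Lemma inve_fine (R : realType) (x : \bar R) : (0 < x < +oo)%E ->
  (x^-1 = (fine x^-1)%:E)%E.
Proof.
by case: x => [r| |]//; rewrite lte_fin ltry andbT => r0; rewrite inver gt_eqF.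
Qed.

(** * The uniform law on the cell of a nucleus at 0 *)

Section uniform_nucleus.
Local Open Scope ereal_scope.
Context {R : realType} {d : nat} {dM : measure_display} {M : measurableType dM}.
Local Notation V := 'rV[R]_d.
Local Notation L := (@lattice_measure R d).
Variable eta : M -> lf_measure R d.
Hypothesis meta : measurable_fun setT eta.

(* The cell of the nucleus 0; it is empty if 0 is not occupied, except that it
   is {0} if nothing is occupied, by the default value of voronoi_point. *)
Definition cell0 (xi : lf_measure R d) : set V :=
  [set i | lattice i /\ voronoi_point xi i = 0%R].

Local Notation c0 y := (counting (cell0 (eta y)) : \bar R).
Local Notation nuc y j := ((\1_nucleus0 (eta y, j))%:E : \bar R).

Definition finite_cell0 (xi : lf_measure R d) : Prop := 0 < (counting (cell0 xi) : \bar R) < +oo.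

Lemma measurable_cell0 xi : measurable (cell0 xi).
Proof.
rewrite (_ : cell0 xi = xsection nucleus0 xi).
  by apply: measurable_xsection; exact: measurable_nucleus0.
by apply/seteqP; split => x; rewrite /xsection /= inE.
Qed.

Lemma measurable_indic_nucleus0 : measurable_fun setT (fun z : M * V => nuc z.1 z.2).
Proof.
apply: (measurable_indicE measurable_nucleus0 (g := fun z : M * V => (eta z.1, z.2))).
apply: measurable_fun_pair => //; exact: (measurableT_comp meta measurable_fst).
Qed.

Lemma measurable_indic_nucleus0r (xi : lf_measure R d) :
  measurable_fun setT (fun j : V => (\1_nucleus0 (xi, j))%:E : \bar R).
Proof.
apply: (measurable_indicE measurable_nucleus0 (g := fun j : V => (xi, j))).
by apply: measurable_fun_pair.
Qed.

Lemma counting_cell0I xi (B : set V) : measurable B ->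
  counting (cell0 xi `&` B) = \int[L]_j ((\1_nucleus0 (xi, j))%:E * (\1_B j)%:E).
Proof.
move=> mB; have mcB : measurable (cell0 xi `&` B).
  by apply: measurableI => //; exact: measurable_cell0.
transitivity (\int[L]_j (\1_(cell0 xi `&` B) j)%:E).
  rewrite integral_indic// setIT lattice_measureE; congr counting.
  by apply/seteqP; split=> [i [[li vi] Bi]|i []//]; split.
apply: eq_integral => j _; rewrite !indicE.
have -> : (j \in cell0 xi `&` B) = ((xi, j) \in nucleus0) && (j \in B).
  by apply/idP/andP; rewrite !inE => -[].
by case: (_ \in nucleus0); case: (_ \in B); rewrite /= ?mule1 ?mule0.
Qed.

Lemma measurable_counting_cell0 : measurable_fun setT (fun y : M => c0 y).
Proof.
have E y : c0 y = \int[L]_j nuc y j.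
  rewrite -[cell0 _]setIT counting_cell0I//; apply: eq_integral => j _.
  by rewrite indicT mule1.
under eq_fun do rewrite E.
apply: (measurable_fun_integral2 (f := fun z : M * V => nuc z.1 z.2)).
- exact: lattice_measure_sigma_finite.
- exact: measurable_indic_nucleus0.
- by move=> z; rewrite lee_fin.
Qed.

(** A probability kernel needs a value at every [y]: where the cell is empty or infinite, the point
    mass at 0 fills in. Measurability comes from writing counts as integrals against
    [lattice_measure]. *)
Lemma uniform_nucleus_kernel : exists u : R.-pker M ~> V,
  (forall y, finite_cell0 (eta y) -> forall B, measurable B ->
    u y B = counting (cell0 (eta y) `&` B) / c0 y).
Proof.
have nuc0 y j : 0 <= nuc y j by rewrite lee_fin.
have cf y : finite_cell0 (eta y) -> (c0 y)^-1 = (fine (c0 y)^-1)%:E.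
  exact: inve_fine.
have : forall y, exists m : {measure set V -> \bar R}, forall B, measurable B ->
    m B = if `[< finite_cell0 (eta y) >] then counting (cell0 (eta y) `&` B) / c0 y
          else \d_(0%R : V) B.
  move=> y; have [g|ng] := pselect (finite_cell0 (eta y)); last first.
    by exists \d_(0%R : V) => B _; rewrite asboolF.
  pose h j : R := (fine (c0 y)^-1 * \1_nucleus0 (eta y, j))%R.
  have mh : measurable_fun setT h.
    apply: measurable_funM; first exact: measurable_cst.
    by apply/measurable_EFinP; exact: measurable_indic_nucleus0r.
  have h0 j : (0 <= h j)%R by rewrite mulr_ge0// fine_ge0// inve_ge0.
  have ml A : measurable A -> measurable_fun setT (fun j : V => \d_j A : \bar R).
    by move=> mA; exact: measurable_fun_dirac.
  have [m mE] := mixture_measure L mh h0 ml.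
  exists m => B mB; rewrite asboolT// mE// counting_cell0I// muleC -ge0_integralZl//.
  - by apply: eq_integral => j _; rewrite /h /= diracE indicE cf// EFinM muleA.
  - apply: emeasurable_funM; first exact: measurable_indic_nucleus0r.
    exact/measurable_EFinP/measurable_indic.
  - by rewrite inve_ge0.
move=> /choice[u uE].
have mgood : measurable [set y | finite_cell0 (eta y)].
  rewrite (_ : [set _ | _] = [set y | 0 < c0 y] `&` [set y | c0 y < +oo]); last first.
    by apply/seteqP; split => y /andP.
  apply: measurableI; rewrite -[X in measurable X]setTI.
    by apply: emeasurable_fun_o_infty => //; exact: measurable_counting_cell0.
  by apply: emeasurable_fun_infty_o => //; exact: measurable_counting_cell0.
have mu_ B : measurable B -> measurable_fun setT (fun y => u y B).
  move=> mB; under eq_fun do rewrite uE//.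
  apply: measurable_fun_if => //.
  - apply: (measurable_fun_bool true); rewrite setTI.
    rewrite (_ : _ @^-1` _ = [set y | finite_cell0 (eta y)])//.
    by apply/seteqP; split => y /= /asboolP.
  - apply: measurable_funTS; apply: emeasurable_funM; last first.
      by apply: measurable_inve => //; exact: measurable_counting_cell0.
    under eq_fun do rewrite counting_cell0I//.
    apply: (measurable_fun_integral2 (f := fun z : M * V => nuc z.1 z.2 * (\1_B z.2)%:E)).
    + exact: lattice_measure_sigma_finite.
    + apply: emeasurable_funM; first exact: measurable_indic_nucleus0.
      by apply: measurable_indicE.
    + by move=> z; apply: mule_ge0; rewrite lee_fin.
have u1 y : u y setT = 1.
  rewrite uE//; case: ifPn => [/asboolP g|_]; last by rewrite diracT.
  have /andP[c1 c2] := g.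
  by rewrite setIT divee// ?gt_eqF// ge0_fin_numE// ltW.
pose ku := isKernel.Build _ _ _ _ _ u mu_.
pose u' : R.-ker M ~> V := HB.pack u ku.
pose pu := Kernel_isProbability.Build _ _ _ _ _ u' u1.
pose u'' : R.-pker M ~> V := HB.pack u ku pu.
by exists u'' => y g B mB; rewrite [LHS]uE// asboolT.
Qed.

Lemma integral_uniform_nucleus (m : {measure set V -> \bar R}) xi (f : V -> \bar R) :
  finite_cell0 xi ->
  (forall B, measurable B -> m B = counting (cell0 xi `&` B) / counting (cell0 xi)) ->
  measurable_fun setT f -> (forall x, 0 <= f x) ->
  \int[m]_i f i = (counting (cell0 xi))^-1 * \int[L]_j ((\1_nucleus0 (xi, j))%:E * f j).
Proof.
move=> g mE mf f0.
have /andP[c1 c2] := g.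
have cf : (counting (cell0 xi))^-1 = (fine (counting (cell0 xi))^-1)%:E :> \bar R.
  exact: inve_fine.
pose h j : R := (fine (counting (cell0 xi))^-1 * \1_nucleus0 (xi, j))%R.
have mn := measurable_indic_nucleus0r xi.
have mh : measurable_fun setT h.
  by apply: measurable_funM; [exact: measurable_cst|exact/measurable_EFinP].
have h0 j : (0 <= h j)%R by rewrite mulr_ge0// fine_ge0// inve_ge0.
rewrite (integral_density mh h0 (nu := L))//.
- rewrite -ge0_integralZl//.
  + by apply: eq_integral => j _; rewrite /h cf// EFinM muleA.
  + exact: emeasurable_funM.
  + by move=> j _; apply: mule_ge0 => //; rewrite lee_fin.
  + by rewrite inve_ge0.
- move=> B mB; rewrite mE// counting_cell0I// muleC -ge0_integralZl//.
  + rewrite [RHS]integral_mkcond; apply: eq_integral => j _.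
    rewrite patchE (indicE R B); case: ifP => _; last by rewrite !mule0.
    by rewrite mule1 cf.
  + by apply: emeasurable_funM => //; apply: measurable_indicE.
  + by rewrite inve_ge0.
Qed.

End uniform_nucleus.

(** * Mass transport on the lattice *)

Section voronoi_transport.
Local Open Scope ereal_scope.
Context {R : realType} {d : nat} {dM : measure_display} {M : measurableType dM}.
Local Notation V := 'rV[R]_d.
Local Notation L := (@lattice_measure R d).
Variables (sh : V -> M -> M) (eta : M -> lf_measure R d).
Hypotheses (sh0 : forall y, sh 0%R y = y)
  (shD : forall s t y, sh (s + t)%R y = sh s (sh t y))
  (msh : measurable_fun setT (fun z : V * M => sh z.1 z.2))
  (meta : measurable_fun setT eta)
  (eta_sh : forall t y, eta (sh t y) = shift_lf t (eta y)).
Variable mu : {measure set M -> \bar R}.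
Hypothesis smu : sigma_finite setT mu.
Hypothesis mu_stationary : forall t (f : M -> \bar R),
  measurable_fun setT f -> (forall y, 0 <= f y) ->
  \int[mu]_y f (sh t y) = \int[mu]_y f y.
Hypothesis mu_good : {ae mu, forall y, 0 < eta y unit_cube -> finite_cell0 (eta y)}.
Variable u : R.-pker M ~> V.
Hypothesis uE : forall y, finite_cell0 (eta y) -> forall B, measurable B ->
  u y B = counting (cell0 (eta y) `&` B) / counting (cell0 (eta y)).

Let measurable_fun_sh := measurable_fun_sh msh.
Let measurable_fun_eta := measurable_fun_eta meta.

Local Ltac meas := measurability
  ltac:(first [apply: measurable_fun_sh | apply: measurable_fun_eta]).

Local Notation c0 y := (counting (cell0 (eta y)) : \bar R).
Local Notation nuc y j := ((\1_nucleus0 (eta y, j))%:E : \bar R).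
Local Notation p y := (voronoi_point (eta y) 0%R).

Let sL : sigma_finite setT L. Proof. exact: lattice_measure_sigma_finite. Qed.

(** Seen from [j], the old origin is at [- j], and the point that was [j] is at 0. This is what
    singles out one term in the sum over [j] before the transport. *)
Lemma nucleus0_shift y j : nucleus0 (eta (sh j y), (- j)%R) <-> j = p y.
Proof.
have l0 : lattice (p y) by apply: lattice_voronoi_point; exact: lattice0.
split=> [[/= lj]|->].
  have {}lj : lattice j by rewrite -[j]opprK; exact: latticeN.
  by rewrite eta_sh voronoi_point_shift// addNr => /eqP; rewrite subr_eq0 => /eqP.
split=> /=; first exact: latticeN.
by rewrite eta_sh voronoi_point_shift// addNr subrr.
Qed.

(** Since S is [- p y], the right side is D°; this links the cell of the origin with the cell of a
    nucleus at 0. *)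
Lemma cell0_shift y :
  cell0 (eta (sh (p y) y)) = [set (- p y + j)%R | j in voronoi_cell (eta y) 0%R].
Proof.
have l0 : lattice (p y) by apply: lattice_voronoi_point; exact: lattice0.
apply/seteqP; split => [i [li]|_ [j [lj vj] <-]].
  rewrite eta_sh voronoi_point_shift// => /eqP; rewrite subr_eq0 => /eqP vi.
  exists (i + p y)%R; last by rewrite addrC addrK.
  by split=> //; exact: latticeD.
split; first by apply: latticeD => //; exact: latticeN.
by rewrite eta_sh voronoi_point_shift// (addrC (- _)%R) subrK vj subrr.
Qed.

(** Stationarity is applied for each [j] separately and removes the shift; the reflection [j -> - j]
    of the lattice removes the sign. *)
Lemma lattice_mass_transport (h : M -> V -> \bar R) :
  measurable_fun setT (fun z : M * V => h z.1 z.2) -> (forall y j, 0 <= h y j) ->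
  \int[mu]_y \int[L]_j h (sh j y) (- j)%R = \int[mu]_y \int[L]_j h y j.
Proof.
move=> mh h0.
transitivity (\int[L]_j \int[mu]_y h (sh j y) (- j)%R).
  apply: (tonelli (f := fun z : M * V => h (sh z.2 z.1) (- z.2)%R)) => //.
  by cbv beta; apply: (measurable_comp2 mh); meas.
transitivity (\int[L]_j \int[mu]_y h y (- j)%R).
  apply: eq_integral => j _; apply: (mu_stationary j (f := fun y => h y (- j)%R)) => //.
  by cbv beta; apply: (measurable_comp2 mh); meas.
transitivity (\int[mu]_y \int[L]_j h y (- j)%R).
  apply/esym; apply: (tonelli (f := fun z : M * V => h z.1 (- z.2)%R)) => //.
  by cbv beta; apply: (measurable_comp2 mh); meas.
apply: eq_integral => y _; apply: integral_lattice_reflect => //.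
by cbv beta; apply: (measurable_comp2 mh); meas.
Qed.

Variable F : M -> V -> V -> \bar R.
Hypotheses (mF : measurable_fun setT (fun z : M * V * V => F z.1.1 z.1.2 z.2))
  (F0 : forall y t i, 0 <= F y t i).

(** The unnormalized integral over T when the nucleus is at 0 and S is [j]. *)
Let a y j := \int[eta y]_t ((\1_unit_cube t)%:E * F (sh t y) t j).

Let mul0 t (x : \bar R) : 0 <= x -> 0 <= (\1_(@unit_cube R d) t)%:E * x.
Proof. by move=> x0; apply: mule_ge0 => //; rewrite lee_fin. Qed.

Let ma : measurable_fun setT (fun z : M * V => a z.1 z.2).
Proof.
apply: (measurable_integral_eta meta (y := fun z : M * V => z.1)
  (g := fun z t => (\1_unit_cube t)%:E * F (sh t z.1) t z.2)).
- by meas.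
- apply: emeasurable_funM.
    by apply: measurable_indicE; [exact: measurable_unit_cube|meas].
  by cbv beta; apply: (measurable_comp3 mF); meas.
- by move=> z t; exact: mul0.
Qed.

Let a0 y j : 0 <= a y j. Proof. by apply: integral_ge0 => t _; exact: mul0. Qed.

Let mnuc := measurable_indic_nucleus0 meta.

Let nuc0 y j : 0 <= nuc y j. Proof. by rewrite lee_fin. Qed.

Let mc0V : measurable_fun setT (fun y => (c0 y)^-1).
Proof. by apply: measurable_inve => //; exact: measurable_counting_cell0. Qed.

(** [h y j] vanishes unless [j] is in the cell of a nucleus at 0. Hence [h (sh j y) (- j)] can be
    nonzero only at [j = p y], whereas after the transport [j] runs over a whole cell and the factor
    [(c0 y)^-1] turns the sum into the mean under [u y]. *)
Lemma voronoi_transport :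
  \int[mu]_y ((c0 (sh (p y) y))^-1 * a (sh (p y) y) (- p y)%R) =
  \int[mu]_y \int[eta y]_t ((\1_unit_cube t)%:E * \int[u y]_i F (sh t y) t i).
Proof.
pose h y j := nuc y j * ((c0 y)^-1 * a y j).
have h0 y j : 0 <= h y j.
  by apply: mule_ge0 => //; apply: mule_ge0 => //; rewrite inve_ge0.
have mh : measurable_fun setT (fun z : M * V => h z.1 z.2).
  apply: emeasurable_funM => //; apply: emeasurable_funM => //.
  by apply: (measurableT_comp mc0V); meas.
transitivity (\int[mu]_y \int[L]_j h (sh j y) (- j)%R).
  apply: eq_integral => y _.
  rewrite -(@integral_lattice_point _ _ (p y)
    (fun j => (c0 (sh j y))^-1 * a (sh j y) (- j)%R)).
  - apply: eq_integral => j _; rewrite /h; congr (_%:E * _).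
    rewrite !indicE; congr (_%:R); congr nat_of_bool.
    by apply/idP/idP; rewrite !inE => /nucleus0_shift.
  - by apply: lattice_voronoi_point; exact: lattice0.
  - apply: emeasurable_funM; last by cbv beta; apply: (measurable_comp2 ma); meas.
    by apply: (measurableT_comp mc0V); meas.
  - by move=> j; apply: mule_ge0 => //; rewrite inve_ge0.
rewrite lattice_mass_transport//.
pose b y t := \int[u y]_i F (sh t y) t i.
have mFu : measurable_fun setT (fun z : M * V => b z.1 z.2).
  apply: (@measurable_kernel_integral _ _ _ _ _ (fun z : M * V => u z.1) (fun=> setT)
    _ _ _ _ _ (fun z : M * V * V => F (sh z.1.2 z.1.1) z.1.2 z.2)) => //.
  - move=> A mA; apply: (measurableT_comp (f := fun y => u y A)); last by meas.
    exact: measurable_kernel.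
  - by rewrite bigcup_const.
  - by move=> z _; rewrite prob_kernel ltry.
  - by cbv beta; apply: (measurable_comp3 mF); meas.
have [N [mN N0 NS]] := mu_good.
apply: ge0_ae_eq_integral => //.
- exact: (measurable_fun_integral2 (f := fun z : M * V => h z.1 z.2)).
- apply: (measurable_integral_eta meta (y := fun y => y)
    (g := fun y t => (\1_unit_cube t)%:E * \int[u y]_i F (sh t y) t i)) => //.
  + apply: emeasurable_funM => //.
    by apply: measurable_indicE; [exact: measurable_unit_cube|meas].
  + by move=> y t; apply: mul0; exact: integral_ge0.
- by move=> y _; apply: integral_ge0.
- by move=> y _; apply: integral_ge0 => t _; apply: mul0; exact: integral_ge0.
exists N; split=> //; apply: subset_trans NS => y /= yN gy; apply: yN => _.
(* Without mass in the cube both sides vanish, even if the cell is empty and [(c0 y)^-1] is [+oo].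
   With mass, the cell is finite and [uE] applies. *)
have [e0|e0] := eqVneq (eta y unit_cube) 0.
  have z0 (f : V -> \bar R) : measurable_fun setT f -> (forall t, 0 <= f t) ->
      \int[eta y]_t ((\1_unit_cube t)%:E * f t) = 0.
    move=> mf f0; rewrite -[RHS](null_set_integral (f := f) measurable_unit_cube _ e0).
      rewrite [RHS]integral_mkcond; apply: eq_integral => t _.
      by rewrite patchE indicE; case: ifP => _; rewrite ?mul1e ?mul0e.
    exact: measurable_funTS.
  rewrite z0; last 2 first.
  - exact: (measurable_comp2 (G := b) mFu (measurable_cst y) (@measurable_id _ _ setT)).
  - by move=> t; exact: integral_ge0.
  apply: integral0_eq => j _; rewrite /h /a z0 ?mule0//.
  by cbv beta; apply: (measurable_comp3 mF); meas.
have {}gy : finite_cell0 (eta y) by apply: gy; rewrite lt0e e0 measure_ge0.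
transitivity ((c0 y)^-1 * \int[L]_j (nuc y j * a y j)).
  rewrite -ge0_integralZl//.
  - by apply: eq_integral => j _; rewrite /h muleCA.
  - apply: emeasurable_funM; first exact: measurable_indic_nucleus0r.
    by cbv beta; apply: (measurable_comp2 ma); meas.
  - by move=> j _; apply: mule_ge0.
  - by rewrite inve_ge0.
transitivity (\int[eta y]_t ((c0 y)^-1 * \int[L]_j (nuc y j *
    ((\1_unit_cube t)%:E * F (sh t y) t j)))); last first.
  apply: eq_integral => t _.
  rewrite (integral_uniform_nucleus gy (uE gy)) => //; last first.
    by cbv beta; apply: (measurable_comp3 mF); meas.
  rewrite muleCA; congr (_ * _); rewrite -ge0_integralZl//.
  - by apply: eq_integral => j _; rewrite muleCA.
  - apply: emeasurable_funM; first exact: measurable_indic_nucleus0r.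
    by cbv beta; apply: (measurable_comp3 mF); meas.
  - by move=> j _; apply: mule_ge0; [exact: nuc0|exact: F0].
have mnF : measurable_fun setT (fun z : V * V => nuc y z.2 *
    ((\1_unit_cube z.1)%:E * F (sh z.1 y) z.1 z.2)).
  apply: emeasurable_funM.
    apply: (measurable_indicE measurable_nucleus0 (g := fun z : V * V => (eta y, z.2))).
    by meas.
  apply: emeasurable_funM.
    by apply: measurable_indicE; [exact: measurable_unit_cube|meas].
  by cbv beta; apply: (measurable_comp3 mF); meas.
have nF0 t j : 0 <= nuc y j * ((\1_unit_cube t)%:E * F (sh t y) t j).
  by apply: mule_ge0 => //; exact: mul0.
rewrite ge0_integralZl//; last 3 first.
- exact: (measurable_fun_integral2 (f := fun z : V * V => nuc y z.2 *
    ((\1_unit_cube z.1)%:E * F (sh z.1 y) z.1 z.2))).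
- by move=> t _; exact: integral_ge0.
- by rewrite inve_ge0.
congr (_ * _).
transitivity (\int[L]_j \int[eta y]_t (nuc y j *
    ((\1_unit_cube t)%:E * F (sh t y) t j))).
  apply: eq_integral => j _; rewrite ge0_integralZl//.
  - apply: emeasurable_funM.
      by apply: measurable_indicE; [exact: measurable_unit_cube|meas].
    by cbv beta; apply: (measurable_comp3 mF); meas.
  - by move=> t _; exact: mul0.
apply/esym; apply: (tonelli (m1 := eta y) (m2 := L) (f := fun z => nuc y z.2 *
    ((\1_unit_cube z.1)%:E * F (sh z.1 y) z.1 z.2))) => //.
- exact: lf_measure_sigma_finite.
Qed.

End voronoi_transport.

(** * Integrals under normalized restrictions of a measure *)

Section conditioning.
Local Open Scope ereal_scope.
Context {R : realType}.

(** This turns a formula for a conditional law into a density. Positivity and finiteness of the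
    normalizer come out as a conclusion, because the formula is matched by a measure of mass 1. *)
Lemma integral_mcond d (T : measurableType d) (m k : {measure set T -> \bar R})
    (A : set T) (f : T -> \bar R) :
  measurable A -> k setT = 1 ->
  (forall B, measurable B -> mcond m A B = k B) ->
  measurable_fun setT f -> (forall x, 0 <= f x) ->
  0 < m A < +oo /\ \int[k]_x f x = (m A)^-1 * \int[m]_x ((\1_A x)%:E * f x).
Proof.
move=> mA k1 kE mf f0.
(* If m A were 0 or +oo, its junk quotients would make k null. *)
have mA_itv : 0 < m A < +oo.
  have := kE _ measurableT; rewrite k1 /mcond setTI.
  have [->|m0] := eqVneq (m A) 0; first by rewrite mul0e => /esym/eqP; rewrite onee_eq0.
  have [->|moo] := eqVneq (m A) +oo.
    by rewrite invey mule0 => /esym/eqP; rewrite onee_eq0.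
  by move=> _; rewrite lt0e m0 measure_ge0/= ltey.
split=> //; have cf := inve_fine mA_itv.
pose h x : R := (fine (m A)^-1 * \1_A x)%R.
have m1 : measurable_fun setT (fun x => (\1_A x)%:E : \bar R).
  by apply/measurable_EFinP; exact: measurable_indic.
have mh : measurable_fun setT h.
  by apply: measurable_funM; [exact: measurable_cst|exact: measurable_indic].
have h0 x : (0 <= h x)%R by rewrite mulr_ge0// fine_ge0// inve_ge0.
rewrite (integral_density mh h0 (nu := m))//.
- rewrite -ge0_integralZl//.
  + by apply: eq_integral => x _; rewrite /h cf EFinM muleA.
  + exact: emeasurable_funM.
  + by move=> x _; apply: mule_ge0 => //; rewrite lee_fin.
  + by rewrite inve_ge0.
- move=> B mB; rewrite -kE// /mcond muleC.
  transitivity ((m A)^-1 * \int[m]_(x in B) (\1_A x)%:E).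
    by congr (_ * _); rewrite integral_indic// setIC.
  rewrite -ge0_integralZl//.
  + by apply: eq_integral => x _; rewrite /h cf EFinM.
  + exact: measurable_funTS.
  + by rewrite inve_ge0.
Qed.

Lemma probability_kernel_of d d' (T : measurableType d) (T' : measurableType d')
    (v : T -> {measure set T' -> \bar R}) :
  (forall B, measurable B -> measurable_fun setT (fun x => v x B)) ->
  (forall x, v x setT = 1) ->
  exists k : R.-pker T ~> T', forall x B, k x B = v x B.
Proof.
move=> mv v1.
pose kv := isKernel.Build _ _ _ _ _ v mv.
pose v' : R.-ker T ~> T' := HB.pack v kv.
pose pv := Kernel_isProbability.Build _ _ _ _ _ v' v1.
pose v'' : R.-pker T ~> T' := HB.pack v kv pv.
by exists v''.
Qed.

End conditioning.

(** * From the integral identity to equality of distributions *)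

Section mass_stationary_of_palm.
Local Open Scope ereal_scope.
Context {R : realType} {d : nat} {dM : measure_display} {M : measurableType dM}.
Local Notation V := 'rV[R]_d.
Local Notation leb := (@lebesgue_rV R d).
Variables (sh : V -> M -> M) (eta : M -> lf_measure R d).
Hypotheses (msh : measurable_fun setT (fun z : V * M => sh z.1 z.2))
  (meta : measurable_fun setT eta).
Context {dO : measure_display} {O : measurableType dO}.
Variables (P : {measure set O -> \bar R}) (Y : O -> M).
Hypotheses (mY : measurable_fun setT Y) (sY : sigma_finite setT (pushforward P Y)).
Variable C : set V.
Hypothesis mC : measurable C.
(** The identity of [palm_mass_stationary], pulled back from the law of [Y] to [P]. *)
Hypothesis palm : forall F : M -> V -> \bar R,
  measurable_fun setT (fun z : M * V => F z.1 z.2) -> (forall y u, 0 <= F y u) ->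
  \int[P]_w \int[leb]_u ((\1_C u)%:E * \int[eta (Y w)]_v ((\1_C (v + u)%R)%:E *
    ((eta (Y w) [set x | C (x + u)%R])^-1 * F (sh v (Y w)) (v + u)%R))) =
  \int[P]_w \int[leb]_u ((\1_C u)%:E * F (Y w) u).

Let measurable_fun_sh := measurable_fun_sh msh.
Let measurable_fun_eta := measurable_fun_eta meta.

Local Ltac meas := measurability
  ltac:(first [apply: measurable_fun_sh | apply: measurable_fun_eta]).

Context {dO' : measure_display} {O' : measurableType dO'}.
Variables (P' : {measure set O' -> \bar R}) (pr : O' -> O) (U W : O' -> V).
Hypotheses (mpr : measurable_fun setT pr)
  (prE : forall A, measurable A -> pushforward P' pr A = P A)
  (condU : cond_distribution P' (Y \o pr) U (fun=> mcond leb C))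
  (condW : cond_distribution P' (fun w => (Y (pr w), U w)) W
     (fun w => mcond (eta (Y (pr w))) [set (y - U w)%R | y in C])).

Let mYpr : measurable_fun setT (Y \o pr). Proof. exact: measurableT_comp. Qed.

Let mU : measurable_fun setT U. Proof. by case: condU. Qed.

Let mW : measurable_fun setT W. Proof. by case: condW. Qed.

Let sYpr : exists F : nat -> set M, setT = \bigcup_n F n /\
  forall n, measurable (F n) /\ P' ((Y \o pr) @^-1` F n) < +oo.
Proof.
have [F FT Foo] := sY; exists F; split=> // n; have [mF Fn] := Foo n; split=> //.
rewrite comp_preimage -[X in X < _]/(pushforward P' pr (Y @^-1` F n)) prE//.
by rewrite -[X in measurable X]setTI; exact: mY.
Qed.

Let sYpr1 : sigma_finite setT (pushforward P' (Y \o pr)).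
Proof. by have [F [FT Foo]] := sYpr; exists F. Qed.

Let sYpr2 : sigma_finite setT (pushforward P' (fun w => (Y (pr w), U w))).
Proof.
have [F [FT Foo]] := sYpr; exists (fun n => F n `*` setT).
  by rewrite -setX_bigcupl -FT setXTT.
move=> n; have [mF Fn] := Foo n; split; first exact: measurableX.
rewrite /pushforward (_ : _ @^-1` _ = (Y \o pr) @^-1` F n)//.
by apply/seteqP; split=> [w []//|w Fw]; split.
Qed.

Let translateE u : [set (y - u)%R | y in C] = [set x | C (x + u)%R].
Proof.
apply/seteqP; split=> [_ [y Cy <-]|x Cx] /=; first by rewrite subrK.
by exists (x + u)%R; rewrite ?addrK.
Qed.

Let mtranslate u : measurable [set x | C (x + u)%R].
Proof.
have m : measurable_fun setT (fun x : V => (x + u)%R) by meas.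
by rewrite -[X in measurable X]setTI; exact: m.
Qed.

(** Once U is integrated out, the integrand depends on the extended space only through [pr], so the
    integral descends to [P]. *)
Let condU_integral (g : M -> V -> \bar R) :
  measurable_fun setT (fun z : M * V => g z.1 z.2) -> (forall y u, 0 <= g y u) ->
  \int[P']_w g (Y (pr w)) (U w) =
  \int[P]_w ((leb C)^-1 * \int[leb]_u ((\1_C u)%:E * g (Y w) u)).
Proof.
move=> mg g0; have [_ _ [k [kE kD]]] := condU.
rewrite (integral_disintegration mYpr mU sYpr1 kD (f := fun z => g z.1 z.2))//=.
pose b y := (leb C)^-1 * \int[leb]_u ((\1_C u)%:E * g y u).
have b0 y : 0 <= b y.
  apply: mule_ge0; first by rewrite inve_ge0.
  by apply: integral_ge0 => u _; apply: mule_ge0 => //; rewrite lee_fin.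
have mb : measurable_fun setT b.
  apply: emeasurable_funM; first exact: measurable_cst.
  apply: (measurable_fun_integral2 (f := fun z : M * V => (\1_C z.2)%:E * g z.1 z.2)).
  - exact: (sigma_finiteT leb).
  - by apply: emeasurable_funM => //; apply: measurable_indicE => //; meas.
  - by move=> z; apply: mule_ge0 => //; rewrite lee_fin.
transitivity (\int[P']_w b (Y (pr w))).
  have mgk : measurable_fun setT (fun y => \int[k y]_u g y u).
    exact: (measurable_fun_integral_finite_kernel (fun z => g z.1 z.2) k).
  apply: ge0_ae_eq_integral => //.
  - exact: (measurableT_comp mgk mYpr).
  - exact: (measurableT_comp mb mYpr).
  - by move=> w _; exact: integral_ge0.
  have [N [mN N0 NS]] := kE.
  exists N; split=> //; apply: subset_trans NS => w /= wN h; apply: wN => _.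
  have [_ ->] := integral_mcond (f := g (Y (pr w))) mC (prob_kernel (Y (pr w))) h
    (measurable_comp2 mg (measurable_cst (Y (pr w))) (@measurable_id _ _ setT)) (g0 _).
  by [].
have [m [mE mint]] := law_measure P' mpr.
rewrite -(mint (fun w => b (Y w)))//.
  by apply: eq_measure_integral => A mA _; rewrite mE -prE.
exact: measurableT_comp.
Qed.

(** Tested on the indicator of [A], the left side is disintegrated first over [W], whose kernel
    depends on [U], and then over [U]. Each side becomes [(leb C)^-1] times one side of [palm]. *)
Lemma mass_stationary_palm (A : set (M * V)) : measurable A ->
  pushforward P' (fun w => (sh (W w) (Y (pr w)), (W w + U w)%R)) A =
  pushforward P' (fun w => (Y (pr w), U w)) A.
Proof.
move=> mA; have [mYU _ [k [kE kD]]] := condW.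
have mYpr' : measurable_fun setT (fun w => Y (pr w)) by exact: mYpr.
have law (Z : O' -> M * V) : measurable_fun setT Z ->
    pushforward P' Z A = \int[P']_w (\1_A (Z w))%:E.
  move=> mZ; rewrite (_ : (fun w => _) = EFin \o \1_(Z @^-1` A)).
    by rewrite integral_indic ?setIT// -[X in measurable X]setTI; exact: mZ.
  by apply/funext.
rewrite !law//; last by meas.
pose F y u : \bar R := (\1_A (y, u))%:E.
have mF : measurable_fun setT (fun z : M * V => F z.1 z.2).
  by apply: (measurable_indicE mA (g := fun z : M * V => (z.1, z.2))); meas.
have F0 y u : 0 <= F y u by rewrite lee_fin.
pose w y u := (eta y [set x | C (x + u)%R])^-1.
have w0 y u : 0 <= w y u by rewrite inve_ge0.
pose psi y u := \int[eta y]_v ((\1_C (v + u)%R)%:E * (w y u * F (sh v y) (v + u)%R)).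
have psi0' y u v : 0 <= (\1_C (v + u)%R)%:E * (w y u * F (sh v y) (v + u)%R).
  by apply: mule_ge0; [rewrite lee_fin|exact: mule_ge0].
have psi0 y u : 0 <= psi y u by exact: integral_ge0.
have mpsi : measurable_fun setT (fun z : M * V => psi z.1 z.2).
  exact: (measurable_mass_kernel msh meta mC mF F0).
pose f z : \bar R := F (sh z.2 z.1.1) (z.2 + z.1.2)%R.
have mf : measurable_fun setT (f : (M * V) * V -> \bar R).
  by apply: (measurable_comp2 mF); meas.
transitivity (\int[P']_w psi (Y (pr w)) (U w)).
  rewrite (integral_disintegration mYU mW sYpr2 kD mf (fun=> F0 _ _)).
  have mfk : measurable_fun setT (fun z : M * V => \int[k z]_v f (z, v)).
    exact: (measurable_fun_integral_finite_kernel f k (fun=> F0 _ _) mf).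
  apply: ge0_ae_eq_integral => //.
  - exact: (measurableT_comp mfk mYU).
  - exact: (measurableT_comp mpsi mYU).
  - by move=> o _; apply: integral_ge0 => v _; exact: F0.
  have [N [mN N0 NS]] := kE.
  exists N; split=> //; apply: subset_trans NS => o /= oN h; apply: oN => _.
  rewrite translateE in h.
  have mfo : measurable_fun setT (fun v => f (Y (pr o), U o, v)).
    by rewrite /f /=; cbv beta; apply: (measurable_comp2 mF); meas.
  have [_ ->] := integral_mcond (mtranslate (U o)) (prob_kernel (Y (pr o), U o)) h mfo
    (fun=> F0 _ _).
  rewrite -ge0_integralZl//.
  - apply: eq_integral => v _; rewrite muleCA; congr (_ * _).
  - apply: emeasurable_funM => //.
    by apply: measurable_indicE => //; meas.
  - by move=> v _; apply: mule_ge0; rewrite lee_fin.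
  - by rewrite inve_ge0.
rewrite (condU_integral mpsi psi0) (condU_integral mF F0).
have m1C (g : M -> V -> \bar R) : measurable_fun setT (fun z : M * V => g z.1 z.2) ->
    (forall y u, 0 <= g y u) ->
    \int[P]_w ((leb C)^-1 * \int[leb]_u ((\1_C u)%:E * g (Y w) u)) =
    (leb C)^-1 * \int[P]_w \int[leb]_u ((\1_C u)%:E * g (Y w) u).
  move=> mg g0; rewrite ge0_integralZl//.
  - apply: (measurableT_comp (f := fun y => \int[leb]_u ((\1_C u)%:E * g y u)) _ mY).
    apply: (measurable_fun_integral2 (f := fun z : M * V => (\1_C z.2)%:E * g z.1 z.2)).
    + exact: (sigma_finiteT leb).
    + by apply: emeasurable_funM => //; apply: measurable_indicE => //; meas.
    + by move=> z; apply: mule_ge0 => //; rewrite lee_fin.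
  - by move=> o _; apply: integral_ge0 => u _; apply: mule_ge0 => //; rewrite lee_fin.
  - by rewrite inve_ge0.
apply: (etrans (m1C psi mpsi psi0)); apply: (etrans _ (esym (m1C F mF F0))).
by congr (_ * _); exact: palm.
Qed.

End mass_stationary_of_palm.

(** * The pair shifted to a typical point of its mass *)

Section voronoi_palm.
Local Open Scope ereal_scope.
Context {R : realType} {d : nat} {dO dE : measure_display}
  {O : measurableType dO} {E : measurableType dE}.
Local Notation V := 'rV[R]_d.
Local Notation M := (E * lf_measure R d)%type.
Local Notation leb := (@lebesgue_rV R d).
Variables (theta : V -> E -> E) (P P' : {measure set O -> \bar R})
  (X : {mfun O >-> E}) (xi : {mfun O >-> lf_measure R d}) (T : {mfun O >-> V}).
Hypothesis act : measurable_action theta.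

Let Y w : M := (X w, xi w).
Let eta (y : M) : lf_measure R d := y.2.
Let sh : V -> M -> M := shift_pair theta.
Let p (y : M) : V := voronoi_point (eta y) 0%R.
Let D w := voronoi_cell (xi w) 0%R.
Let S w := voronoi_vector (xi w) 0%R.
Let Y' w := sh (T w) (sh (- S w)%R (Y w)).

Let sh0 y : sh 0%R y = y. Proof. exact: shift_pair0. Qed.

Let shD s t y : sh (s + t)%R y = sh s (sh t y). Proof. exact: shift_pairD. Qed.

Let msh : measurable_fun setT (fun z : V * M => sh z.1 z.2).
Proof. exact: measurable_shift_pair. Qed.

Let meta : measurable_fun setT eta. Proof. exact: measurable_snd. Qed.

Let eta_sh t y : eta (sh t y) = shift_lf t (eta y). Proof. by []. Qed.

Let measurable_fun_sh := measurable_fun_sh msh.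
Let measurable_fun_eta := measurable_fun_eta meta.

Local Ltac meas := measurability
  ltac:(first [apply: measurable_fun_sh | apply: measurable_fun_eta]).

Let mY : measurable_fun setT Y. Proof. exact: measurable_fun_pair. Qed.

Let mp : measurable_fun setT p.
Proof.
by apply: (measurableT_comp (measurable_voronoi_point (@lattice0 R d)) meta).
Qed.

Let SE w : S w = (- p (Y w))%R.
Proof. by rewrite /S /voronoi_vector sub0r. Qed.

Let Y'E w : Y' w = sh (T w) (sh (p (Y w)) (Y w)).
Proof. by rewrite /Y' SE opprK. Qed.

Let mS : measurable_fun setT S.
Proof.
rewrite (_ : S = fun w => (- p (Y w))%R); last by apply/funext => w; rewrite SE.
apply: measurable_funN_rV.
exact: (measurableT_comp mp mY).
Qed.

Let mspy : measurable_fun setT (fun y => sh (p y) y).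
Proof. by apply: (measurable_comp2 msh). Qed.

Lemma measurable_Y' : measurable_fun setT Y'.
Proof.
rewrite (_ : Y' = fun w => sh (T w) (sh (p (Y w)) (Y w))); last first.
  by apply/funext => w; rewrite Y'E.
apply: (measurable_comp2 msh) => //.
exact: (measurableT_comp mspy mY).
Qed.

Let mY' := measurable_Y'.

Let c0 y : \bar R := counting (cell0 (eta y)).

Let mc0 : measurable_fun setT c0. Proof. exact: measurable_counting_cell0. Qed.

Let dens y : \bar R := eta (sh (p y) y) unit_cube / c0 (sh (p y) y).

Let cell0E w : cell0 (eta (sh (p (Y w)) (Y w))) = [set (S w + j)%R | j in D w].
Proof. by rewrite (cell0_shift eta_sh) SE. Qed.

Let countingDE w : counting (D w) = c0 (sh (p (Y w)) (Y w)).
Proof.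
rewrite /c0 cell0E (@counting_image _ _ (fun x => S w + x)%R (fun x => - S w + x)%R)//.
by move=> x; rewrite addKr.
Qed.

Let c0_gt0 w : 0 < c0 (sh (p (Y w)) (Y w)).
Proof.
rewrite -countingDE; apply: (@counting_gt0 _ _ _ 0%R).
by split=> //; exact: lattice0.
Qed.

Let densE w : shift_lf (- S w) (xi w) unit_cube / counting (D w) = dens (Y w).
Proof. by rewrite SE opprK countingDE. Qed.

Let mdens : measurable_fun setT dens.
Proof.
apply: emeasurable_funM.
  apply: (measurableT_comp (measurable_lf_eval (@measurable_unit_cube R d))).
  exact: (measurableT_comp meta mspy).
by apply: measurable_inve; [exact: (measurableT_comp mc0 mspy)|].
Qed.

Let dens0 y : 0 <= dens y.
Proof. by apply: mule_ge0 => //; rewrite inve_ge0. Qed.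

(** The cube has finite mass and the cell contains the origin; an infinite cell has inverse count 0.
    So the density is finite everywhere and can serve as a real-valued weight. *)
Let dens_fin w : dens (Y w) = (fine (dens (Y w)))%:E.
Proof.
rewrite fineK// /dens ge0_fin_numE; last exact: dens0.
apply: lte_mul_pinfty => //.
  rewrite ge0_fin_numE//; apply: lf_locally_finite; first exact: measurable_unit_cube.
  exact: bounded_unit_cube.
move: (c0_gt0 w); case: (c0 _) => [r|_|//]; last exact: (ltry 0%R).
by rewrite lte_fin => r0; rewrite inver gt_eqF// ltry.
Qed.

Hypothesis stat : stationary theta P Y.
Hypothesis hull : {ae P, forall w, conv_hull (msupport (xi w)) = setT}.
Hypothesis condT : cond_distribution P Y T
  (fun w => mcond (shift_lf (- S w) (xi w)) unit_cube).
Hypothesis P'E : forall A : set O, measurable A ->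
  P' A = \int[P]_(w in A) (shift_lf (- S w) (xi w) unit_cube / counting (D w)).

Let P'_null N : measurable N -> P N = 0 -> P' N = 0.
Proof.
move=> mN N0; rewrite P'E//; under eq_integral do rewrite densE.
by apply: null_set_integral => //; apply: measurable_funTS; exact: (measurableT_comp mdens mY).
Qed.

Let good_P : {ae P, forall w, finite_cell0 (eta (sh (p (Y w)) (Y w)))}.
Proof.
have [N [mN N0 NS]] := hull.
exists N; split=> //; apply: subset_trans NS => w /= wN hw; apply: wN.
apply/andP; split; first exact: c0_gt0.
rewrite -[X in X < _]/(c0 (sh (p (Y w)) (Y w))) -countingDE.
by apply/counting_lty; exact: finite_voronoi_cell.
Qed.

Let mgood : measurable [set y : M | finite_cell0 (eta y)].
Proof.
have -> : [set y : M | finite_cell0 (eta y)] = [set y | 0 < c0 y] `&` [set y | c0 y < +oo].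
  by apply/seteqP; split => y /andP.
apply: measurableI; rewrite -[X in measurable X]setTI.
  exact: emeasurable_fun_o_infty.
exact: emeasurable_fun_infty_o.
Qed.

Section law.
Variable mu : {measure set M -> \bar R}.
Hypothesis muE : forall A, mu A = P (Y @^-1` A).
Hypothesis mu_int : forall f, measurable_fun setT f -> (forall y, 0 <= f y) ->
  \int[mu]_y f y = \int[P]_w f (Y w).

Let smu : sigma_finite setT mu.
Proof.
case: stat => _ [F FT Foo] _; exists F => // n; have [mF Fn] := Foo n.
by split=> //; rewrite muE.
Qed.

Let mu_stationary t (f : M -> \bar R) : measurable_fun setT f -> (forall y, 0 <= f y) ->
  \int[mu]_y f (sh t y) = \int[mu]_y f y.
Proof.
move=> mf f0.
have msht : measurable_fun setT (fun y => sh t y).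
  exact: (measurable_comp2 msh (measurable_cst t) (@measurable_id _ _ setT)).
have [m [mE mint]] := law_measure mu msht.
rewrite -mint//; apply: eq_measure_integral => A mA _.
by case: stat => _ _ /(_ t A mA); rewrite mE !muE.
Qed.

(** If the cube at 0 is charged, then 0 is its own nucleus and [cell0] is the cell of the origin,
    which the hull hypothesis makes finite. *)
Let mu_good : {ae mu, forall y, 0 < eta y unit_cube -> finite_cell0 (eta y)}.
Proof.
pose B := [set y : M | 0 < eta y unit_cube] `&` ~` [set y : M | finite_cell0 (eta y)].
have mB : measurable B.
  apply: measurableI; last exact: measurableC.
  rewrite -[X in measurable X]setTI; apply: emeasurable_fun_o_infty => //.
  exact: (measurableT_comp (measurable_lf_eval (@measurable_unit_cube R d)) meta).
exists B; split=> //; last first.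
  by move=> y /= /not_implyP[].
rewrite muE; have [N [mN N0 NS]] := hull.
apply/eqP; rewrite -measure_le0 -N0; apply: le_measure; rewrite ?inE//.
  by rewrite -[X in measurable X]setTI; exact: mY.
apply: subset_trans NS => w [/= cube_gt0 ngood] hw; apply: ngood.
have occ0 : occupied (xi w) 0%R.
  split; first exact: lattice0.
  rewrite (_ : [set _ | _ in _] = unit_cube)//.
  by apply/seteqP; split=> [_ [x xC <-]|x xC]; rewrite ?add0r//; exists x => //; rewrite add0r.
have vp0 := voronoi_point_occupied occ0.
have cE : cell0 (eta (Y w)) = D w.
  by apply/seteqP; split => [i [li vi]|i [li vi]]; split=> //; [rewrite vi|rewrite vi].
rewrite /finite_cell0 cE; apply/andP; split.
  by apply: (@counting_gt0 _ _ _ 0%R); split=> //; exact: lattice0.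
by apply/counting_lty; exact: finite_voronoi_cell.
Qed.

Variable u : R.-pker M ~> V.
Hypothesis uE : forall y, finite_cell0 (eta y) -> forall B, measurable B ->
  u y B = counting (cell0 (eta y) `&` B) / counting (cell0 (eta y)).

(** All conclusions are read off from this formula by a choice of [F]. Disintegrating T over its
    conditional law turns the left side into the left side of [voronoi_transport]. *)
Lemma joint_law (F : M -> V -> V -> \bar R) :
  measurable_fun setT (fun z : M * V * V => F z.1.1 z.1.2 z.2) ->
  (forall y t i, 0 <= F y t i) ->
  \int[P']_w F (Y' w) (T w) (S w) =
  \int[mu]_y \int[eta y]_t ((\1_unit_cube t)%:E * \int[u y]_i F (sh t y) t i).
Proof.
move=> mF F0; have mC := @measurable_unit_cube R d.
rewrite -(voronoi_transport msh meta eta_sh smu mu_stationary mu_good uE mF F0).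
have mh : measurable_fun setT (fun w => fine (dens (Y w))).
  apply: (measurableT_comp (fine_measurable measurableT)) => //.
  exact: (measurableT_comp mdens mY).
have h0 w : (0 <= fine (dens (Y w)))%R by rewrite fine_ge0// dens0.
have mFY : measurable_fun setT (fun w => F (Y' w) (T w) (S w)).
  exact: (measurable_comp3 mF).
rewrite (integral_density mh h0 (nu := P))//; last first.
  by move=> A mA; rewrite P'E//; apply: eq_integral => w _; rewrite densE -dens_fin.
pose G (z : M * V) := dens z.1 * F (sh z.2 (sh (p z.1) z.1)) z.2 (- p z.1)%R.
have mG : measurable_fun setT G.
  apply: emeasurable_funM; first exact: (measurableT_comp mdens measurable_fst).
  apply: (measurable_comp3 mF) => //.
    by apply: (measurable_comp2 msh) => //; exact: (measurableT_comp mspy measurable_fst).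
  by apply: measurable_funN_rV; exact: (measurableT_comp mp measurable_fst).
have G0 z : 0 <= G z by apply: mule_ge0; [exact: dens0|exact: F0].
transitivity (\int[P]_w G (Y w, T w)).
  by apply: eq_integral => w _; rewrite -dens_fin /G /= Y'E SE.
have [_ mT [k [kE kD]]] := condT.
have sY : sigma_finite setT (pushforward P Y) by case: stat.
rewrite (integral_disintegration mY mT sY kD mG G0).
set b := fun y => (counting (cell0 (eta (sh (p y) y))))^-1 * _.
have b0 y : 0 <= b y.
  apply: mule_ge0; first by rewrite inve_ge0.
  by apply: integral_ge0 => t _; apply: mule_ge0 => //; rewrite lee_fin.
have mb : measurable_fun setT b.
  apply: emeasurable_funM.
    by apply: measurable_inve; [exact: (measurableT_comp mc0 mspy)|].
  apply: (measurable_integral_eta meta (y := fun y => sh (p y) y)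
    (g := fun y t => (\1_unit_cube t)%:E * F (sh t (sh (p y) y)) t (- p y)%R)) => //.
  - apply: emeasurable_funM; first by apply: measurable_indicE => //; exact: measurable_snd.
    apply: (measurable_comp3 mF) => //.
      by apply: (measurable_comp2 msh) => //; exact: (measurableT_comp mspy measurable_fst).
    by apply: measurable_funN_rV; exact: (measurableT_comp mp measurable_fst).
  - by move=> y t; apply: mule_ge0 => //; rewrite lee_fin.
rewrite mu_int//.
apply: ge0_ae_eq_integral => //.
- apply: (measurableT_comp (f := fun y => \int[k y]_t G (y, t)) _ mY).
  exact: (measurable_fun_integral_finite_kernel G k G0 mG).
- exact: (measurableT_comp mb mY).
- by move=> w _; exact: integral_ge0.
- by move=> w _; exact: b0.
have [N [mN N0 NS]] := kE.
exists N; split=> //; apply: subset_trans NS => w /= wN h; apply: wN => _.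
rewrite SE opprK in h.
have mFw : measurable_fun setT (fun t => F (sh t (sh (p (Y w)) (Y w))) t (- p (Y w))%R).
  by apply: (measurable_comp3 mF) => //; exact: (measurable_comp2 msh).
have mGw : measurable_fun setT (fun t => G (Y w, t)).
  by apply: emeasurable_funM; [exact: (measurable_cst (dens (Y w)))|exact: mFw].
(* Besides the density of T, this yields that the cube mass at the nucleus is positive and finite,
   which the cancellation at the end requires. *)
have [cube_itv ->] := integral_mcond mC (prob_kernel (Y w)) h mGw (fun=> G0 _).
rewrite /b /G /=.
have F1 t : 0 <= (\1_(@unit_cube R d) t)%:E * F (sh t (sh (p (Y w)) (Y w))) t (- p (Y w))%R.
  by apply: mule_ge0 => //; rewrite lee_fin.
transitivity ((shift_lf (p (Y w)) (xi w) unit_cube)^-1 * (dens (Y w) *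
    \int[eta (sh (p (Y w)) (Y w))]_t ((\1_unit_cube t)%:E *
      F (sh t (sh (p (Y w)) (Y w))) t (- p (Y w))%R))).
  congr (_ * _); rewrite -ge0_integralZl//.
  - by apply: eq_integral => t _; rewrite muleCA.
  - by apply: emeasurable_funM => //; exact: measurable_indicE.
rewrite muleA; congr (_ * _); rewrite /dens muleA.
rewrite [X in X * _](_ : _ = 1) ?mul1e//.
move: cube_itv => /andP[c1 c2]; rewrite muleC divee ?gt_eqF// ge0_fin_numE//.
Qed.

(** [F] ignores T and S, and [u y] has mass 1, so the cell drops out and the defining formula of the
    Palm measure of [mu] remains. *)
Lemma palm_law (Q : {measure set M -> \bar R}) :
  (forall f, measurable_fun setT f -> (forall y, 0 <= f y) ->
    \int[Q]_y f y = \int[P']_w f (Y' w)) ->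
  forall f, measurable_fun setT f -> (forall y, 0 <= f y) ->
    \int[Q]_y f y = \int[mu]_y \int[eta y]_t ((\1_unit_cube t)%:E * f (sh t y)).
Proof.
move=> Qint f mf f0; apply: (etrans (Qint f mf f0)).
apply: (etrans (joint_law (F := fun y _ _ => f y) _ _)) => //.
- by apply: (measurableT_comp mf); meas.
- apply: eq_integral => y _; apply: eq_integral => t _; congr (_ * _).
  by rewrite integral_cst// prob_kernel mule1.
Qed.

(** D° is a function of the conditioning variables: [back] undoes the shift by T and recovers the
    pair recentred at the nucleus, whose [cell0] is D°. In [joint_law] the same shift returns
    [sh t y] to [y], so the kernel at [back] is [u y]. *)
Lemma cond_distribution_S :
  cond_distribution P' (fun w => (Y' w, T w)) S
    (fun w => mcond counting [set (S w + j)%R | j in D w]).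
Proof.
have mY'T : measurable_fun setT (fun w => (Y' w, T w)) by exact: measurable_fun_pair.
pose back (z : M * V) := sh (- z.2)%R z.1.
have mback : measurable_fun setT back.
  apply: (measurable_comp2 msh); last exact: measurable_fst.
  by apply: measurable_funN_rV; exact: measurable_snd.
have backE w : back (Y' w, T w) = sh (p (Y w)) (Y w).
  by rewrite /back /= Y'E -shD addNr sh0.
have [k kE] := @probability_kernel_of R _ _ _ _ (fun z => u (back z))
  (fun B mB => measurableT_comp (measurable_kernel u B mB) mback) (fun z => prob_kernel (back z)).
split=> //; exists k; split.
  have [N [mN N0 NS]] := good_P.
  exists N; split=> //; first exact: P'_null.
  apply: subset_trans NS => w /= wN g; apply: wN => B mB.
  by rewrite kE backE uE// cell0E /mcond setIC.
move=> A B mA mB.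
transitivity (\int[P']_w ((\1_A (Y' w, T w))%:E * (\1_B (S w))%:E)).
  have mAB : measurable ((fun w => (Y' w, T w)) @^-1` A `&` S @^-1` B).
    by apply: measurableI; rewrite -[X in measurable X]setTI; [exact: mY'T|exact: mS].
  rewrite -[LHS]mul1e -(integral_cst P' mAB) [LHS]integral_mkcond.
  apply: eq_integral => w _; rewrite patchE !indicE.
  have -> : (w \in (fun w => (Y' w, T w)) @^-1` A `&` S @^-1` B) =
      ((Y' w, T w) \in A) && (S w \in B) by apply/idP/andP; rewrite !inE => -[].
  by case: (_ \in A); case: (_ \in B); rewrite /= ?mule1 ?mule0.
pose q z := u (back z) B.
have mq : measurable_fun setT q.
  exact: (measurableT_comp (measurable_kernel u B mB) mback).
rewrite (joint_law (F := fun y t i => (\1_A (y, t))%:E * (\1_B i)%:E)); last 2 first.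
- by apply: emeasurable_funM; apply: measurable_indicE => //; meas.
- by move=> y t i; apply: mule_ge0; rewrite lee_fin.
transitivity (\int[P']_w ((\1_A (Y' w, T w))%:E * q (Y' w, T w))); last first.
  rewrite [RHS]integral_mkcond; apply: eq_integral => w _.
  rewrite patchE indicE kE (_ : (w \in _) = ((Y' w, T w) \in A)).
    by case: (_ \in A); rewrite ?mul1e ?mul0e.
  by apply/idP/idP; rewrite !inE.
rewrite (joint_law (F := fun y t i => (\1_A (y, t))%:E * q (y, t))); last 2 first.
- apply: emeasurable_funM; first by apply: measurable_indicE => //; meas.
  by apply: (measurableT_comp mq); meas.
- by move=> y t i; apply: mule_ge0 => //; rewrite lee_fin.
apply: eq_integral => y _; apply: eq_integral => t _; congr (_ * _).
rewrite integral_cst// prob_kernel mule1 /q /back /= -shD addNr sh0.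
rewrite ge0_integralZl//; last exact/measurable_EFinP/measurable_indic.
by rewrite integral_indic// setIT.
Qed.

Section palm_measure.
Variable Q : {measure set M -> \bar R}.
Hypothesis QmE : forall A, Q A = P' (Y' @^-1` A).
Hypothesis Qint : forall f, measurable_fun setT f -> (forall y, 0 <= f y) ->
  \int[Q]_y f y = \int[P']_w f (Y' w).

Let QE := palm_law Qint.

(** With an integrand free of S, the right side of [joint_law] is a Campbell integral. Its other
    form integrates [t] against Lebesgue measure on the cube, whatever the configuration [y]. *)
Lemma cond_distribution_T : cond_distribution P' Y' T (fun=> mcond leb unit_cube).
Proof.
have mC := @measurable_unit_cube R d.
pose v : {measure set V -> \bar R} := mrestr leb mC.
have leb1 : leb unit_cube = 1 by exact: lebesgue_rV_unit_cube.
have v1 : v setT = 1 by rewrite /v /= /mrestr setTI.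
have [k kE] := @probability_kernel_of R _ _ _ _ (fun _ : M => v)
  (fun B mB => measurable_cst (v B)) (fun=> v1).
split=> //; exists k; split.
  exists set0; split=> //.
  move=> w /= wN; exfalso; apply: wN => B mB.
  by rewrite kE /mcond leb1 inve1 mule1.
move=> A B mA mB.
have mAB : measurable (Y' @^-1` A `&` T @^-1` B).
  by apply: measurableI; rewrite -[X in measurable X]setTI; [exact: mY'|exact: measurable_funPT].
transitivity (\int[P']_w ((\1_A (Y' w))%:E * (\1_B (T w))%:E)).
  rewrite -[LHS]mul1e -(integral_cst P' mAB) [LHS]integral_mkcond.
  apply: eq_integral => w _; rewrite patchE !indicE.
  have -> : (w \in Y' @^-1` A `&` T @^-1` B) =
      (Y' w \in A) && (T w \in B) by apply/idP/andP; rewrite !inE => -[].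
  by case: (_ \in A); case: (_ \in B); rewrite /= ?mule1 ?mule0.
rewrite (joint_law (F := fun y t _ => (\1_A y)%:E * (\1_B t)%:E)); last 2 first.
- by apply: emeasurable_funM; apply: measurable_indicE => //; meas.
- by move=> y t i; apply: mule_ge0; rewrite lee_fin.
pose G (y : M) (t : V) : \bar R := (\1_unit_cube t)%:E * ((\1_A y)%:E * (\1_B t)%:E).
have mG : measurable_fun setT (fun z : M * V => G z.1 z.2).
  apply: emeasurable_funM; first by apply: measurable_indicE => //; exact: measurable_snd.
  by apply: emeasurable_funM; apply: measurable_indicE.
have G0 y t : 0 <= G y t.
  by apply: mule_ge0; [rewrite lee_fin|apply: mule_ge0; rewrite lee_fin].
transitivity (\int[mu]_y \int[eta y]_t G (sh t y) t).
  apply: eq_integral => y _; apply: eq_integral => t _; congr (_ * _).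
  by rewrite integral_cst// prob_kernel mule1.
rewrite (campbell shD msh meta eta_sh smu mu_stationary QE mG G0).
rewrite Qint; last 2 first.
- exact: (measurable_fun_integral2 (f := fun z => G z.1 z.2) (sigma_finiteT leb)).
- by move=> y; exact: integral_ge0.
rewrite [RHS]integral_mkcond; apply: eq_integral => w _.
transitivity ((\1_A (Y' w))%:E * \int[leb]_t ((\1_unit_cube t)%:E * (\1_B t)%:E)).
  rewrite -ge0_integralZl//.
  - by apply: eq_integral => t _; rewrite /G muleCA.
  - by apply: emeasurable_funM; apply: measurable_indicE.
have -> : \int[leb]_t ((\1_unit_cube t)%:E * (\1_B t)%:E) = v B.
  have mBC : measurable (B `&` unit_cube) by exact: measurableI.
  rewrite -[RHS]mul1e -(integral_cst leb mBC) [RHS]integral_mkcond.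
  apply: eq_integral => t _; rewrite patchE !indicE.
  have -> : (t \in B `&` unit_cube) = (t \in B) && (t \in unit_cube).
    by apply/idP/andP; rewrite !inE => -[].
  by case: (_ \in B); case: (_ \in unit_cube); rewrite /= ?mule1 ?mule0.
rewrite patchE indicE kE (_ : (w \in _) = (Y' w \in A)).
  by case: (_ \in A); rewrite ?mul1e ?mul0e.
by apply/idP/idP; rewrite !inE.
Qed.

Lemma palm_version_Y' : palm_version theta P Y P' Y'.
Proof.
move=> f mf f0 B mB /andP[B0 Boo].
rewrite -(Qint mf f0).
have e := palm_formula shD msh meta eta_sh smu mu_stationary QE mB mf f0.
rewrite mu_int in e; last 2 first.
- rewrite (_ : (fun y => _) = fun y => \int[eta y]_t (f (sh t y) * (\1_B t)%:E)).
    apply: (measurable_integral_eta meta (y := fun y => y)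
      (g := fun y t => f (sh t y) * (\1_B t)%:E)) => //.
    + apply: emeasurable_funM; last by apply: measurable_indicE => //; meas.
      by apply: (measurableT_comp mf); meas.
    + by move=> y t; apply: mule_ge0 => //; rewrite lee_fin.
  apply/funext => y; rewrite integral_mkcond; apply: eq_integral => t _.
  by rewrite patchE indicE; case: ifP => _; rewrite ?mule1 ?mule0.
- by move=> y; exact: integral_ge0.
rewrite e -muleA divee ?mule1 ?gt_eqF// ge0_fin_numE// ltW.
Qed.

(** The Palm lemmas concern the law [Q]; sigma-finiteness, the null set of the support condition and
    the integral identity are pulled back along [Y']. *)
Lemma mass_stationary_Y' : mass_stationary theta P' Y'.
Proof.
have sY' : sigma_finite setT (pushforward P' Y').
  have [F FT Foo] := palm_sigma_finite sh0 shD msh meta eta_sh smu mu_stationary QE.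
  exists F => // n; have [mF Fn] := Foo n; split=> //.
  by rewrite /pushforward -QmE.
split=> //.
  have [N [mN N0 NS]] := palm_support shD msh meta eta_sh smu mu_stationary QE.
  exists (Y' @^-1` N); split.
  - by rewrite -[X in measurable X]setTI; exact: mY'.
  - by rewrite -QmE.
  - by move=> w /= h; exact: NS.
move=> C mC bC _ dC dO' O' P'' pr U W mpr prE cU cW A mA.
apply: (mass_stationary_palm msh meta mY' sY' mC _ mpr prE cU cW mA).
move=> F mF F0.
have := palm_mass_stationary shD msh meta eta_sh smu mu_stationary QE mC bC dC mF F0.
have mK := measurable_mass_kernel msh meta mC mF F0.
have K0 y u0 : 0 <= \int[eta y]_v ((\1_C (v + u0)%R)%:E *
    ((eta y [set x | C (x + u0)%R])^-1 * F (sh v y) (v + u0)%R)).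
  apply: integral_ge0 => v _; apply: mule_ge0; first by rewrite lee_fin.
  by apply: mule_ge0 => //; rewrite inve_ge0.
rewrite !Qint//.
- apply: (measurable_fun_integral2 (f := fun z : M * V => (\1_C z.2)%:E * F z.1 z.2)).
  + exact: (sigma_finiteT leb).
  + by apply: emeasurable_funM => //; apply: measurable_indicE => //; meas.
  + by move=> z; apply: mule_ge0 => //; rewrite lee_fin.
- by move=> y; apply: integral_ge0 => v _; apply: mule_ge0 => //; rewrite lee_fin.
- apply: (measurable_fun_integral2 (f := fun z : M * V => (\1_C z.2)%:E *
    \int[eta z.1]_v ((\1_C (v + z.2)%R)%:E *
    ((eta z.1 [set x | C (x + z.2)%R])^-1 * F (sh v z.1) (v + z.2)%R)))).
  + exact: (sigma_finiteT leb).
  + by apply: emeasurable_funM => //; apply: measurable_indicE => //; meas.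
  + by move=> z; apply: mule_ge0 => //; rewrite lee_fin.
- by move=> y; apply: integral_ge0 => v _; apply: mule_ge0 => //; rewrite lee_fin.
Qed.

End palm_measure.

End law.

End voronoi_palm.

Theorem theorem2 (R : realType) (d : nat) (dO dE : measure_display)
    (O : measurableType dO) (E : measurableType dE)
    (theta : 'rV[R]_d -> E -> E)
    (P P' : {measure set O -> \bar R})
    (X : {mfun O >-> E}) (xi : {mfun O >-> lf_measure R d})
    (T : {mfun O >-> 'rV[R]_d}) :
  let Y := fun w => (X w, xi w) in
  let D := fun w => voronoi_cell (xi w) 0 in
  let S := fun w => voronoi_vector (xi w) 0 in
  let D' := fun w => [set S w + j | j in D w] in
  let Y' := fun w => shift_pair theta (T w) (shift_pair theta (- S w) (Y w)) in
  measurable_action theta ->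
  stationary theta P Y ->
  {ae P, forall w, conv_hull (msupport (xi w)) = setT} ->
  (forall w, unit_cube (T w)) ->
  cond_distribution P Y T (fun w => mcond (shift_lf (- S w) (xi w)) unit_cube) ->
  (forall A : set O, measurable A ->
    P' A = \int[P]_(w in A)
      (shift_lf (- S w) (xi w) unit_cube / counting (D w)))%E ->
  [/\ mass_stationary theta P' Y',
      cond_distribution P' Y' T (fun=> mcond (lebesgue_rV d) unit_cube),
      cond_distribution P' (fun w => (Y' w, T w)) S
        (fun w => mcond counting (D' w)) &
      palm_version theta P Y P' Y'].
Proof.
move=> Y D S D' Y' act stat hull cube_T condT P'E.
have mY : measurable_fun setT Y by exact: measurable_fun_pair.
(* The Palm calculus runs on the space of pairs: [mu] is the law of [Y] under [P], and [Q] below is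
   the law of [Y'] under [P'], which [palm_law] identifies as the Palm measure of [mu]. *)
have [mu [muE mu_int]] := law_measure P mY.
have [u uE] := uniform_nucleus_kernel
  (@measurable_snd _ _ E (lf_measure R d)).
have mY' : measurable_fun setT Y' by exact: measurable_Y'.
have [Q [QmE Qint]] := law_measure P' mY'.
split.
- exact: (mass_stationary_Y' act stat hull condT P'E muE mu_int uE QmE Qint).
- exact: (cond_distribution_T act stat hull condT P'E muE mu_int uE Qint).
- exact: (cond_distribution_S act stat hull condT P'E muE mu_int uE).
- exact: (palm_version_Y' act stat hull condT P'E muE mu_int uE Qint).
Qed.
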